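(* Let $T$ be a complete countable dp-minimal theory with monster model $\mathcal U$. Let $M\prec N\prec\mathcal U$ be small models with $M$ countable and $N$ $\aleph_1$-saturated, and let $\phi(\bar x;d)\in L(N)$ be a formula (with $\bar x$ a finite tuple of variables and $d\in N$) which does not fork over $M$. Let $M\prec M_1\prec N$ satisfy: (0) $M_1$ is countable; (1) $\operatorname{tp}(d/M_1)$ is finitely satisfiable in $M$; (2) for every finite tuple $m\in M_1$ there is $d'\in M_1$ with $(m,d')\equiv_M(m,d)$; (3) for every finite tuple $m\in M_1$ there is a strict Morley sequence $(m_i:i<\omega)$ of $\operatorname{tp}(m/M)$ contained in $M_1$ with $m_0=m$. Then there is $\bar a\in\mathcal U$ with $\models\phi(\bar a;d)$ such that $\operatorname{tp}(\bar a/N)$ is $M$-invariant and commutes over $M_1$ with every coheir of $\operatorname{tp}(d/M)$ which extends $\operatorname{tp}(d/M_1)$.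
   Context: $T$ is dp-minimal if every partial type in one variable has dp-rank $\le1$ (for every realization $a$ and two sequences mutually indiscernible over the parameter set $A$, one is indiscernible over $Aa$); such $T$ is NIP. A type over $N$ is $M$-invariant if it does not distinguish tuples of $N$ having the same type over $M$; it is identified with its unique global $M$-invariant extension. For global $M$-invariant types $p(x),q(y)$, $p_x\otimes q_y=\operatorname{tp}(a,b/\mathcal U)$ with $b\models q$, $a\models p|_{\mathcal U b}$; $p,q$ commute over $M_1$ if $p_x\otimes q_y$ and $q_y\otimes p_x$ have the same restriction to $M_1$. A coheir of $\operatorname{tp}(d/M)$ is a global extension finitely satisfiable in $M$. $\operatorname{tp}(b/C)$, $C\supseteq M$, is strictly non-forking over $M$ if it extends to a global $\operatorname{tp}(b^*/\mathcal U)$ with both $\operatorname{tp}(b^*/\mathcal U)$ and $\operatorname{tp}(\mathcal U/Mb^* )$ non-forking over $M$. A strict Morley sequence of $\operatorname{tp}(m/M)$ is an $M$-indiscernible sequence of realizations of $\operatorname{tp}(m/M)$ with each $\operatorname{tp}(m_i/m_{<i}M)$ strictly non-forking over $M$. *)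

(* Defs.v *)
From mathcomp Require Import all_boot.
From mathcomp Require Import boolp classical_sets functions cardinality.

Set Implicit Arguments.
Unset Strict Implicit.
Unset Printing Implicit Defensive.

Local Open Scope classical_set_scope.

Record language := Language {
  fun_symb : Type;
  fun_ar : fun_symb -> nat;
  rel_symb : Type;
  rel_ar : rel_symb -> nat }.

Definition countable_language (L : language) : Prop :=
  countable [set: fun_symb L] /\ countable [set: rel_symb L].

Section Syntax.
Variable L : language.

(* The free variables of a term or formula are indexed by a type [V]; the
   variable bound by [All] is the [None] of [option V]. *)
Inductive term (V : Type) : Type :=
| Var of V
| App (f : fun_symb L) of ('I_(fun_ar f) -> term V).

Inductive formula (V : Type) : Type :=
| Eq of term V & term V
| Rel (R : rel_symb L) of ('I_(rel_ar R) -> term V)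
| Bot
| Imp of formula V & formula V
| All of formula (option V).

Definition Not (V : Type) (phi : formula V) : formula V := Imp phi (Bot V).

Definition sentence : Type := formula void.

Record structure := Structure {
  carrier :> Type;
  carrier_inhabited : inhabited carrier;
  fun_int : forall f : fun_symb L, ('I_(fun_ar f) -> carrier) -> carrier;
  rel_int : forall R : rel_symb L, ('I_(rel_ar R) -> carrier) -> Prop }.

End Syntax.

Arguments App {L V} f _.
Arguments Rel {L V} R _.
Arguments Bot {L V}.

Definition extend (V W : Type) (e : V -> W) (w : W) (o : option V) : W :=
  if o is Some v then e v else w.

(* Concatenation of two tuples indexed by [X] and [Y]. *)
Definition tcat (W X Y : Type) (a : X -> W) (b : Y -> W) (z : X + Y) : W :=
  match z with inl x => a x | inr y => b y end.

Section Semantics.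
Variables (L : language) (S : structure L).

Fixpoint eval (V : Type) (e : V -> S) (t : term L V) : S :=
  match t with
  | Var v => e v
  | App f ts => fun_int (fun i => eval e (ts i))
  end.

Fixpoint sat (V : Type) (e : V -> S) (phi : formula L V) : Prop :=
  match phi with
  | Eq t u => eval e t = eval e u
  | Rel R ts => rel_int (fun i => eval e (ts i))
  | Bot => False
  | Imp phi1 phi2 => sat e phi1 -> sat e phi2
  | All phi1 => forall w : S, sat (extend e w) phi1
  end.

Definition sat_sentence (s : sentence L) : Prop := sat (of_void S) s.

Definition models (T : set (sentence L)) : Prop :=
  forall s, T s -> sat_sentence s.

Definition automorphism (f : S -> S) : Prop :=
  [/\ bijective f,
      forall (g : fun_symb L) (e : 'I_(fun_ar g) -> S),
        f (fun_int e) = fun_int (f \o e) &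
      forall (R : rel_symb L) (e : 'I_(rel_ar R) -> S),
        rel_int e <-> rel_int (f \o e)].

End Semantics.

Definition entails (L : language) (T : set (sentence L)) (s : sentence L) :=
  forall S : structure L, models S T -> sat_sentence S s.

Definition complete_theory (L : language) (T : set (sentence L)) : Prop :=
  (exists S : structure L, models S T) /\
  forall s : sentence L, entails T s \/ entails T (Not s).

Definition elementary (L : language) (S S' : structure L) (f : S -> S') :=
  forall (V : Type) (phi : formula L V) (e : V -> S),
    sat e phi <-> sat (f \o e) phi.

Record substructure (L : language) (U : structure L) := Substructure {
  sub_set :> set U;
  sub_nonempty : sub_set !=set0;
  sub_closed : forall (f : fun_symb L) (e : 'I_(fun_ar f) -> U),
    (forall i, sub_set (e i)) -> sub_set (fun_int e) }.

Section Substructures.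
Variables (L : language) (U : structure L).

Lemma sub_inhabited (M : substructure U) : inhabited {u : U | sub_set M u}.
Proof. by case: (sub_nonempty M) => u Mu; constructor; exists u. Qed.

Definition induced (M : substructure U) : structure L :=
  @Structure L {u : U | sub_set M u} (sub_inhabited M)
    (fun f e => exist (sub_set M) (fun_int (fun i => sval (e i)))
                  (@sub_closed L U M f _ (fun i => proj2_sig (e i))))
    (fun R e => rel_int (fun i => sval (e i))).

Definition sub_incl (M N : substructure U) (MN : sub_set M `<=` sub_set N)
  (u : induced M) : induced N := exist (sub_set N) (sval u) (MN _ (proj2_sig u)).

Definition elem_sub (M N : substructure U) : Prop :=
  exists MN : sub_set M `<=` sub_set N, elementary (sub_incl MN).

Definition elem_sub_in (M : substructure U) : Prop :=
  elementary (fun u : induced M => sval u : U).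

End Substructures.

(* [pform U X] is the type of L(U)-formulas phi(x; b), x = (x_i : i in X)
   and b a finite tuple of [U]. *)
Record pform (L : language) (U : structure L) (X : Type) := Pform {
  pf_ar : nat;
  pf_fml : formula L (X + 'I_pf_ar);
  pf_par : 'I_pf_ar -> U }.

Arguments Pform {L U X pf_ar} _ _.
Arguments pf_par {L U X} _ _.

Definition pf_map (L : language) (U V : structure L) (j : U -> V) (X : Type)
  (phi : pform U X) : pform V X := Pform (pf_fml phi) (j \o pf_par phi).

Section Types.
Variables (L : language) (U : structure L).
Implicit Types (A B M : set U) (X Y : Type).

Definition psat X (a : X -> U) (phi : pform U X) : Prop :=
  sat (tcat a (pf_par phi)) (pf_fml phi).

Definition pf_not X (phi : pform U X) : pform U X :=
  Pform (Not (pf_fml phi)) (pf_par phi).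

Definition pf_over A X : set (pform U X) :=
  [set phi | forall i, A (pf_par phi i)].

Definition realizes X (a : X -> U) (p : set (pform U X)) : Prop :=
  forall phi, p phi -> psat a phi.

Definition tuple_in A X (a : X -> U) : Prop := forall i, A (a i).

Definition finsat_in A X (p : set (pform U X)) : Prop :=
  forall s : set (pform U X), finite_set s -> s `<=` p ->
  exists2 a : X -> U, tuple_in A a & realizes a s.

Definition partial_type A X (p : set (pform U X)) : Prop :=
  p `<=` @pf_over A X /\ finsat_in setT p.

Definition complete_type A X (p : set (pform U X)) : Prop :=
  partial_type A p /\
  forall phi, pf_over A phi -> p phi \/ p (pf_not phi).

Definition tp X (a : X -> U) A : set (pform U X) :=
  [set phi | pf_over A phi /\ psat a phi].

Definition restrict_type X (p : set (pform U X)) A : set (pform U X) :=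
  p `&` @pf_over A X.

Definition eq_tp A X (a b : X -> U) : Prop := tp a A = tp b A.

Definition saturated (small : set U -> Prop) : Prop :=
  forall A, small A ->
  forall (n : nat) (p : set (pform U 'I_n)), partial_type A p ->
  exists a : 'I_n -> U, realizes a p.

Definition strongly_homogeneous (small : set U -> Prop) : Prop :=
  forall (I : Type) (a b : I -> U), small (range a) -> eq_tp set0 a b ->
  exists2 f : U -> U, automorphism f & f \o a = b.

Definition invariant_type M N X (p : set (pform U X)) : Prop :=
  forall (k : nat) (phi : formula L (X + 'I_k)) (b c : 'I_k -> U),
    tuple_in N b -> tuple_in N c -> eq_tp M b c ->
    p (Pform phi b) <-> p (Pform phi c).

Definition coheir M X (d : X -> U) (q : set (pform U X)) : Prop :=
  [/\ complete_type setT q, tp d M `<=` q & finsat_in M q].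

Definition linear_order (I : Type) (lt : I -> I -> Prop) : Prop :=
  [/\ forall i, ~ lt i i,
      forall i j k, lt i j -> lt j k -> lt i k &
      forall i j, [\/ lt i j, i = j | lt j i]].

Definition increasing (I : Type) (lt : I -> I -> Prop) n (i : 'I_n -> I) :=
  forall x y : 'I_n, (x < y)%N -> lt (i x) (i y).

Definition indiscernible (I : Type) (lt : I -> I -> Prop) A X
    (a : I -> X -> U) : Prop :=
  forall (n : nat) (i j : 'I_n -> I), increasing lt i -> increasing lt j ->
  eq_tp A (fun z : 'I_n * X => a (i z.1) z.2)
          (fun z : 'I_n * X => a (j z.1) z.2).

Definition seq_set (I X : Type) (a : I -> X -> U) : set U :=
  [set u | exists i x, u = a i x].

Definition mutually_indiscernible (I J : Type) (ltI : I -> I -> Prop)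
    (ltJ : J -> J -> Prop) A X Y (a : I -> X -> U) (b : J -> Y -> U) : Prop :=
  indiscernible ltI (A `|` seq_set b) a /\
  indiscernible ltJ (A `|` seq_set a) b.

Definition divides A X (phi : pform U X) : Prop :=
  exists (k : nat) (b : nat -> 'I_(pf_ar phi) -> U),
    (forall i, eq_tp A (b i) (pf_par phi)) /\
    forall f : 'I_k -> nat, injective f ->
      ~ exists a : X -> U, forall j, psat a (Pform (pf_fml phi) (b (f j))).

Definition forks A X (phi : pform U X) : Prop :=
  exists s : set (pform U X),
    [/\ finite_set s, forall psi, s psi -> divides A psi &
        forall a : X -> U, psat a phi -> exists2 psi, s psi & psat a psi].

Definition nonforking A X (p : set (pform U X)) : Prop :=
  forall phi, p phi -> ~ forks A phi.

End Types.

Definition card_lt (S S' : Type) (A : set S) (B : set S') : Prop :=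
  (A #<= B)%card /\ ~ (B #<= A)%card.

Section Monster.
Variable L : language.
Implicit Types U V : structure L.

(* Cardinals are represented by types: small means of cardinality < |K|. *)
Definition small (K S : Type) (A : set S) : Prop := card_lt A [set: K].

Definition strong_limit (K : Type) : Prop :=
  forall A : set K, small K A -> small K [set B : set K | B `<=` A].

Definition monster (K : Type) U : Prop :=
  [/\ small K [set: nat], strong_limit K,
      @saturated L U (@small K U) & @strongly_homogeneous L U (@small K U)].

(* Sequences are indexed by arbitrary small infinite linear orders; with finite
   sequences allowed the notion would be much too strong. *)
Definition dp_rank_le1 (K : Type) U (A : set U) X (p : set (pform U X)) :=
  forall a : X -> U, realizes a p ->
  forall (I J : Type) (ltI : I -> I -> Prop) (ltJ : J -> J -> Prop)
         (k l : nat) (b : I -> 'I_k -> U) (c : J -> 'I_l -> U),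
    linear_order ltI -> linear_order ltJ ->
    infinite_set [set: I] -> infinite_set [set: J] ->
    small K [set: I] -> small K [set: J] ->
    mutually_indiscernible ltI ltJ A b c ->
    indiscernible ltI (A `|` range a) b \/
    indiscernible ltJ (A `|` range a) c.

Definition dp_minimal (K : Type) U : Prop :=
  forall (A : set U) (p : set (pform U 'I_1)),
    small K A -> partial_type A p -> dp_rank_le1 K A p.

(* b* is taken in a larger monster model V, of which U is a small elementary
   submodel; tp(U/Mb* ) is the type of U enumerated by itself. *)
Definition strictly_nonforking U (M C : set U) X (b : X -> U) : Prop :=
  exists (K : Type) (V : structure L) (j : U -> V) (bs : X -> V),
    [/\ monster K V, elementary j & small K (range j)] /\
    [/\ forall phi, tp b C phi -> psat bs (pf_map j phi),
        nonforking (j @` M) (tp bs (range j)) &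
        nonforking (j @` M) (tp j (j @` M `|` range bs))].

Definition strict_morley U (M : set U) X (m : X -> U) (s : nat -> X -> U) :=
  [/\ indiscernible (fun i j => (i < j)%N) M s,
      forall i, realizes (s i) (tp m M) &
      forall i, strictly_nonforking M
        (M `|` [set u | exists j x, (j < i)%N /\ u = s j x]) (s i)].

(* For an M-invariant global type p and a set B of an elementary extension V
   of U: the formulas over B of the M-invariant extension of p to V. *)
Definition inv_ext U V (j : U -> V) (M : set U) X (p : set (pform U X))
    (B : set V) : set (pform V X) :=
  [set phi | pf_over B phi /\
     exists2 c : 'I_(pf_ar phi) -> U,
       eq_tp (j @` M) (j \o c) (pf_par phi) & p (Pform (pf_fml phi) c)].

(* The order of the factors in p_x (x) q_y: first b |= q, then a |= p|Ub. *)
Definition realizes_product U V (j : U -> V) (M : set U) X Y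
    (p : set (pform U X)) (q : set (pform U Y)) (a : X -> V) (b : Y -> V) :=
  (forall phi, q phi -> psat b (pf_map j phi)) /\
  realizes a (inv_ext j M p (range j `|` range b)).

(* p_x (x) q_y and q_y (x) p_x have the same restriction to M1; the formulas
   over M1 are in the variables (x, y) for both products. *)
Definition commute_over U (M M1 : set U) X Y
    (p : set (pform U X)) (q : set (pform U Y)) : Prop :=
  forall (V V' : structure L) (j : U -> V) (j' : U -> V')
         (a : X -> V) (b : Y -> V) (a' : X -> V') (b' : Y -> V'),
    elementary j -> elementary j' ->
    realizes_product j M p q a b -> realizes_product j' M q p b' a' ->
    forall phi : pform U (X + Y), pf_over M1 phi ->
      psat (tcat a b) (pf_map j phi) <-> psat (tcat a' b') (pf_map j' phi).

End Monster.

(* Main.v *)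
(* Since d is a small tuple, N plays no role: it suffices to find a global M-invariant
   type p containing phi(x; d) and commuting over M1 with the coheirs of tp(d/M) that
   extend tp(d/M1), and to realize p over N.  By NIP (alternating sequences, which (2)
   brings into M1), all these coheirs coincide; call their common value q.  By NIP and a
   variant of the broom lemma, a non-forking formula lies in an M-invariant type.

   The type p is built one variable at a time.  Given R(x', x; d, m) in some invariant
   type, replace d by a copy d' in M1 and take in M1 a strict Morley sequence (s_i) of
   (m, d').  By induction there is a commuting invariant p'(x') containing the formula
   "R(x', x; s_0) and R(x', x; s_1) have a common solution x"; strictness and NIP in the
   single variable x imply that R(x', x; d, m) lies in an invariant extension of p'.
   Among the invariant extensions of p', commuting at a given formula R(x', x; y, m)
   is open and dense: let p contain R(.; d, m) while q(y) does not contain R(a; y, m)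
   for a realizing p over m.  Take a' realizing p' over M1, a Morley sequence e, e_0, ...
   of q over M1 a', continued by d_0, ....  By dp-minimality, for every b such that
   (a', b) realizes p over m, e_0, d_0 one of the two halves is indiscernible over
   M1 a' b, and it must be the first one; hence R(a', b; e, m).  By compactness a formula
   over m, e_0, d_0 is responsible for this, and by finite satisfiability e_0 and d_0 can
   be moved into M.  As p' commutes with q, this yields a formula over M1 which is
   consistent with p' in an invariant type and implies R(.; d, m), and also that q
   contains R(a; y, m), modulo p'.  The language and M1 being countable, a Baire category
   argument produces an invariant extension of p' commuting with q. *)
Require Import Defs.
From mathcomp Require Import all_boot.
From mathcomp Require Import boolp classical_sets functions cardinality.
From mathcomp Require Import filter zify.

Set Implicit Arguments.
Unset Strict Implicit.
Unset Printing Implicit Defensive.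

Local Open Scope classical_set_scope.

(** * Renaming of variables and countability *)

(** Dp-minimality speaks about one element over a base, whence the induction on variables: the tuple
    already built goes into the base. NIP enters only through the bound [nip], obtained by halving a
    linear order once per variable: along an indiscernible sequence, an n-tuple cannot make a
    formula disagree on each of [2 ^ n] disjoint consecutive pairs. For one variable this is 2, so
    two terms of a strict Morley sequence suffice. Invariance is handled through pairs [(c, e)] that
    begin a Morley sequence of a coheir over [M]. Countably many conjugates have a common partner
    [e], so a type that agrees on all such pairs is invariant; and the formula saying that [c] and
    [e] disagree divides over [M]. In the density step the separate term [E 0] is kept out of the
    formula found by compactness, so that it still realizes [Q] over [M1] and [a'], where the
    commutation of [p'] applies. Types are ultrafilters of tuples of [U]: completeness and limits of
    types then come for free, and coheirs are the ultrafilters concentrated on tuples of [M]. *)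

Section Renaming.
Variable L : language.

Fixpoint trename (V W : Type) (f : V -> W) (t : term L V) : term L W :=
  match t with
  | Var v => Var L (f v)
  | App g ts => App g (fun i => trename f (ts i))
  end.

Fixpoint frename (V : Type) (phi : formula L V) :
    forall W : Type, (V -> W) -> formula L W :=
  match phi with
  | Eq t u => fun W f => Eq (trename f t) (trename f u)
  | Rel R ts => fun W f => Rel R (fun i => trename f (ts i))
  | Bot => fun W f => Bot
  | Imp phi1 phi2 => fun W f => Imp (frename phi1 f) (frename phi2 f)
  | All phi1 => fun W f => All (frename phi1 (omap f))
  end.

Lemma eval_rename (S : structure L) V W (f : V -> W) (e : W -> S) t :
  eval e (trename f t) = eval (e \o f) t.
Proof. by elim: t => //= g ts IH; congr fun_int; apply: funext. Qed.

Lemma sat_rename (S : structure L) V (phi : formula L V) W (f : V -> W)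
  (e : W -> S) : sat e (frename phi f) <-> sat (e \o f) phi.
Proof.
elim: phi W f e => [{}V t u|{}V R ts|{}V|{}V p1 IH1 p2 IH2|{}V p IH] W f e /=.
- by rewrite !eval_rename.
- rewrite (_ : (fun i => _) = (fun i => eval (e \o f) (ts i))) //.
  by apply: funext => i; rewrite eval_rename.
- by [].
- by split=> H /IH1 /H /IH2.
- have E w : extend e w \o omap f = extend (e \o f) w by apply: funext => -[].
  by split=> H w; have := H w; rewrite IH E.
Qed.

Lemma sat_ext (S : structure L) V (phi : formula L V) (e e' : V -> S) :
  e =1 e' -> sat e phi -> sat e' phi.
Proof. by move=> /funext ->. Qed.

Lemma trename_comp V W Z (f : V -> W) (g : W -> Z) t :
  trename g (trename f t) = trename (g \o f) t.
Proof. by elim: t => //= h ts IH; congr App; apply: funext. Qed.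

Lemma frename_comp V (phi : formula L V) W Z (f : V -> W) (g : W -> Z) :
  frename (frename phi f) g = frename phi (g \o f).
Proof.
elim: phi W Z f g => [{}V t u|{}V R ts|{}V|{}V p1 IH1 p2 IH2|{}V p IH] W Z f g /=.
- by rewrite !trename_comp.
- by congr Rel; apply: funext => i; rewrite trename_comp.
- by [].
- by rewrite IH1 IH2.
- by rewrite IH; congr (All (frename _ _)); apply: funext => -[].
Qed.

Lemma term_support V (t : term L V) :
  exists (W : finType) (u : term L W) (f : W -> V), t = trename f u.
Proof.
elim: t => [v|g ts IH]; first by exists unit, (Var L tt), (fun=> v).
have /choice[F HF] : forall i, exists s : {W : finType & (term L W * (W -> V))%type},
    ts i = trename (projT2 s).2 (projT2 s).1.
  by move=> i; have [W [u [f ->]]] := IH i; exists (existT _ W (u, f)).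
pose W := fun i => projT1 (F i).
exists {i : 'I_(fun_ar g) & W i},
  (App g (fun i => trename (Tagged W (i:=i)) (projT2 (F i)).1)),
  (fun s => (projT2 (F (tag s))).2 (tagged s)).
by rewrite /=; congr App; apply: funext => i; rewrite trename_comp HF.
Qed.

(** Parameters are fed to formulas through variables indexed by all of [induced M] or of [U]. The
    finite support turns such a formula back into one with a finite tuple of parameters, as [pform]
    demands. *)
Lemma formula_support V (phi : formula L V) :
  exists (W : finType) (psi : formula L W) (f : W -> V), phi = frename psi f.
Proof.
elim: phi => {V} [V t u|V R ts|V|V p1 [W1 [q1 [f1 ->]]] p2 [W2 [q2 [f2 ->]]]|
                  V p [W1 [q [f1 E]]]].
- have [W1 [t1 [f1 ->]]] := term_support t.
  have [W2 [u1 [f2 ->]]] := term_support u.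
  exists (W1 + W2)%type, (Eq (trename inl t1) (trename inr u1)),
    (fun s => match s with inl x => f1 x | inr y => f2 y end).
  by rewrite /= !trename_comp.
- have /choice[F HF] : forall i,
      exists s : {W : finType & (term L W * (W -> V))%type},
      ts i = trename (projT2 s).2 (projT2 s).1.
    by move=> i; have [W [u [f ->]]] := term_support (ts i); exists (existT _ W (u, f)).
  pose W := fun i => projT1 (F i).
  exists {i : 'I_(rel_ar R) & W i},
    (Rel R (fun i => trename (Tagged W (i:=i)) (projT2 (F i)).1)),
    (fun s => (projT2 (F (tag s))).2 (tagged s)).
  by rewrite /=; congr Rel; apply: funext => i; rewrite trename_comp HF.
- by exists void, Bot, (of_void V).
- exists (W1 + W2)%type, (Imp (frename q1 inl) (frename q2 inr)),
    (fun s => match s with inl x => f1 x | inr y => f2 y end).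
  by rewrite /= !frename_comp.
(* Variables that [f1] sends to the bound [None] leave the support; [insub] in [g] sends them back
   to [None]. *)
- pose W := {w : W1 | isSome (f1 w)}.
  pose f (w : W) : V := match f1 (val w) as o return isSome o -> V with
    | Some v => fun=> v | None => fun h => False_rect _ (notF h) end (valP w).
  pose g (w : W1) : option W := insub w.
  exists W, (All (frename q g)), f.
  rewrite /= frename_comp E; congr (All (frename _ _)).
  apply: funext => w /=; rewrite /g; case: insubP => [u wP uw|] /=.
    rewrite /f; move: (valP u); rewrite uw; move: wP; case: (f1 w) => //.
  by case: (f1 w).
Qed.

Lemma all_ord n Y (phi : formula L ('I_n + Y)) :
  exists psi : formula L Y, forall (S : structure L) (e : Y -> S),
    sat e psi <-> forall x : 'I_n -> S, sat (tcat x e) phi.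
Proof.
elim: n Y phi => [|n IH] Y phi.
  pose r (s : 'I_0 + Y) : Y :=
    match s with inl x => False_rect _ (notF (valP x)) | inr y => y end.
  exists (frename phi r) => S e; rewrite sat_rename; split=> [H x|H].
    by apply: sat_ext H => -[[]|].
  by apply: sat_ext (H (fun x => False_rect _ (notF (valP x)))) => -[[]|].
pose r (s : 'I_n.+1 + Y) : 'I_n + option Y :=
  match s with
  | inl x => if unlift ord0 x is Some i then inl i else inr None
  | inr y => inr (Some y)
  end.
have [psi Hpsi] := IH _ (frename phi r).
exists (All psi) => S e /=; split=> [H x|H w].
  have /Hpsi/(_ (fun i => x (lift ord0 i)))/sat_rename := H (x ord0).
  by apply: sat_ext => -[i|y] //=; case: unliftP => [j ->|->].
apply/Hpsi => x; apply/sat_rename.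
apply: sat_ext (H (fun i => if unlift ord0 i is Some j then x j else w)).
by move=> -[i|y] //=; case: unliftP.
Qed.

Lemma all_fin (X : finType) Y (phi : formula L (X + Y)) :
  exists psi : formula L Y, forall (S : structure L) (e : Y -> S),
    sat e psi <-> forall x : X -> S, sat (tcat x e) phi.
Proof.
pose r (s : X + Y) : 'I_#|X| + Y :=
  match s with inl x => inl (enum_rank x) | inr y => inr y end.
have [psi Hpsi] := all_ord (frename phi r).
exists psi => S e; rewrite Hpsi; split=> H x.
  have /sat_rename := H (x \o enum_val).
  by apply: sat_ext => -[i|y] //=; rewrite enum_rankK.
by apply/sat_rename; apply: sat_ext (H (x \o enum_rank)) => -[].
Qed.

Lemma conj_ord n V (phi : 'I_n -> formula L V) :
  exists psi : formula L V, forall (S : structure L) (e : V -> S),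
    sat e psi <-> forall i, sat e (phi i).
Proof.
elim: n phi => [|n IH] phi.
  by exists (Imp Bot Bot) => S e; split=> // _ [].
have [psi Hpsi] := IH (fun i => phi (lift ord0 i)).
exists (Not (Imp (phi ord0) (Not psi))) => S e /=; split=> [H i|H nH]; last first.
  by apply: nH => //; apply/Hpsi.
apply: contrapT => ni; apply: H => H0 /Hpsi H1; apply: ni.
by case: (unliftP ord0 i) => [j ->|->].
Qed.

(** The variables from [S] name all elements of [S] as parameters. The existential statement is a
    single formula, read in both structures, so elementarity reflects it. *)
Lemma elementary_ex (S S' : structure L) (j : S -> S') (X : finType) n
    (phi : 'I_n -> formula L (X + S)) : elementary j ->
  (exists x : X -> S', forall i, sat (tcat x j) (phi i)) ->
  exists x : X -> S, forall i, sat (tcat x id) (phi i).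
Proof.
move=> ej [x Hx]; have [psi Hpsi] := conj_ord phi.
have [chi Hchi] := all_fin (Not psi).
apply: contrapT => nx.
have : sat (id : S -> S) chi by apply/Hchi => y /Hpsi Hy; apply: nx; exists y.
by move=> /ej /Hchi /(_ x); apply; apply/Hpsi.
Qed.

Lemma sat_automorphism (S : structure L) (f : S -> S) : automorphism f ->
  forall V (phi : formula L V) (e : V -> S), sat e phi <-> sat (f \o e) phi.
Proof.
move=> [fbij ff fR].
have Et V (e : V -> S) t : eval (f \o e) t = f (eval e t).
  by elim: t => //= g ts IH; rewrite ff; congr fun_int; apply: funext.
move=> V phi; elim: phi => {V} [V t u|V R ts|V|V p1 IH1 p2 IH2|V p IH] e /=.
- by rewrite !Et; split=> [->//|/(bij_inj fbij)].
- rewrite fR (_ : (fun i => eval (f \o e) (ts i)) = f \o (fun i => eval e (ts i))) //.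
  by apply: funext => i; rewrite Et.
- by [].
- by rewrite IH1 IH2.
- have E w : f \o extend e w = extend (f \o e) (f w) by apply: funext => -[].
  have [g fK gK] := fbij; split=> H w.
    by have /IH := H (g w); rewrite E gK.
  by apply/IH; rewrite E; exact: H.
Qed.

End Renaming.

Section Countability.
Variable L : language.
Hypothesis countL : countable_language L.

(** Formulas inject into finitely branching trees of natural numbers. The tags 0 to 3 belong to the
    other constructors, whence the shift by 4 on relation symbols; under [All] the bound variable
    gets 0 and the others move up by one. *)
Lemma formula_code (V : countType) : exists c : formula L V -> nat, injective c.
Proof.
have [/countable_injP[cf cfI] /countable_injP[cr crI]] := countL.
have {}cfI : injective cf by move=> x y; apply: cfI; rewrite in_setT.
have {}crI : injective cr by move=> x y; apply: crI; rewrite in_setT.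
pose tc := fix tc (V : Type) (e : V -> nat) (t : term L V) : GenTree.tree nat :=
  match t with
  | Var v => GenTree.Leaf (e v)
  | App f ts => GenTree.Node (cf f) [seq tc V e (ts i) | i <- enum 'I_(fun_ar f)]
  end.
pose fc := fix fc (V : Type) (phi : formula L V) : (V -> nat) -> GenTree.tree nat :=
  match phi with
  | Eq t u => fun e => GenTree.Node 0 [:: tc V e t; tc V e u]
  | Rel R ts => fun e => GenTree.Node (cr R).+4 [seq tc V e (ts i) | i <- enum 'I_(rel_ar R)]
  | Bot => fun e => GenTree.Node 1 [::]
  | Imp p q => fun e => GenTree.Node 2 [:: fc V p e; fc V q e]
  | All p => fun e => GenTree.Node 3 [:: fc (option V) p (fun o => if o is Some v then (e v).+1 else 0)]
  end.
have tcI V' (e : V' -> nat) : injective e -> injective (tc V' e).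
  move=> eI; elim=> [v|f ts IH] [w|g us] //=; first by case=> /eI ->.
  case=> /cfI fg; subst g => H; congr App; apply: funext => i; apply: IH.
  by move/eq_in_map: H; apply; rewrite mem_enum.
suff fcI V' (phi psi : formula L V') (e : V' -> nat) :
    injective e -> fc V' phi e = fc V' psi e -> phi = psi.
  exists (fun phi => choice.pickle (fc V phi choice.pickle)) => phi psi.
  move=> /(pcan_inj choice.pickleK); apply: fcI.
  exact: (pcan_inj choice.pickleK).
elim: phi psi e => {V V'} [V t u|V R ts|V|V p1 IH1 p2 IH2|V p IH] [t' u'|R' ts'||q1 q2|q] e eI //=.
- by case=> /(tcI _ _ eI) -> /(tcI _ _ eI) ->.
- case=> /crI RR; subst R' => H; congr Rel; apply: funext => i; apply: (tcI _ _ eI).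
  by move/eq_in_map: H; apply; rewrite mem_enum.
- by case=> /(IH1 _ _ eI) -> /(IH2 _ _ eI) ->.
- case=> /IH ->// [x|] [y|] //= [] /eI -> //.
Qed.

End Countability.

Lemma tcat_comp (W W' X Y : Type) (f : W -> W') (a : X -> W) (b : Y -> W) :
  f \o tcat a b = tcat (f \o a) (f \o b).
Proof. by apply: funext => -[]. Qed.

(** The variables of [X] stay, the others that occur are numbered, and [g] records their origin.
    [w0] is a dummy value of [g] at numbers that come from [X]. *)
Lemma parametric_formula (L : language) (X : finType) (Y W : Type) (w0 : W)
    (phi : formula L ((X + Y) + W)) :
  exists (k : nat) (psi : formula L (X + 'I_k)) (g : 'I_k -> Y + W),
  forall (S : structure L) (x : X -> S) (c : Y -> S) (m : W -> S),
    sat (tcat (tcat x c) m) phi <-> sat (tcat x (tcat c m \o g)) psi.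
Proof.
have [Z [psi [f ->]]] := formula_support phi.
pose r z : X + 'I_#|Z| :=
  if f z is inl (inl x) then inl x else inr (enum_rank z).
pose g (i : 'I_#|Z|) : Y + W := match f (enum_val i) with
  | inl (inl _) => inr w0 | inl (inr y) => inl y | inr w => inr w end.
exists #|Z|, (frename psi r), g => S x c m; rewrite !sat_rename.
suff -> : tcat (tcat x c) m \o f = tcat x (tcat c m \o g) \o r by [].
apply: funext => z /=; rewrite /r /g.
by case E : (f z) => [[a|y]|w] //=; rewrite enum_rankK E.
Qed.

(** * Ultrafilters and the finite intersection property *)

Section UltraFilterFacts.
Variables (T : Type) (F : set_system T).
Hypothesis FU : UltraFilter F.

Lemma ultra_not P : F (~` P) <-> ~ F P.
Proof.
split=> [FnP FP|nFP].
  by have [x []] := filter_ex (filterI FP FnP).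
by case: (in_ultra_setVsetC P FU).
Qed.

Lemma ultra_image T' (f : T -> T') : UltraFilter [set P : set T' | F (f @^-1` P)].
Proof.
have PF : ProperFilter [set P : set T' | F (f @^-1` P)].
  split; last split.
  - by rewrite /= preimage_set0; exact: filter_not_empty.
  - by rewrite /= preimage_setT; exact: filterT.
  - by move=> P Q; exact: filterI.
  - by move=> P Q PQ; apply: filterS => x; exact: PQ.
split=> // G GF FG; apply/seteqP; split=> // P GP.
case: (in_ultra_setVsetC (f @^-1` P) FU) => // FnP.
have /FG GnP : F (f @^-1` (~` P)) by [].
by have [x []] := filter_ex (filterI GP GnP).
Qed.

End UltraFilterFacts.

Lemma directed_ultra (T : Type) (D : set (set T)) : D !=set0 ->
  (forall P, D P -> P !=set0) ->
  (forall P Q, D P -> D Q -> exists2 R, D R & R `<=` P `&` Q) ->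
  exists F : set_system T, UltraFilter F /\ D `<=` F.
Proof.
move=> [P0 DP0] Dn0 DI.
have PF : ProperFilter (filter_from D id).
  apply: filter_from_proper; last exact: Dn0.
  by apply: filter_from_filter; [exists P0|exact: DI].
have [F [FU DF]] := ultraFilterLemma PF.
by exists F; split=> // P DP; apply: DF; exists P.
Qed.

Inductive meets (T : Type) (D : set (set T)) : set T -> Prop :=
| MeetT : meets D setT
| MeetI P Q : D P -> meets D Q -> meets D (P `&` Q).

Lemma meets_I T (D : set (set T)) P Q :
  meets D P -> meets D Q -> meets D (P `&` Q).
Proof.
move=> mP mQ; elim: mP => [|P1 P2 DP1 _ IH]; first by rewrite setTI.
by rewrite -setIA; apply: MeetI.
Qed.

Lemma meets_in T (D : set (set T)) P : D P -> meets D P.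
Proof. by move=> DP; rewrite -(setIT P); apply: MeetI => //; exact: MeetT. Qed.

Lemma meets_proper T (D : set (set T)) :
  (forall P, meets D P -> P !=set0) -> ProperFilter (filter_from (meets D) id).
Proof.
move=> Dn0; apply: filter_from_proper => //.
apply: filter_from_filter; first by exists setT; exact: MeetT.
by move=> P Q mP mQ; exists (P `&` Q) => //; exact: meets_I.
Qed.

Lemma meets_ultra T (D : set (set T)) : (forall P, meets D P -> P !=set0) ->
  exists F : set_system T, UltraFilter F /\ D `<=` F.
Proof.
move=> /meets_proper /ultraFilterLemma[F [FU DF]]; exists F; split=> // P DP.
by apply: DF; exists P => //; exact: meets_in.
Qed.

Lemma countableU (T : Type) (A B : set T) :
  countable A -> countable B -> countable (A `|` B).
Proof.
move=> cA cB; rewrite -bigcup2E; apply: bigcup_countable => // -[|[|i]] _ //=.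
Qed.

Lemma countable_range (X : countType) (T : Type) (a : X -> T) : countable (range a).
Proof. exact: card_le_trans (card_image_le a setT) (countableP _). Qed.

(** * Definable sets, invariant types and coheirs *)

Section Definable.
Variables (L : language) (K : Type) (U : structure L) (M : substructure U).
Hypotheses (monsterU : monster K U) (countM : countable M) (MU : elem_sub_in M).

(** Definability over [M], every element of [M] being a variable of its own. As a property of sets
    it is proved by closure rules, without writing formulas down. *)
Definition dfn X (R : set (X -> U)) : Prop :=
  exists phi : formula L (X + induced M),
    forall e, R e <-> sat (tcat e (@sval _ _)) phi.

Lemma dfn_sat X (phi : formula L X) : dfn (fun e => sat e phi).
Proof. by exists (frename phi inl) => e; rewrite sat_rename. Qed.

Lemma dfn_ext X (R R' : set (X -> U)) : (forall e, R e <-> R' e) -> dfn R -> dfn R'.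
Proof. by move=> E [phi H]; exists phi => e; rewrite -E. Qed.

(** Substitution of variables, which may also plug in elements of [M]. It is stated with a map [g]
    on assignments so as to match goals written with [tcat] and composition. *)
Lemma dfn_subM X Y (R : set (X -> U)) (f : X -> Y + induced M)
    (g : (Y -> U) -> X -> U) :
  (forall e, g e =1 fun x => tcat e (@sval _ _) (f x)) -> dfn R ->
  dfn (fun e => R (g e)).
Proof.
move=> E [phi H].
pose r (s : X + induced M) := match s with inl x => f x | inr m => inr m end.
exists (frename phi r) => e; rewrite sat_rename H.
suff -> : tcat (g e) (@sval _ _) = tcat e (@sval _ _) \o r by [].
by apply: funext => -[x|m] //=; rewrite E.
Qed.

Lemma dfn_sub X Y (R : set (X -> U)) (f : X -> Y) (g : (Y -> U) -> X -> U) :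
  (forall e, g e =1 e \o f) -> dfn R -> dfn (fun e => R (g e)).
Proof. by move=> E; apply: (dfn_subM (f := inl \o f)) => e x; rewrite E. Qed.

Lemma dfn_imp X (R R' : set (X -> U)) :
  dfn R -> dfn R' -> dfn (fun e => R e -> R' e).
Proof. by move=> [p Hp] [q Hq]; exists (Imp p q) => e /=; rewrite Hp Hq. Qed.

Lemma dfn_false X : dfn (fun _ : X -> U => False).
Proof. by exists Bot. Qed.

Lemma dfn_not X (R : set (X -> U)) : dfn R -> dfn (fun e => ~ R e).
Proof. by move=> dR; apply: dfn_imp => //; exact: dfn_false. Qed.

Lemma dfn_and X (R R' : set (X -> U)) :
  dfn R -> dfn R' -> dfn (fun e => R e /\ R' e).
Proof.
move=> dR dR'; have := dfn_not (dfn_imp dR (dfn_not dR')).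
apply: dfn_ext => e; split=> [H|[? ?]]; last by apply.
by split; apply: contrapT => ?; apply: H.
Qed.

Lemma dfn_or X (R R' : set (X -> U)) :
  dfn R -> dfn R' -> dfn (fun e => R e \/ R' e).
Proof.
move=> dR dR'; have := dfn_imp (dfn_not dR) dR'; apply: dfn_ext => e; split.
  by have [|nR /(_ nR)] := pselect (R e); [left|right].
by case.
Qed.

Lemma dfn_iff X (R R' : set (X -> U)) :
  dfn R -> dfn R' -> dfn (fun e => R e <-> R' e).
Proof. by move=> dR dR'; apply: dfn_and; exact: dfn_imp. Qed.

Lemma dfn_all (X : finType) Y (R : set (X + Y -> U)) :
  dfn R -> dfn (fun e => forall x, R (tcat x e)).
Proof.
move=> [phi H].
pose r (s : (X + Y) + induced M) : X + (Y + induced M) := match s with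
  | inl (inl x) => inl x | inl (inr y) => inr (inl y) | inr m => inr (inr m) end.
have [psi Hpsi] := all_fin (frename phi r); exists psi => e; rewrite Hpsi.
by split=> Hx x; have := Hx x; rewrite H sat_rename; apply: sat_ext => -[[]|].
Qed.

Lemma dfn_ex (X : finType) Y (R : set (X + Y -> U)) :
  dfn R -> dfn (fun e => exists x, R (tcat x e)).
Proof.
move=> /dfn_not/dfn_all/dfn_not; apply: dfn_ext => e; split.
  by move=> /existsNP[x /contrapT]; exists x.
by move=> [x Rx] /(_ x).
Qed.

Lemma dfn_all_fin (I : finType) X (R : I -> set (X -> U)) :
  (forall i, dfn (R i)) -> dfn (fun e => forall i, R i e).
Proof.
move=> dR.
suff H (s : seq I) : dfn (fun e => forall i, i \in s -> R i e).
  by apply: (dfn_ext _ (H (enum I))) => e; split=> Hi i *; apply: Hi; rewrite ?mem_enum.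
elim: s => [|i s IH].
  by apply: (dfn_ext _ (dfn_imp (@dfn_false X) (@dfn_false X))) => e; split.
apply: (dfn_ext _ (dfn_and (dR i) IH)) => e; split=> [[Ri Rs] j|H].
  by rewrite inE => /orP[/eqP ->|/Rs].
by split=> [|j js]; apply: H; rewrite inE ?eqxx ?js ?orbT.
Qed.

Lemma dfn_ex_fin (I : finType) X (R : I -> set (X -> U)) :
  (forall i, dfn (R i)) -> dfn (fun e => exists i, R i e).
Proof.
move=> dR; apply: (dfn_ext _ (dfn_not (dfn_all_fin (fun i => dfn_not (dR i))))) => e.
split; first by move=> /existsNP[i /contrapT]; exists i.
by move=> [i Ri] /(_ i).
Qed.

(** The Tarski-Vaught property of [M] in [U]. *)
Lemma dfn_point (X : finType) (R : set (X -> U)) x :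
  dfn R -> R x -> exists2 x', tuple_in M x' & R x'.
Proof.
move=> [phi H] /H Rx.
have [psi Hpsi] := all_fin (Not phi).
have nU : ~ sat (@sval _ _ : induced M -> U) psi by move=> /Hpsi/(_ x); apply.
have nM : ~ sat (id : induced M -> induced M) psi by move=> /(MU psi).
have : ~ forall x : X -> induced M, sat (tcat x id) (Not phi) by move/Hpsi.
move=> /existsNP[y /contrapT /MU Hy].
exists (fun i => sval (y i)); first by move=> i; exact: (svalP (y i)).
by apply/H; apply: sat_ext Hy => -[].
Qed.

(** Equality of types over [M], see [eqM_tp]; the converse implication comes from complements. *)
Definition eqM X (a b : X -> U) : Prop := forall R : set (X -> U), dfn R -> R a -> R b.

Lemma eqM_refl X (a : X -> U) : eqM a a. Proof. by []. Qed.

Lemma eqM_sym X (a b : X -> U) : eqM a b -> eqM b a.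
Proof.
move=> ab R dR Rb; apply: contrapT => nRa.
exact: (ab _ (dfn_not dR)).
Qed.

Lemma eqM_trans X (a b c : X -> U) : eqM a b -> eqM b c -> eqM a c.
Proof. by move=> ab bc R dR /(ab _ dR)/(bc _ dR). Qed.

Lemma eqM_sub X Y (f : X -> Y) (a b : Y -> U) : eqM a b -> eqM (a \o f) (b \o f).
Proof. by move=> ab R dR; apply: (ab (fun e => R (e \o f))); apply: dfn_sub dR. Qed.

Lemma eqM_subE X Y (f : X -> Y) (a b : Y -> U) (a' b' : X -> U) :
  a' =1 a \o f -> b' =1 b \o f -> eqM a b -> eqM a' b'.
Proof. by move=> /funext -> /funext ->; exact: eqM_sub. Qed.

Lemma eqM_tp X (a b : X -> U) : eqM a b <-> eq_tp M a b.
Proof.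
have tpP (c : X -> U) (phi : pform U X) : pf_over M phi ->
    exists2 R : set (X -> U), dfn R & forall c, R c <-> psat c phi.
  case: phi => k phi par /= oM.
  exists (fun c => sat (tcat c par) phi) => //.
  pose f (s : X + 'I_k) : X + induced M := match s with
    | inl x => inl x | inr i => inr (exist _ (par i) (oM i)) end.
  exists (frename phi f) => e; rewrite sat_rename.
  by split; apply: sat_ext => -[].
split=> [ab|ab R [phi HR]].
  apply/seteqP; split=> phi [oM sphi]; split=> //.
    by have [R dR RE] := tpP a phi oM; apply/RE/(ab _ dR)/RE.
  by have [R dR RE] := tpP a phi oM; apply/RE/(eqM_sym ab dR)/RE.
have [u0 Mu0] := sub_nonempty M.
have [W [psi [f E]]] := formula_support phi.
pose r (w : W) : X + 'I_#|W| :=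
  match f w with inl x => inl x | inr _ => inr (enum_rank w) end.
pose par (i : 'I_#|W|) : U := match f (enum_val i) with inl _ => u0 | inr m => sval m end.
have PE c : R c <-> psat c (Pform (frename psi r) par).
  rewrite HR E /psat /= !sat_rename.
  suff -> : tcat c (@sval _ _) \o f = tcat c par \o r by [].
  by apply: funext => w /=; rewrite /r /par; case fw : (f w) => //=; rewrite enum_rankK fw.
have oM : pf_over M (Pform (frename psi r) par).
  by move=> i; rewrite /= /par; case: (f _) => // m; exact: (svalP m).
move=> /PE Ra; apply/PE.
have : tp a M (Pform (frename psi r) par) by [].
by rewrite ab => -[].
Qed.

(* Global types are represented by ultrafilters of tuples, of which only the trace on
   definable sets matters. *)
Definition inv X (F : set_system (X -> U)) : Prop :=
  forall (Y : finType) (R : set (X + Y -> U)) (b c : Y -> U), dfn R -> eqM b c ->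
  F [set x | R (tcat x b)] -> F [set x | R (tcat x c)].

(* [R] hides parameters from [M]: [x] realizes the restriction of [F] to [M `|` A]. *)
Definition reals X (F : set_system (X -> U)) (A : set U) (x : X -> U) : Prop :=
  forall (Y : finType) (R : set (X + Y -> U)) (c : Y -> U), dfn R -> tuple_in A c ->
  F [set x | R (tcat x c)] -> R (tcat x c).

Definition fsat X (A : set U) (x : X -> U) : Prop :=
  forall (Y : finType) (R : set (X + Y -> U)) (c : Y -> U), dfn R -> tuple_in A c ->
  R (tcat x c) -> exists2 x', tuple_in M x' & R (tcat x' c).

Lemma countable_small (T : Type) (A : set T) : countable A -> small K A.
Proof.
have [[Kn nK] _ _ _] := monsterU => cA; split; first exact: card_le_trans Kn.
by move=> KA; apply: nK; exact: card_le_trans cA.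
Qed.

Lemma aut_eqM (f : U -> U) X (a : X -> U) : automorphism f ->
  (forall u, sub_set M u -> f u = u) -> eqM a (f \o a).
Proof.
move=> fA fM R [phi H] /H /(sat_automorphism fA) Ra; apply/H.
by apply: sat_ext Ra => -[x|m] //=; rewrite fM //; exact: (svalP m).
Qed.

(** Strong homogeneity is applied to the tuples enumerating [M] followed by [a] and by [b], which
    are countable and have the same type over the empty set. *)
Lemma eqM_aut (X : countType) (a b : X -> U) : eqM a b -> exists f : U -> U,
  [/\ automorphism f, forall u, sub_set M u -> f u = u & f \o a = b].
Proof.
move=> ab; have [_ _ _ hom] := monsterU.
pose s0 : induced M -> U := @sval _ _.
have cr : countable (range (tcat s0 a)).
  apply: (sub_countable _ (countableU countM (countable_range a))).
  by apply: subset_card_le => _ [[m|x] _ <-]; [left; exact: (svalP m)|right; exists x].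
have [|f fA fE] := hom _ _ (tcat s0 b) (countable_small cr).
  have E (c c' : X -> U) : eqM c c' -> tp (tcat s0 c) set0 `<=` tp (tcat s0 c') set0.
    move=> cc' [k phi par] [o0 sphi]; split=> //; move: sphi; rewrite /psat /=.
    pose f (s : (induced M + X) + 'I_k) : X + induced M := match s with
      | inl (inl m) => inr m | inl (inr x) => inl x
      | inr i => False_rect _ (o0 i) end.
    have fE c0 : tcat (tcat s0 c0) par =1 tcat c0 s0 \o f.
      by move=> [[m|x]|i] //=; case: (o0 i).
    move=> sc; suff : sat (tcat c' s0 \o f) phi by apply: sat_ext => z; rewrite fE.
    apply: (cc' (fun e => sat (tcat e s0 \o f) phi)); last exact: sat_ext sc.
    by exists (frename phi f) => e; rewrite sat_rename.
  by apply/seteqP; split; apply: E => //; exact: eqM_sym.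
exists f; split=> // [u Mu|]; last by apply: funext => x; have := congr1 (@^~ (inr x)) fE.
by have := congr1 (@^~ (inl (exist _ u Mu))) fE.
Qed.

Lemma eqM_extend (X : countType) Y (a b : X -> U) (c : Y -> U) : eqM a b ->
  exists c', eqM (tcat a c) (tcat b c').
Proof.
move=> /eqM_aut[f [fA fM <-]]; exists (f \o c); rewrite -tcat_comp.
exact: aut_eqM.
Qed.

Lemma eqM_catM X Y (x : X -> U) (a b : Y -> U) : tuple_in M x -> eqM a b ->
  eqM (tcat x a) (tcat x b).
Proof.
move=> xM ab R dR; apply: (ab (fun e => R (tcat x e))).
pose f (s : X + Y) : Y + induced M := match s with
  | inl i => inr (exist _ (x i) (xM i)) | inr y => inl y end.
by apply: (dfn_subM (f := f)) dR => e [].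
Qed.

Lemma dfn_par (X : Type) (Y : finType) (R : set (X + Y -> U)) (c : Y -> U) :
  dfn R -> tuple_in M c -> dfn (fun x => R (tcat x c)).
Proof.
move=> dR cM; pose f (s : X + Y) : X + induced M := match s with
  | inl i => inl i | inr y => inr (exist _ (c y) (cM y)) end.
by apply: (dfn_subM (f := f)) dR => e [].
Qed.

Lemma saturated_dfn (X : finType) (A : set U) (D : set (set (X -> U))) :
  countable A -> D !=set0 -> (forall P, D P -> P !=set0) ->
  (forall P Q, D P -> D Q -> exists2 R, D R & R `<=` P `&` Q) ->
  (forall P, D P -> exists (Y : finType) (c : Y -> U) (R : set (X + Y -> U)),
    [/\ dfn R, tuple_in A c & P = [set x | R (tcat x c)]]) ->
  exists x, forall P, D P -> P x.
Proof.
move=> cA [P0 DP0] Dn0 DI Ddfn; have [_ _ satU _] := monsterU.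
have [u0 Mu0] := sub_nonempty M.
pose p : set (pform U 'I_#|X|) := [set phi | pf_over (sub_set M `|` A) phi /\
  exists2 P, D P & forall x : X -> U, P x <-> psat (x \o enum_val) phi].
have Dp P : D P -> exists2 phi, p phi &
    forall x : X -> U, P x <-> psat (x \o enum_val) phi.
  move=> DP; have [Y [c [R [[phi HR] cA' PE]]]] := Ddfn _ DP.
  have [k [psi [g gE]]] := parametric_formula (exist _ u0 Mu0 : induced M) phi.
  pose r (s : X + 'I_k) : 'I_#|X| + 'I_k :=
    match s with inl x => inl (enum_rank x) | inr i => inr i end.
  pose par := tcat c (@sval _ _ : induced M -> U) \o g.
  have E x : P x <-> psat (x \o enum_val) (Pform (frename psi r) par).
    rewrite PE /= HR gE /psat /= sat_rename.
    by split; apply: sat_ext => -[i|i] //=; rewrite enum_rankK.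
  exists (Pform (frename psi r) par) => //; split; last by exists P.
  move=> i; rewrite /= /par /=; case: (g i) => [y|m]; [by right; exact: cA'|left; exact: (svalP m)].
have [|a Ha] := satU (sub_set M `|` A) (countable_small (countableU countM cA)) _ p.
  split=> [phi []//|s fs sp].
  have [Q DQ Qs] : exists2 Q, D Q & forall x : X -> U, Q x -> forall phi, s phi ->
      psat (x \o enum_val) phi.
    have /finite_seqP[l lE] : finite_set (s : set {classic pform U 'I_#|X|}) by [].
    have : forall phi, phi \in l -> s phi by move=> phi; rewrite lE.
    suff : (forall phi, phi \in l -> s phi) -> exists2 Q, D Q &
        forall x : X -> U, Q x -> forall phi, phi \in l -> psat (x \o enum_val) phi.
      by move=> /[apply] -[Q DQ HQ]; exists Q => // x Qx phi; rewrite lE; exact: HQ.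
    elim: l {lE} => [|phi l IH] ls; first by exists P0.
    have [|Q DQ HQ] := IH; first by move=> psi psil; apply: ls; rewrite inE psil orbT.
    have [_ [Q' DQ' Q'E]] : p phi by apply: sp; apply: ls; rewrite inE eqxx.
    have [S DS SQ] := DI _ _ DQ DQ'; exists S => // x /SQ[Qx Q'x] psi.
    by rewrite inE => /orP[/eqP ->|]; [exact/Q'E|exact: HQ].
  by have [x Qx] := Dn0 _ DQ; exists (x \o enum_val) => // phi; exact: Qs.
exists (a \o enum_rank) => P /Dp[phi pphi ->].
apply: sat_ext (Ha _ pphi) => -[i|] //=.
by rewrite /= enum_valK.
Qed.

Lemma reals_ex (X : finType) (F : set_system (X -> U)) (A : set U) :
  ProperFilter F -> countable A -> exists x, reals F A x.
Proof.
move=> FF cA.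
pose D : set (set (X -> U)) := [set P | F P /\ exists (Y : finType) (c : Y -> U)
  (R : set (X + Y -> U)), [/\ dfn R, tuple_in A c & P = [set x | R (tcat x c)]]].
have [||||x Hx] := @saturated_dfn X A D cA.
- exists setT; split; first exact: filterT.
  exists void, (of_void U), (fun _ => ~ False); split=> //; first exact/dfn_not/dfn_false.
  by apply/seteqP; split=> // x _ [].
- by move=> P [/filter_ex].
- move=> P Q [FP [Y [c [R [dR cA1 PE]]]]] [FQ [Z [d [S [dS dA QE]]]]].
  exists (P `&` Q) => //; split; first exact: filterI.
  exists (Y + Z)%type, (tcat c d), (fun e =>
    R (tcat (e \o inl) (e \o inr \o inl)) /\ S (tcat (e \o inl) (e \o inr \o inr))).
  split; last by rewrite PE QE.
  + apply: dfn_and.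
      apply: (dfn_sub (f := fun s => match s with inl x => inl x | inr y => inr (inl y) end)) dR.
      by move=> e [].
    apply: (dfn_sub (f := fun s => match s with inl x => inl x | inr y => inr (inr y) end)) dS.
    by move=> e [].
  + by case.
- by move=> P [].
- by exists x => Y R c dR cA1 FR; apply: (Hx [set x | R (tcat x c)]); split=> //; exists Y, c, R.
Qed.

Lemma realsP X (F : set_system (X -> U)) A x (Y : finType) (R : set (X + Y -> U)) c :
  UltraFilter F -> reals F A x -> dfn R -> tuple_in A c ->
  F [set x | R (tcat x c)] <-> R (tcat x c).
Proof.
move=> FU Fx dR cA; split; first exact: Fx.
move=> Rx; apply: contrapT => /(ultra_not FU) nF.
by have := Fx _ _ _ (dfn_not dR) cA nF.
Qed.

Lemma reals_mono X (F : set_system (X -> U)) A B x : A `<=` B -> reals F B x -> reals F A x.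
Proof. by move=> AB Fx Y R c dR cA; apply: Fx => // y; exact: AB. Qed.

Lemma eqM_reals X (F : set_system (X -> U)) A B x y (Y : finType) (b c : Y -> U) :
  UltraFilter F -> inv F -> reals F A x -> reals F B y -> tuple_in A b -> tuple_in B c ->
  eqM b c -> eqM (tcat x b) (tcat y c).
Proof.
move=> FU iF Fx Fy bA cB bc R dR /(realsP FU Fx dR bA) FR.
by apply: Fy => //; exact: (iF _ _ b).
Qed.

Lemma inv_iff X (F : set_system (X -> U)) (Y : finType) (R : set (X + Y -> U)) b c :
  inv F -> dfn R -> eqM b c -> F [set x | R (tcat x b)] <-> F [set x | R (tcat x c)].
Proof. by move=> iF dR bc; split; apply: iF => //; exact: eqM_sym. Qed.

Lemma inv_realsM X (F : set_system (X -> U)) A x (Y : finType) (R : set (X + Y -> U)) b c :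
  UltraFilter F -> inv F -> reals F A x -> dfn R -> tuple_in A c -> eqM b c ->
  F [set x | R (tcat x b)] <-> R (tcat x c).
Proof.
by move=> FU iF Fx dR cA bc; rewrite (inv_iff iF dR bc) (realsP FU Fx dR cA).
Qed.

(** If [F] contained [R(x; b)] but not [R(x; c)], some tuple [x] of [M] would satisfy the first and
    not the second, although [b] and [c] have the same type over [M]. *)
Lemma coheir_inv X (F : set_system (X -> U)) : UltraFilter F ->
  F [set x | tuple_in M x] -> inv F.
Proof.
move=> FU FM Y R b c dR bc FR; apply: contrapT => /(ultra_not FU) nFR.
have [x [[Rb nRc] xM]] := filter_ex (filterI (filterI FR nFR) FM).
exact: nRc (eqM_catM xM bc dR Rb).
Qed.

Lemma coheir_fsat X (F : set_system (X -> U)) A x : UltraFilter F ->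
  F [set x | tuple_in M x] -> reals F A x -> fsat A x.
Proof.
move=> FU FM Fx Y R c dR cA /(realsP FU Fx dR cA) FR.
by have [x' [? ?]] := filter_ex (filterI FR FM); exists x'.
Qed.

Lemma fsat_coheir X A (x : X -> U) : fsat A x -> exists F : set_system (X -> U),
  [/\ UltraFilter F, F [set x | tuple_in M x] & reals F A x].
Proof.
move=> fx.
pose D : set (set (X -> U)) := [set P | exists (Y : finType) (c : Y -> U) 
  (R : set (X + Y -> U)), [/\ dfn R, tuple_in A c, R (tcat x c) &
   P = [set x' | tuple_in M x' /\ R (tcat x' c)]]].
have [|||F [FU DF]] := @directed_ultra _ D.
- exists [set x' | tuple_in M x' /\ ~ False].
  by exists void, (of_void U), (fun _ => ~ False); split=> //; exact/dfn_not/dfn_false.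
- move=> P [Y [c [R [dR cA Rx ->]]]].
  by have [x' ? ?] := fx _ _ _ dR cA Rx; exists x'.
- move=> P Q [Y [c [R [dR cA Rx ->]]]] [Z [d [S [dS dA Sx ->]]]].
  pose T e := R (tcat (e \o inl) (e \o inr \o inl)) /\ 
              S (tcat (e \o inl) (e \o inr \o (inr : Z -> Y + Z))).
  exists [set x' | tuple_in M x' /\ T (tcat x' (tcat c d))]; last first.
    by move=> x' /= [? [? ?]].
  exists (Y + Z)%type, (tcat c d), T; split=> //; last by case.
  apply: dfn_and.
    apply: (dfn_sub (f := fun s => match s with inl x => inl x | inr y => inr (inl y) end)) dR.
    by move=> e [].
  apply: (dfn_sub (f := fun s => match s with inl x => inl x | inr y => inr (inr y) end)) dS.
  by move=> e [].
have DR (Y : finType) (c : Y -> U) R : dfn R -> tuple_in A c -> R (tcat x c) ->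
    F [set x' | tuple_in M x' /\ R (tcat x' c)].
  by move=> dR cA Rx; apply: DF; exists Y, c, R.
exists F; split=> //.
  have := DR void (of_void U) _ (dfn_not (@dfn_false _)) _ _.
  by move=> /(_ _ _)/filterS; apply=> // ? [].
move=> Y R c dR cA FR; apply: contrapT => nR.
have := DR _ c _ (dfn_not dR) cA nR => nFR.
by have [x' [? [_]]] := filter_ex (filterI FR nFR).
Qed.

Lemma fsat_mono X A B (x : X -> U) : A `<=` B -> fsat B x -> fsat A x.
Proof. by move=> AB fx Y R c dR cA; apply: fx => // y; exact: AB. Qed.

(** [y] is replaced in [M] first, with [x] as a parameter; what remains is a condition on [x] alone
    over [M] and [A]. *)
Lemma fsat_trans (X Y : finType) A (x : X -> U) (y : Y -> U) :
  fsat A x -> fsat (A `|` range x) y -> fsat A (tcat x y).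
Proof.
move=> fx fy Z R c dR cA Rxy.
pose R1 (e : Y + (X + Z) -> U) := R (tcat (tcat (e \o inr \o inl) (e \o inl)) (e \o inr \o inr)).
have dR1 : dfn R1.
  apply: (dfn_sub (f := fun s => match s with inl (inl x) => inr (inl x) | inl (inr y) => inl y
     | inr z => inr (inr z) end)) dR; by move=> e [[]|].
have [||y' yM Ry'] := fy _ R1 (tcat x c) dR1.
- by move=> [i|z] /=; [right; exists i|left].
- exact: Rxy.
pose R2 (e : Y + (X + Z) -> U) := R1 e.
have dR2 : dfn (fun e : X + Z -> U => R1 (tcat y' e)).
  apply: (dfn_subM (f := fun s : Y + (X + Z) => match s with inl i => inr (exist _ (y' i) (yM i)) | inr z => inl z end)) dR1.
  by move=> e [].
have [x' xM Rx'] := fx _ (fun e : X + Z -> U => R1 (tcat y' e)) c dR2 cA Ry'.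
by exists (tcat x' y') => //; case.
Qed.

(** * Morley sequences, mutual indiscernibility and NIP *)

Lemma countable_seq_set (I X : countType) (y : I -> X -> U) : countable (seq_set y).
Proof.
apply: sub_countable (countable_range (fun z : I * X => y z.1 z.2)).
by apply: subset_card_le => _ [i [x ->]]; exists (i, x).
Qed.

Lemma eq_tp_eqM X (B : set U) (a a' : X -> U) :
  (forall k (b : 'I_k -> U), tuple_in B b -> eqM (tcat b a) (tcat b a')) ->
  eq_tp B a a'.
Proof.
move=> H; suff E (c c' : X -> U) :
    (forall k (b : 'I_k -> U), tuple_in B b -> eqM (tcat b c) (tcat b c')) ->
    tp c B `<=` tp c' B.
  by apply/seteqP; split; [exact: E|apply: E => k b bB; apply: eqM_sym; exact: H].
move=> {}H [k phi par] [oB sphi]; split=> //; move: sphi; rewrite /psat /= => sphi.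
pose f (s : X + 'I_k) : 'I_k + X := match s with inl x => inr x | inr i => inl i end.
suff : sat (tcat par c' \o f) phi by apply: sat_ext => -[].
apply: (H k par oB (fun e => sat (e \o f) phi)).
  by apply: (dfn_sub (f := f)) (dfn_sat phi).
by apply: sat_ext sphi => -[].
Qed.

Lemma eqM_eq_tp X (Y : finType) (B : set U) (a a' : X -> U) (b : Y -> U) :
  sub_set M `<=` B -> eq_tp B a a' -> tuple_in B b -> eqM (tcat b a) (tcat b a').
Proof.
move=> MB aa' bB R [phi HR] /HR sphi; apply/HR.
have [W [psi [f E]]] := formula_support phi.
have [u0 Mu0] := sub_nonempty M.
pose r (w : W) : X + 'I_#|W| := if f w is inl (inr x) then inl x else inr (enum_rank w).
pose par (i : 'I_#|W|) : U := match f (enum_val i) with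
  | inl (inl y) => b y | inl _ => u0 | inr m => sval m end.
have PE c : tcat (tcat b c) (@sval _ _) \o f =1 tcat c par \o r.
  by move=> w; rewrite /= /r /par; case fw: (f w) => [[y|x]|m] //=; rewrite enum_rankK fw.
have : tp a B (Pform (frename psi r) par).
  split; last first.
    rewrite /psat /= sat_rename; move: sphi; rewrite E sat_rename; exact: sat_ext.
  by move=> i; rewrite /= /par; case: (f _) => [[y|x]|m] //; apply: MB => //; exact: (svalP m).
rewrite aa' => -[_]; rewrite /psat /= sat_rename E sat_rename.
by apply: sat_ext => w; rewrite PE.
Qed.

(** The type may depend on [i], for the alternating sequence of [coheir1_unique], and [lt] may be a
    reversed order, as in [morley_pieces]. *)
Definition morley I (lt : I -> I -> Prop) X (F : I -> set_system (X -> U))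
    (B : set U) (y : I -> X -> U) : Prop :=
  forall i, reals (F i) (B `|` [set u | exists j x, lt j i /\ u = y j x]) (y i).

Lemma morley_nat (X : finType) (F : nat -> set_system (X -> U)) B :
  (forall i, UltraFilter (F i)) -> countable B ->
  exists y, morley (fun i j => (i < j)%N) F B y.
Proof.
move=> FU cB.
have /choice[g Hg] : forall s : set U * nat, exists x : X -> U,
    countable s.1 -> reals (F s.2) s.1 x.
  move=> [A i]; have [cA|] := pselect (countable A); last first.
    by have [u0 _] := sub_nonempty M => nA; exists (fun=> u0).
  by have [x Hx] := reals_ex (X := X) (F := F i) _ cA; exists x.
pose P := fix P i := if i is j.+1 then P j `|` range (g (P j, j)) else B.
have cP i : countable (P i).
  elim: i => //= i IH; apply: countableU IH _; exact: countable_range.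
have sP i j : (i <= j)%N -> P i `<=` P j.
  move=> /subnK <-; elim: (j - i)%N => //= k IH u Pu; left; exact: IH.
exists (fun i => g (P i, i)) => i; apply: reals_mono (Hg (P i, i) (cP i)).
move=> u [Bu|[j [x [ji ->]]]]; first exact: (sP 0%N).
by apply: (sP j.+1 i ji); right; exists x.
Qed.

Lemma eqM_snoc I J X (Y : Type) (b b' : Y -> U) (y : I -> X -> U) (y' : J -> X -> U)
    s (i : 'I_s.+1 -> I) (i' : 'I_s.+1 -> J) :
  eqM (tcat (y (i ord_max)) (tcat b (fun z : 'I_s * X => y (i (lift ord_max z.1)) z.2)))
      (tcat (y' (i' ord_max)) (tcat b' (fun z : 'I_s * X => y' (i' (lift ord_max z.1)) z.2))) ->
  eqM (tcat b (fun z : 'I_s.+1 * X => y (i z.1) z.2))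
      (tcat b' (fun z : 'I_s.+1 * X => y' (i' z.1) z.2)).
Proof.
apply: (eqM_subE (f := fun s => match s with
  | inl c => inr (inl c)
  | inr z => if unlift ord_max z.1 is Some j then inr (inr (j, z.2)) else inl z.2 end)).
  by move=> [c|[j x]] //=; case: unliftP => [k ->|->].
by move=> [c|[j x]] //=; case: unliftP => [k ->|->].
Qed.

(** Invariance determines the type of an increasing tuple over the base, the last term being added
    to the earlier ones. Two sequences over two bases are compared at once; for a single sequence
    this is indiscernibility. *)
Lemma morley_eqM I J ltI ltJ (X Y : finType) (F : set_system (X -> U)) B B'
    (y : I -> X -> U) (y' : J -> X -> U) s (i : 'I_s -> I) (i' : 'I_s -> J)
    (b b' : Y -> U) :
  UltraFilter F -> inv F -> morley ltI (fun=> F) B y -> morley ltJ (fun=> F) B' y' ->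
  increasing ltI i -> increasing ltJ i' -> tuple_in B b -> tuple_in B' b' -> eqM b b' ->
  eqM (tcat b (fun z : 'I_s * X => y (i z.1) z.2))
      (tcat b' (fun z : 'I_s * X => y' (i' z.1) z.2)).
Proof.
move=> FU iF my my' + + bB b'B bb'.
elim: s i i' => [|s IH] i i' ii ii'.
  apply: (eqM_subE (f := fun s : Y + 'I_0 * X => match s with inl c => c
     | inr z => False_rect _ (notF (valP z.1)) end)) bb'.
    by move=> [//|[[]]].
  by move=> [//|[[]]].
apply: (eqM_snoc (y := y) (y' := y') (i := i) (i' := i')).
have lt_max (t : 'I_s) : (lift ord_max t < @ord_max s)%N by rewrite lift_max ltn_ord.
have lift_lt (t u : 'I_s) : (t < u)%N -> (lift ord_max t < lift (@ord_max s) u)%N.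
  by rewrite !lift_max.
apply: (eqM_reals FU iF (my _) (my' _)).
- move=> [c|[t x]]; first by left; exact: bB.
  by right; exists (i (lift ord_max t)), x; split=> //; exact: (ii _ _ (lt_max t)).
- move=> [c|[t x]]; first by left; exact: b'B.
  by right; exists (i' (lift ord_max t)), x; split=> //; exact: (ii' _ _ (lt_max t)).
- apply: (IH (fun t => i (lift ord_max t)) (fun t => i' (lift ord_max t))).
    by move=> t u tu; apply: ii; exact: lift_lt.
  by move=> t u tu; apply: ii'; exact: lift_lt.
Qed.

Lemma morley_indiscernible I lt (X : finType) (F : set_system (X -> U)) B
    (y : I -> X -> U) : UltraFilter F -> inv F -> morley lt (fun=> F) B y ->
  indiscernible lt B y.
Proof.
move=> FU iF my n i j ii ij; apply: eq_tp_eqM => k b bB.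
exact: (morley_eqM FU iF my my).
Qed.

Lemma eq_tp_sub (V : structure L) X Y (f : X -> Y) (A : set V) (a b : Y -> V) : eq_tp A a b ->
  eq_tp A (a \o f) (b \o f).
Proof.
move=> ab; suff H (c c' : Y -> V) : eq_tp A c c' -> tp (c \o f) A `<=` tp (c' \o f) A.
  by apply/seteqP; split; apply: H.
move=> cc' [k phi par] [oA sphi]; split=> //; move: sphi; rewrite /psat /= => sphi.
pose r (s : X + 'I_k) : Y + 'I_k := match s with inl x => inl (f x) | inr i => inr i end.
have : tp c A (Pform (frename phi r) par).
  by split=> //; rewrite /psat /= sat_rename; apply: sat_ext sphi => -[].
by rewrite cc' => -[_]; rewrite /psat /= sat_rename; apply: sat_ext => -[].
Qed.

Lemma indiscernible_sub I lt A X Y (f : X -> Y) (y : I -> Y -> U) :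
  indiscernible lt A y -> indiscernible lt A (fun i => y i \o f).
Proof.
move=> iy n i j ii ij.
exact: (eq_tp_sub (fun z : 'I_n * X => (z.1, f z.2)) (iy n i j ii ij)).
Qed.

Lemma eq_tp_mono X A B (a b : X -> U) : A `<=` B -> eq_tp B a b -> eq_tp A a b.
Proof.
move=> AB ab; suff H (c c' : X -> U) : eq_tp B c c' -> tp c A `<=` tp c' A.
  by apply/seteqP; split; apply: H.
move=> cc' phi [oA sphi]; split=> //.
have : tp c B phi by split=> // i; apply: AB.
by rewrite cc' => -[].
Qed.

Lemma indiscernible_mono I lt A B X (y : I -> X -> U) : A `<=` B ->
  indiscernible lt B y -> indiscernible lt A y.
Proof. by move=> AB iy n i j ii ij; apply: eq_tp_mono AB _; exact: iy. Qed.

Lemma increasing_enum (I : Type) (lt : I -> I -> Prop) (s : seq {classic I}) :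
  linear_order lt ->
  exists (n : nat) (g : 'I_n -> I), increasing lt g /\
    forall x, x \in s -> exists t, g t = x.
Proof.
move=> [irr tr tot].
pose le (a b : {classic I}) := `[< lt a b \/ a = b >].
have le_tot : total le.
  by move=> a b; apply/orP; case: (tot a b) => H; [left|left|right]; apply/asboolP; tauto.
have le_tr : transitive le.
  move=> b a c /asboolP ab /asboolP bc; apply/asboolP.
  case: ab => [ab|->] //; case: bc => [bc|<-]; left => //; exact: tr bc.
pose l := sort le (undup s).
have lE x : x \in s -> x \in l by rewrite mem_sort mem_undup.
have ul : uniq l by rewrite sort_uniq undup_uniq.
have sl : sorted le l by exact: sort_sorted.
exists (size l), (fun t => tnth (in_tuple l) t); split=> [a b ab|x /lE xl].
  have x0 : {classic I} by exact: tnth (in_tuple l) a.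
  rewrite !(tnth_nth x0) /=.
  have /asboolP[//|E] : le (nth x0 l a) (nth x0 l b).
    by apply: sorted_ltn_nth => //; rewrite inE.
  move/eqP: E; rewrite nth_uniq // => /eqP E.
  by rewrite E ltnn in ab.
exists (Ordinal (etrans (index_mem x l) xl)).
by rewrite (tnth_nth x) /= nth_index.
Qed.

(* Parameters from [h J] may be added to the base when increasing tuples
   of [g I] and of [h J] can be merged in a way depending only on their lengths. *)
Lemma indiscernible_merge (I J Q : Type) (ltI : I -> I -> Prop) (ltJ : J -> J -> Prop)
    (lt : Q -> Q -> Prop) (g : I -> Q) (h : J -> Q) A (X : finType) (y : Q -> X -> U) :
  sub_set M `<=` A -> linear_order ltJ ->
  (forall n s, exists m (p : 'I_n -> 'I_m) (q : 'I_s -> 'I_m),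
    forall i j, @increasing _ ltI n i -> @increasing _ ltJ s j ->
    exists2 u : 'I_m -> Q, increasing lt u & u \o p = g \o i /\ u \o q = h \o j) ->
  indiscernible lt A y -> indiscernible ltI (A `|` seq_set (y \o h)) (y \o g).
Proof.
move=> MA loJ merge iy n i i' ii ii'; apply: eq_tp_eqM => k c cA.
have /choice[o oP] : forall t, exists o : option (J * X), match o with
    None => A (c t) | Some jx => c t = y (h jx.1) jx.2 end.
  by move=> t; case: (cA t) => [At|[j [x E]]]; [exists None|exists (Some (j, x))].
pose l : seq {classic J} := pmap (omap fst \o o) (enum 'I_k).
have [s [j [ij jl]]] := increasing_enum l loJ.
have /choice[f fP] : forall t, exists r : option ('I_s * X), match r with
    None => A (c t) | Some jx => c t = y (h (j jx.1)) jx.2 end.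
  move=> t; have := oP t; case E : (o t) => [[j0 x]|] => [H|H]; last by exists None.
  have [t' Et'] : exists t', j t' = j0.
    apply: jl; rewrite /l mem_pmap; apply/mapP; exists t; first by rewrite mem_enum.
    by rewrite /= E.
  by exists (Some (t', x)); rewrite /= Et'.
have [m [p [q mE]]] := merge n s.
have [u iu [up uq]] := mE i j ii ij.
have [u' iu' [up' uq']] := mE i' j ii' ij.
have [u0 Mu0] := sub_nonempty M.
pose b t := if f t is Some _ then u0 else c t.
have bA : tuple_in A b.
  by move=> t; rewrite /b; move: (fP t); case: (f t) => [_ _|//]; exact: MA.
pose r (s : 'I_k + 'I_n * X) : 'I_k + 'I_m * X := match s with
  | inl t => if f t is Some jx then inr (q jx.1, jx.2) else inl t
  | inr z => inr (p z.1, z.2) end.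
have E (v : 'I_m -> Q) (w : 'I_n -> I) : v \o p = g \o w -> v \o q = h \o j ->
    tcat c (fun z : 'I_n * X => (y \o g) (w z.1) z.2) =1
    tcat b (fun z : 'I_m * X => y (v z.1) z.2) \o r.
  move=> vp vq [t|[a x]] /=; last by have /= -> := congr1 (@^~ a) vp.
  rewrite /b; move: (fP t); case ft : (f t) => [[a x]|] /=; last by rewrite ft.
  by move=> ->; have /= -> := congr1 (@^~ a) vq.
apply: (eqM_subE (E u i up uq) (E u' i' up' uq')).
exact: eqM_eq_tp MA (iy m u u' iu iu') bA.
Qed.

Lemma linear_order_nat : linear_order (fun i j : nat => (i < j)%N).
Proof.
split=> [i|i j k|i j]; [by rewrite ltnn|exact: ltn_trans|].
by case: (ltngtP i j) => H; [apply: Or31|apply: Or33|apply: Or32].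
Qed.

Definition sum_lt (I J : Type) (ltI : I -> I -> Prop) (ltJ : J -> J -> Prop)
    (a b : I + J) : Prop :=
  match a, b with
  | inl i, inl i' => ltI i i' | inl _, inr _ => True
  | inr _, inl _ => False | inr j, inr j' => ltJ j j' end.

Lemma linear_order_sum I J (ltI : I -> I -> Prop) (ltJ : J -> J -> Prop) :
  linear_order ltI -> linear_order ltJ -> linear_order (sum_lt ltI ltJ).
Proof.
move=> [irrI trI totI] [irrJ trJ totJ]; split.
- by move=> [i|j] //=.
- move=> [i|j] [i'|j'] [i''|j''] //=; [exact: trI|exact: trJ].
- move=> [i|j] [i'|j'] /=; try by [apply: Or31|apply: Or33].
    by case: (totI i i') => [H|->|H]; [apply: Or31|apply: Or32|apply: Or33].
  by case: (totJ j j') => [H|->|H]; [apply: Or31|apply: Or32|apply: Or33].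
Qed.

(** A tuple from the first half followed by one from the second is increasing in the sum, so either
    half stays indiscernible over the other. *)
Lemma mutually_indiscernible_sum I J (ltI : I -> I -> Prop) (ltJ : J -> J -> Prop)
    A (X : finType) (y : I + J -> X -> U) :
  sub_set M `<=` A -> linear_order ltI -> linear_order ltJ ->
  indiscernible (sum_lt ltI ltJ) A y ->
  mutually_indiscernible ltI ltJ A (y \o inl) (y \o inr).
Proof.
move=> MA loI loJ iy; split.
- apply: (@indiscernible_merge _ _ _ ltI ltJ (sum_lt ltI ltJ)) => // n s.
  exists (n + s)%N, (@lshift n s), (@rshift n s) => i j ii ij.
  exists (fun z => match fintype.split z with inl a => inl (i a) | inr b => inr (j b) end).
    move=> a b; case: (split_ordP a) => [a' ->|a' ->]; case: (split_ordP b) => [b' ->|b' ->];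
      rewrite ?(unsplitK (inl _)) ?(unsplitK (inr _)) /=.
    - exact: ii.
    - by [].
    - by rewrite ltnNge (leq_trans (ltnW (ltn_ord b'))) ?leq_addr.
    - by rewrite ltn_add2l; exact: ij.
  by split; apply: funext => a; rewrite /= ?(unsplitK (inl _)) ?(unsplitK (inr _)).
- apply: (@indiscernible_merge _ _ _ ltJ ltI (sum_lt ltI ltJ)) => // n s.
  exists (s + n)%N, (@rshift s n), (@lshift s n) => j i ij ii.
  exists (fun z => match fintype.split z with inl a => inl (i a) | inr b => inr (j b) end).
    move=> a b; case: (split_ordP a) => [a' ->|a' ->]; case: (split_ordP b) => [b' ->|b' ->];
      rewrite ?(unsplitK (inl _)) ?(unsplitK (inr _)) /=.
    - exact: ii.
    - by [].
    - by rewrite ltnNge (leq_trans (ltnW (ltn_ord b'))) ?leq_addr.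
    - by rewrite ltn_add2l; exact: ij.
  by split; apply: funext => a; rewrite /= ?(unsplitK (inl _)) ?(unsplitK (inr _)).
Qed.

(** * Dp-minimality and bounded alternation *)

Hypothesis dpT : dp_minimal K U.

(** Dp-minimality is applied to the empty partial type over [A], which every element [u]
    realizes. *)
Lemma dp_minimal_sum (I J : countType) (ltI : I -> I -> Prop) (ltJ : J -> J -> Prop)
    A (X : finType) (y : I + J -> X -> U) (u : U) :
  sub_set M `<=` A -> countable A -> linear_order ltI -> linear_order ltJ ->
  infinite_set [set: I] -> infinite_set [set: J] ->
  indiscernible (sum_lt ltI ltJ) A y ->
  indiscernible ltI (A `|` [set u]) (y \o inl) \/
  indiscernible ltJ (A `|` [set u]) (y \o inr).
Proof.
move=> MA cA loI loJ nI nJ iy.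
have [iyI iyJ] := mutually_indiscernible_sum MA loI loJ iy.
pose ev : 'I_#|X| -> X := enum_val.
have sE (I' : Type) (w : I' -> X -> U) : seq_set (fun i => w i \o ev) = seq_set w.
  apply/seteqP; split=> z [i [x ->]]; first by exists i, (ev x).
  by exists i, (enum_rank x); rewrite /= /ev enum_rankK.
have uE : range (fun _ : 'I_1 => u) = [set u].
  by apply/seteqP; split=> [_ [_ _ <-]//|_ ->]; exists ord0.
have back (I' : Type) (lt : I' -> I' -> Prop) (w : I' -> X -> U) B :
    indiscernible lt B (fun i => w i \o ev) -> indiscernible lt B w.
  move=> /(indiscernible_sub (enum_rank : X -> 'I_#|X|)).
  rewrite (_ : (fun i => _) = w) //; apply: funext => i; apply: funext => x.
  by rewrite /= /ev enum_rankK.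
have p0 : partial_type A (set0 : set (pform U 'I_1)).
  split=> // s _ s0; exists (fun=> u) => // phi /s0 [].
have r0 : realizes (fun _ : 'I_1 => u) (set0 : set (pform U 'I_1)) by [].
have [|H|H] := dpT (countable_small cA) p0 r0 (b := fun i => y (inl i) \o ev)
  (c := fun j => y (inr j) \o ev) loI loJ nI nJ (countable_small (countableP _))
  (countable_small (countableP _)).
- split; rewrite sE; exact: indiscernible_sub.
- by left; rewrite -uE; exact: back.
- by right; rewrite -uE; exact: back.
Qed.

(* The order on [2 ^ n] consecutive copies of the reversed natural numbers. *)
Fixpoint pieces n : countType := if n is m.+1 then (pieces m + pieces m)%type else nat.

Fixpoint pieces_lt n : pieces n -> pieces n -> Prop := match n with
  | 0 => fun i j : nat => (j < i)%N
  | m.+1 => sum_lt (@pieces_lt m) (@pieces_lt m)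
  end.

Fixpoint piece n (l i : nat) : pieces n := match n with
  | 0 => i
  | m.+1 => if (l < 2 ^ m)%N then inl (piece m l i) else inr (piece m (l - 2 ^ m) i)
  end.

Lemma linear_order_pieces n : linear_order (@pieces_lt n).
Proof.
elim: n => [|n IH]; last exact: linear_order_sum.
split=> [i|i j k|i j] /=; [by rewrite ltnn|by move=> ij jk; exact: ltn_trans jk ij|].
by case: (ltngtP i j) => H; [apply: Or33|apply: Or31|apply: Or32].
Qed.

Lemma infinite_pieces n : infinite_set [set: pieces n].
Proof.
elim: n => [|n IH] /=; first exact: infinite_nat.
move=> fin; apply: IH.
have /= := finite_preimage (f := inl : pieces n -> pieces n + pieces n) _ fin.
by apply=> a b _ _ [].
Qed.

Lemma pieces_lt_piece n l l' i j : (l < 2 ^ n)%N -> (l' < 2 ^ n)%N ->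
  (l < l')%N || (l == l') && (j < i)%N -> pieces_lt (piece n l i) (piece n l' j).
Proof.
elim: n l l' => [|n IH] l l' /=.
  by rewrite expn0 !ltnS !leqn0 => /eqP -> /eqP ->; rewrite ltnn eqxx.
move=> ln l'n H; case: ltnP => l1; case: ltnP => l2 //=.
- exact: IH.
- case/orP: H => [H|/andP[/eqP H _]]; last by rewrite H leqNgt l2 in l1.
  by have /ltnW := leq_trans l2 l1; rewrite leqNgt H.
- apply: IH.
  + by rewrite ltn_subLR // addnn -mul2n -expnS.
  + by rewrite ltn_subLR // addnn -mul2n -expnS.
  + by rewrite ltn_sub2rE // eqn_sub2rE.
Qed.

(** Each entry of [x] costs one halving: by dp-minimality one of the two halves remains
    indiscernible when the entry is added to the base. *)
Lemma piece_indiscernible n A (X : finType) (y : pieces n -> X -> U) (x : 'I_n -> U) :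
  sub_set M `<=` A -> countable A -> indiscernible (@pieces_lt n) A y ->
  exists2 l, (l < 2 ^ n)%N &
    indiscernible (fun i j : nat => (j < i)%N) (A `|` range x) (fun i => y (piece n l i)).
Proof.
elim: n A y x => [|n IH] A y x MA cA iy.
  exists 0 => //; apply: indiscernible_mono iy.
  by move=> u [//|[[]]].
have cAx : countable (A `|` [set x ord0]) by apply: countableU => //; exact: countable1.
have sub : A `|` range x `<=` (A `|` [set x ord0]) `|` range (x \o lift ord0).
  move=> u [Au|[i _ <-]]; first by left; left.
  case: (unliftP ord0 i) => [j ->|->]; [by right; exists j|by left; right].
have MAx : sub_set M `<=` A `|` [set x ord0] by move=> u /MA; left.
have [iyx|iyx] := dp_minimal_sum (x ord0) MA cA (linear_order_pieces n)
    (linear_order_pieces n) (@infinite_pieces n) (@infinite_pieces n) iy.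
  have [l ln H] := IH _ _ (x \o lift ord0) MAx cAx iyx.
  exists l; first by rewrite expnS mul2n -addnn ltn_addr.
  by rewrite /= ln; exact: indiscernible_mono sub H.
have [l ln H] := IH _ _ (x \o lift ord0) MAx cAx iyx.
exists (2 ^ n + l)%N; first by rewrite expnS mul2n -addnn ltn_add2l.
by rewrite /= ltnNge leq_addr /= addKn; exact: indiscernible_mono sub H.
Qed.

Lemma free_ultra : exists W : set_system nat, UltraFilter W /\
  forall N, W [set i | (N < i)%N].
Proof.
have [|||W [WU DW]] := @directed_ultra nat [set P | exists N, P = [set i | (N < i)%N]].
- by exists [set i | (0 < i)%N], 0.
- by move=> _ [N ->]; exists N.+1 => /=.
- move=> _ _ [N ->] [N' ->]; exists [set i | (maxn N N' < i)%N]; first by exists (maxn N N').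
  by move=> i /=; rewrite gtn_max => /andP.
- by exists W; split=> // N; apply: DW; exists N.
Qed.

Lemma morley_pieces n (X : finType) (F : set_system (X -> U)) B :
  UltraFilter F -> countable B -> exists y : pieces n -> X -> U,
  morley (fun i j => pieces_lt j i) (fun=> F) B y.
Proof.
move=> FU; elim: n B => [|n IH] B cB; first exact: morley_nat.
have [y2 my2] := IH B cB.
have [y1 my1] := IH _ (countableU cB (countable_seq_set y2)).
exists (fun i => match i with inl a => y1 a | inr a => y2 a end) => -[a|a].
  apply: reals_mono (my1 a) => u [Bu|[[j|j] [x [ja ->]]]].
  - by left; left.
  - by right; exists j, x.
  - by left; right; exists j, x.
apply: reals_mono (my2 a) => u [Bu|[[j|j] [x [ja ->]]]] //; first by left.
by right; exists j, x.
Qed.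

(* An indiscernible sequence indexed by [nat] is stretched to [pieces n] by
   iterating its limit type along an ultrafilter. *)
Lemma stretch n (X : finType) (z : nat -> X -> U) :
  indiscernible (fun i j => (i < j)%N) M z -> exists y : pieces n -> X -> U,
  forall s (i : 'I_s -> pieces n), increasing (@pieces_lt n) i ->
    eqM (fun w : 'I_s * X => z w.1 w.2) (fun w : 'I_s * X => y (i w.1) w.2).
Proof.
move=> iz; have [W [WU Wfree]] := free_ultra.
pose F := [set P : set (X -> U) | W (z @^-1` P)].
have FU : UltraFilter F by exact: ultra_image.
have [y my] := morley_pieces n FU (countable_seq_set z).
exists y => s i ii.
(* Entries before [t] come from [z], the others from [y]. The induction on [d] passes from [z] to
   [y] one entry at a time, beginning with the last, because each term of [y] realizes the limit
   type over [z] and the later terms of [y]. *)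
pose mix t (J : 'I_s -> nat) (w : 'I_s * X) :=
  if (w.1 < t)%N then z (J w.1) w.2 else y (i w.1) w.2.
pose incr (J : 'I_s -> nat) := forall a b : 'I_s, (a < b)%N -> (J a < J b)%N.
suff H d : (d <= s)%N -> forall J, incr J -> forall R : set ('I_s * X -> U), dfn R ->
    R (mix (s - d)%N J) <-> R (fun w => z w.1 w.2).
  move=> R dR Rz; have := H s (leqnn s) val (fun a b => id) R dR.
  rewrite subnn => -[_ /(_ Rz)].
  by rewrite (_ : mix 0 val = fun w => y (i w.1) w.2) //; apply: funext.
elim: d => [|d IH] ds J iJ R dR.
  rewrite subn0 (_ : mix s J = fun w => z (J w.1) w.2); last first.
    by apply: funext => w; rewrite /mix ltn_ord.
  have /eqM_tp H := iz s J val iJ (fun a b => id).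
  by split; [exact: H|exact: eqM_sym H R dR].
have {}IH := IH (ltnW ds).
have t0s : (s - d.+1 < s)%N by rewrite ltn_subrL /= (leq_trans _ ds).
have tE : (s - d = (s - d.+1).+1)%N by rewrite -subSn // subSS.
rewrite tE in IH; set t0 := (s - d.+1)%N in IH t0s tE *.
pose t : 'I_s := Ordinal t0s.
(* [z 0] is a placeholder at the entry [t], which [R'] overrides. *)
pose c (w : 'I_s * X) := if w.1 == t then z 0 w.2 else mix t0 J w.
pose A := seq_set z `|` [set u | exists j x, pieces_lt (i t) j /\ u = y j x].
have cA : tuple_in A c.
  move=> [w x]; rewrite /c /mix /=; case: eqP => [_|wt]; first by left; exists 0, x.
  case: ltnP => wt0; first by left; exists (J w), x.
  right; exists (i w), x; split=> //; apply: ii.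
  by rewrite /= ltn_neqAle wt0 andbT; apply/eqP => E; apply: wt; apply: val_inj.
pose R' (e : X + 'I_s * X -> U) :=
  R (fun w => if w.1 == t then e (inl w.2) else e (inr w)).
have dR' : dfn R'.
  apply: (dfn_sub (f := fun w : 'I_s * X => if w.1 == t then inl w.2 else inr w)) dR.
  by move=> e w; rewrite /=; case: ifP.
have E1 : R (mix t0 J) = R' (tcat (y (i t)) c).
  congr R; apply: funext => -[w x] /=; rewrite /c /=; case: eqP => [->|//].
  by rewrite /mix /= ltnn.
have [N HN] : exists N, forall a, (J a < N)%N.
  exists (\max_(a < s) J a).+1 => a; rewrite ltnS; exact: leq_bigmax.
have E2 k : (N < k)%N -> R' (tcat (z k) c) <-> R (fun w => z w.1 w.2).
  (* Beyond all values of [J], the term [z k] can serve as entry [t0]; after [t0] the values of [J']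
     just keep it increasing. *)
  move=> Nk; pose J' (w : 'I_s) := if (w < t0)%N then J w else (k + (w - t0))%N.
  have iJ' : incr J'.
    move=> a b ab; rewrite /J'; case: (ltnP a t0) => ha; case: (ltnP b t0) => hb.
    - exact: iJ.
    - by rewrite (leq_trans (HN a)) // (leq_trans (ltnW Nk)) ?leq_addr.
    - by move: (leq_trans hb ha) => /ltnW; rewrite leqNgt ab.
    - by rewrite ltn_add2l ltn_sub2rE.
  rewrite -(IH J' iJ' R dR) /R'; have -> // : (fun w : 'I_s * X =>
    if w.1 == t then tcat (z k) c (inl w.2) else tcat (z k) c (inr w)) = mix t0.+1 J'.
  apply: funext => -[w x]; rewrite /mix /J' /c /=; case: eqP => [->|wt] /=.
    by rewrite ltnn ltnSn subnn addn0.
  have {}wt : (w : nat) <> t0 by move=> E; apply: wt; exact: val_inj.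
  by rewrite ltnS leq_eqVlt; case: eqP => //= _; rewrite /mix /=; case: ltnP.
rewrite E1 -(realsP FU (my (i t)) dR' cA); split.
  move=> FR; have /filter_ex[k [Nk Rk]] :
      W ([set k | (N < k)%N] `&` z @^-1` [set v | R' (tcat v c)]) by exact: filterI.
  by apply/(E2 k).
move=> Rz; have : W (z @^-1` [set v | R' (tcat v c)]); last by [].
by apply: filterS (Wfree N) => k Nk; apply/(E2 k).
Qed.

(** Pair number [l] is put into piece [l] of a stretched sequence, along which a copy [x'] of [x]
    alternates in the same way; yet some piece is indiscernible over [x']. *)
Lemma nip (X Y : finType) (z : nat -> Y -> U) (R : set (X + Y -> U)) :
  indiscernible (fun i j => (i < j)%N) M z -> dfn R ->
  ~ exists x, forall l, (l < 2 ^ #|X|)%N ->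
    ~ (R (tcat x (z l.*2)) <-> R (tcat x (z l.*2.+1))).
Proof.
move=> iz dR [x flip]; set n := #|X|; set s := (2 ^ n).*2.
have [y Hy] := stretch n iz.
have iy : indiscernible (@pieces_lt n) M y.
  move=> m i j ii ij; apply/eqM_tp; apply: eqM_trans (eqM_sym (Hy _ _ ii)) (Hy _ _ ij).
(* The pieces are ordered backwards, so the even member of a pair gets position 1 and the odd one
   position 0. *)
pose i (w : 'I_s) := piece n w./2 (~~ odd w).
have ws (w : 'I_s) : (w./2 < 2 ^ n)%N by rewrite -(half_double (2 ^ n)) ltn_half_double ?half_double ?ltn_ord.
have ii : increasing (@pieces_lt n) i.
  move=> a b ab; apply: pieces_lt_piece => //.
  have := half_leq (ltnW ab); rewrite leq_eqVlt => /orP[/eqP E|->//].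
  have := ab; rewrite -{1}(odd_double_half a) -{1}(odd_double_half b) E eqxx ltnn /=.
  by rewrite ltn_add2r; case: (odd a); case: (odd b).
have [x' Hx'] := eqM_extend x (Hy s i ii).
pose ev : 'I_n -> X := enum_val.
have [l ln il] := piece_indiscernible (x' \o ev) (@subset_refl _ _) countM iy.
have ls (b : bool) : (b + l.*2 < s)%N.
  rewrite /s; case: b => /=; rewrite ?ltn_double // add1n ltn_Sdouble //.
have lE (b : bool) : (b + l.*2)./2 = l /\ odd (b + l.*2) = b.
  by rewrite half_bit_double oddD odd_double addbF; case: b.
pose pt (b : bool) := Ordinal (ls b).
pose rr (b : bool) : X + Y -> ('I_s * Y) + X := fun w => match w with
  | inl a => inr a | inr a => inl (pt b, a) end.
have Rpt (b : bool) : dfn (fun e => R (e \o rr b)) by apply: (dfn_sub (f := rr b)) dR.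
have pt0 : tcat (fun w : 'I_s * Y => z w.1 w.2) x \o rr false = tcat x (z l.*2).
  by apply: funext => -[].
have pt1 : tcat (fun w : 'I_s * Y => z w.1 w.2) x \o rr true = tcat x (z l.*2.+1).
  by apply: funext => -[].
have pt' b : tcat (fun w : 'I_s * Y => y (i w.1) w.2) x' \o rr b
    = tcat x' (y (piece n l (~~ b))).
  by apply: funext => -[a|a] //=; rewrite /i /=; have [-> ->] := lE b.
have := flip l ln; rewrite -pt0 -pt1.
have := dfn_not (dfn_iff (Rpt false) (Rpt true)) => /Hx' /[apply]; rewrite !pt'; apply.
have [H1 H0] : (increasing (fun i j : nat => (j < i)%N) (fun _ : 'I_1 => 1)) /\
    (increasing (fun i j : nat => (j < i)%N) (fun _ : 'I_1 => 0)).
  by split=> -[[|?] ?] [[|?] ?].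
have xin : tuple_in (M `|` range (x' \o ev)) x'.
  by move=> a; right; exists (enum_rank a) => //=; rewrite /ev enum_rankK.
have E := eqM_eq_tp (@subsetUl _ _ _) (il 1 _ _ H1 H0) xin.
pose r (w : X + Y) : X + 'I_1 * Y := match w with inl a => inl a | inr a => inr (ord0, a) end.
have dr : dfn (fun e => R (e \o r)) by apply: (dfn_sub (f := r)) dR.
have rE (k : nat) : tcat x' (fun w : 'I_1 * Y => y (piece n l k) w.2) \o r
    = tcat x' (y (piece n l k)) by apply: funext => -[].
by rewrite -!rE; split; [exact: (E _ dr)|exact: (eqM_sym E dr)].
Qed.

Lemma indiscernible_reindex I J (ltI : I -> I -> Prop) (ltJ : J -> J -> Prop) (g : I -> J)
    A X (y : J -> X -> U) : (forall i j, ltI i j -> ltJ (g i) (g j)) ->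
  indiscernible ltJ A y -> indiscernible ltI A (y \o g).
Proof.
move=> gI iy n i j ii ij; apply: (iy n (g \o i) (g \o j)).
  by move=> a b ab; apply/gI/ii.
by move=> a b ab; apply/gI/ij.
Qed.

(** Let [l] instances be consistent but not [l + 1]. A solution for the first [l] even indices then
    fails at each odd index in between, since otherwise [l + 1] instances would be solved; once [l]
    reaches the bound this is too much alternation. *)
Lemma indiscernible_consistent (X Y : finType) (z : nat -> Y -> U) (R : set (X + Y -> U)) :
  indiscernible (fun i j => (i < j)%N) M z -> dfn R ->
  (exists x, forall i, (i < 2 ^ #|X|)%N -> R (tcat x (z i))) ->
  forall l, exists x, forall i, (i < l)%N -> R (tcat x (z i)).
Proof.
move=> iz dR ex0.
pose C l (g : nat -> nat) := exists x, forall i : 'I_l, R (tcat x (z (g i))).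
have CE l g : (forall i j, (i < j)%N -> (g i < g j)%N) -> C l g <-> C l id.
  move=> gI; pose S (e : 'I_l * Y -> U) := exists x, forall i : 'I_l, R (tcat x (fun a => e (i, a))).
  have dS : dfn S.
    apply: (dfn_ex (R := fun e : X + 'I_l * Y -> U => forall i : 'I_l,
      R (tcat (e \o inl) (fun a => e (inr (i, a)))))).
    apply: dfn_all_fin => i.
    apply: (dfn_sub (f := fun s => match s with inl x => inl x | inr a => inr (i, a) end)) dR.
    by move=> e [].
  have /eqM_tp E := iz l (g \o val) val (fun a b ab => gI _ _ ab) (fun a b => id).
  by split; [exact: E _ dS|exact: (eqM_sym E dS)].
elim=> [|l [x Hx]].
  by have [x _] := ex0; exists x.
have [le|gt] := ltnP l (2 ^ #|X|).
  have [x' Hx'] := ex0; exists x' => i il; apply: Hx'; exact: leq_trans il le.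
have : C l id by exists x => i; exact: Hx.
rewrite -(CE l double); last by move=> i j; rewrite ltn_double.
move=> [x' Hx']; apply: contrapT => none.
have [] := nip iz dR; exists x' => k kl [+ _].
have kl' : (k < l)%N := leq_trans kl gt.
have /= H0 := Hx' (Ordinal kl').
move=> /(_ H0) H1; apply: none.
(* The indices 0, 2, ..., 2k, 2k+1, 2k+2, 2k+4, ...: the even ones and a single odd one. *)
pose g i := if (i <= k)%N then i.*2 else if i == k.+1 then k.*2.+1 else i.-1.*2.
suff : C l.+1 id by move=> [x2 H2]; exists x2 => i il; exact: (H2 (Ordinal il)).
rewrite -(CE l.+1 g); last by move=> i j; rewrite /g; do !case: ifP; lia.
exists x' => -[i il]; rewrite /g /=; case: ifP => ik.
  exact: (Hx' (Ordinal (leq_ltn_trans ik kl'))).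
case: eqP => [_|/eqP ik1]; first exact: H1.
have il' : (i.-1 < l)%N by lia.
exact: (Hx' (Ordinal il')).
Qed.

Lemma fsat_sub X Y (f : X -> Y) A (y : Y -> U) : fsat A y -> fsat A (y \o f).
Proof.
move=> fy Z R c dR cA Ry.
have dR' : dfn (fun e : Y + Z -> U => R (tcat (e \o inl \o f) (e \o inr))).
  apply: (dfn_sub (f := fun s => match s with inl x => inl (f x) | inr z => inr z end)) dR.
  by move=> e [].
have [y' yM Ry'] := fy _ _ c dR' cA Ry.
by exists (y' \o f) => // x; exact: yM.
Qed.

Lemma fsat_eqM (X : Type) (Y : finType) (x x' : X -> U) (y y' : Y -> U) :
  eqM (tcat y x) (tcat y' x') -> fsat (range y) x -> fsat (range y') x'.
Proof.
move=> E fx Z R c dR cA Rx'.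
have /choice[f fE] : forall z, exists a, c z = y' a.
  by move=> z; have [a _ <-] := cA z; exists a.
have {}fE : c = y' \o f by apply: funext => z; rewrite fE.
have dR' : dfn (fun e : Y + X -> U => R (tcat (e \o inr) (e \o inl \o f))).
  apply: (dfn_sub (f := fun s => match s with inl x => inr x | inr z => inl (f z) end)) dR.
  by move=> e [].
have Rx : R (tcat x (y \o f)) by apply: (eqM_sym E dR'); rewrite fE in Rx'.
have [|x0 x0M Rx0] := fx _ _ (y \o f) dR _ Rx; first by move=> z; exists (f z).
exists x0 => //; rewrite fE; apply: (eqM_catM x0M _ dR Rx0).
by apply: eqM_sub; exact: (eqM_subE (f := inl) _ _ E).
Qed.

(** Parameters in [M] are absorbed by the definable set. *)
Lemma reals_M X (F : set_system (X -> U)) A x : reals F A x -> reals F (sub_set M `|` A) x.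
Proof.
move=> Fx Y R b dR bMA; have [u0 Mu0] := sub_nonempty M.
pose Q := [pred y : Y | ~~ `[< sub_set M (b y) >]].
pose mk (y : Y) : induced M := match pselect (sub_set M (b y)) with
  | left h => exist _ (b y) h | right _ => exist _ u0 Mu0 end.
pose f (s : X + Y) : (X + {y | Q y}) + induced M := match s with
  | inl x => inl (inl x)
  | inr y => if insub y is Some y' then inl (inr y') else inr (mk y) end.
pose b' (y : {y | Q y}) := b (val y).
have E x0 : tcat x0 b =1 (fun s => tcat (tcat x0 b') (@sval _ _) (f s)).
  move=> [a|y] //=; case: insubP => [y' Qy' yE|] /=; first by rewrite /b' yE.
  by rewrite negbK => /asboolP My; rewrite /mk; case: pselect.
pose R' (e : X + {y | Q y} -> U) := R (fun s => tcat e (@sval _ _) (f s)).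
have dR' : dfn R' by apply: (dfn_subM (f := f)) dR.
have RE x0 : R (tcat x0 b) = R' (tcat x0 b') by rewrite /R' (funext (E x0)).
rewrite RE (_ : [set x0 | R (tcat x0 b)] = [set x0 | R' (tcat x0 b')]); last first.
  by apply: funext => x0; exact: RE.
apply: (Fx _ R' b' dR') => -[y Qy]; have /asboolP nMy := Qy.
by case: (bMA y).
Qed.

Lemma reals_cat X (Y : finType) (F : set_system (X -> U)) A (t : Y -> U) x :
  (forall (Z : finType) (a : Z -> U) (R : set (X + (Z + Y) -> U)), dfn R ->
    tuple_in (sub_set M `|` A) a ->
    F [set x | R (tcat x (tcat a t))] -> R (tcat x (tcat a t))) ->
  reals F (A `|` range t) x.
Proof.
move=> H Z R c dR cA; have [u0 Mu0] := sub_nonempty M.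
have /choice[o oP] : forall z, exists o : option Y,
    if o is Some y then c z = t y else A (c z).
  by move=> z; case: (cA z) => [?|[y _ <-]]; [exists None|exists (Some y)].
pose a z := if o z is Some _ then u0 else c z.
pose f z : Z + Y := if o z is Some y then inr y else inl z.
have cE : c = tcat a t \o f.
  apply: funext => z; rewrite /= /f; move: (oP z).
  by case oz : (o z) => [y|] //=; rewrite /a oz.
rewrite cE; apply: (H Z a (fun e => R (tcat (e \o inl) (e \o inr \o f)))).
  apply: (dfn_sub (f := fun s => match s with inl x => inl x | inr z => inr (f z) end)) dR.
  by move=> e [].
by move=> z; rewrite /a; move: (oP z); case: (o z) => [_ _|]; [left|right].
Qed.

Lemma reals_iff X (F : set_system (X -> U)) A x (Y : finType) (R : set (X + Y -> U)) c :
  UltraFilter F -> reals F A x -> dfn R -> tuple_in (sub_set M `|` A) c ->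
  F [set x | R (tcat x c)] <-> R (tcat x c).
Proof. by move=> FU /reals_M Fx dR cA; exact: realsP FU Fx dR cA. Qed.

Lemma eqM_reals0 X (F : set_system (X -> U)) A B x y : UltraFilter F -> inv F ->
  reals F A x -> reals F B y -> eqM x y.
Proof.
move=> FU iF Fx Fy.
have := eqM_reals FU iF Fx Fy (b := of_void U) (c := of_void U).
move=> /(_ _ _ (@eqM_refl _ _)) E.
by apply: (eqM_subE (f := inl)) (E _ _).
Qed.

(* [(u, v)] is the beginning of a Morley sequence of a coheir over [M]. *)
Definition coheir_pair (Y : finType) (u v : Y -> U) : Prop :=
  exists s : set_system (Y -> U), [/\ UltraFilter s, s [set y | tuple_in M y],
    reals s set0 u & reals s (range u) v].

(** A coheir of the type of [b] over [M] is realized over all of [A], so the same [e] forms a pair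
    with each conjugate of [b] in [A]. Conjugates can then be compared through [e]. *)
Lemma coheir_partner (Y : finType) (b : Y -> U) (A : set U) : countable A ->
  exists e, forall c, eqM b c -> range c `<=` A -> coheir_pair c e.
Proof.
move=> cA; have fb : fsat set0 b.
  move=> Z S d dS d0 Sbd; have dM : tuple_in M d by move=> y; case: (d0 y).
  by have [x xM Sx] := dfn_point (dfn_par dS dM) Sbd; exists x.
have [s [sU sM sb]] := fsat_coheir fb.
have [e se] := reals_ex (X := Y) (F := s) _ cA.
exists e => c bc cA'; exists s; split=> //; last exact: reals_mono se.
move=> Z S d dS d0 sS; have dM : tuple_in M d by move=> y; case: (d0 y).
exact: (bc _ (dfn_par dS dM) (sb _ _ _ dS d0 sS)).
Qed.

(** The order of the quantifiers fits a pair with [v] realizing [s] over [u]: when [s] concentrates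
    on [M], [v] ranges over tuples of [M], for which [R(u; v)] depends only on the type of [u] over
    [M]. *)
Definition pair_prod (Y : finType) (s : set_system (Y -> U)) : set_system (Y + Y -> U) :=
  [set P | s [set v | s [set u | P (tcat u v)]]].

Lemma pair_prod_ultra (Y : finType) (s : set_system (Y -> U)) :
  UltraFilter s -> UltraFilter (pair_prod s).
Proof.
move=> sU.
have PF : ProperFilter (pair_prod s).
  split; last split.
  - move=> H; have /filter_ex[v /filter_ex[u //]] : s [set v | s set0] := H.
  - by rewrite /pair_prod /=; apply: filterE => v; exact: filterT.
  - move=> P Q; rewrite /pair_prod /= => sP sQ.
    by apply: filterS2 sP sQ => v /=; exact: filterI.
  - move=> P Q PQ; rewrite /pair_prod /=; apply: filterS => v /=.
    by apply: filterS => u /=; exact: PQ.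
split=> // G GF sG; apply/seteqP; split=> // P GP; apply: contrapT.
move=> /(ultra_not sU) sP.
have /sG GnP : pair_prod s (~` P).
  by rewrite /pair_prod /=; apply: filterS sP => v /= /(ultra_not sU).
by have [x []] := filter_ex (filterI GP GnP).
Qed.

(** For a Morley sequence of [Q], the last two components form a Morley sequence of [s] read two
    terms at a time. To ensure this, the sets of [pair_prod s] are put into [D] besides the type of
    [(w, u, v)]. *)
Lemma coheir_pair_extension (W Y : finType) (w : W -> U) (u v : Y -> U) s :
  UltraFilter s -> s [set y | tuple_in M y] -> reals s set0 u -> reals s (range u) v ->
  exists Q : set_system (W + (Y + Y) -> U), [/\ UltraFilter Q, Q [set t | tuple_in M t],
    reals Q set0 (tcat w (tcat u v)) &
    forall A t, reals Q A t -> reals s A (t \o inr \o inl) /\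
      reals s (A `|` range (t \o inr \o inl)) (t \o inr \o inr)].
Proof.
move=> sU sM su sv; have s2U := pair_prod_ultra sU.
pose D : set (set (W + (Y + Y) -> U)) := [set B | exists R P, [/\ dfn R,
  R (tcat w (tcat u v)), pair_prod s P &
  B = [set t | [/\ tuple_in M t, R t & P (t \o inr)]]]].
have [|||Q [QU DQ]] := @directed_ultra _ D.
- exists [set t | [/\ tuple_in M t, ~ False & setT (t \o inr)]].
  exists (fun=> ~ False), setT; split=> //; [exact/dfn_not/dfn_false|exact: filterT].
- move=> B [R [P [dR Rwuv sP ->]]].
  have dT : dfn (fun e : Y + Y -> U => exists w, R (tcat w e)) by exact: dfn_ex.
  have sT : pair_prod s (fun e : Y + Y -> U => exists w, R (tcat w e)).
    pose T (e : Y + Y -> U) := exists w, R (tcat w e).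
    have dT' : dfn (fun e : Y + Y -> U => T (tcat (e \o inr) (e \o inl))).
      apply: (dfn_sub (f := fun s => match s with inl x => inr x | inr z => inl z end)) dT.
      by move=> e [].
    have Tuv : T (tcat u v) by exists w.
    have : s [set v | T (tcat u v)].
      exact: (proj2 (realsP sU sv (R := fun e => T (tcat (e \o inr) (e \o inl))) dT' _)).
    move=> suT; rewrite /pair_prod /=; apply: filterS2 suT sM => v' /= Tuv' v'M.
    apply: (proj2 (reals_iff sU su (R := T) dT _)) => //.
    by move=> y; left.
  have sMM : pair_prod s [set e | tuple_in M e].
    rewrite /pair_prod /=; apply: (filterS _ sM) => v' v'M; apply: (filterS _ sM) => u' u'M; by case.
  have [e [[[w' Rw'e] Pe] eM]] := filter_ex (filterI (filterI sT sP) sMM).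
  have [w0 w0M Rw0] := dfn_point (dfn_par dR eM) Rw'e.
  by exists (tcat w0 e); split=> //; case.
- move=> B B' [R [P [dR Rwuv sP ->]]] [R' [P' [dR' Rwuv' sP' ->]]].
  exists [set t | [/\ tuple_in M t, R t /\ R' t & (P `&` P') (t \o inr)]].
    by exists (fun t => R t /\ R' t), (P `&` P'); split=> //; [exact: dfn_and|exact: filterI].
  by move=> t [? [? ?] [? ?]].
have QR R : dfn R -> R (tcat w (tcat u v)) -> Q R.
  move=> dR Rwuv; suff : Q [set t | [/\ tuple_in M t, R t & setT (t \o inr)]].
    by apply: filterS => t [].
  by apply: DQ; exists R, setT; split=> //; exact: filterT.
have QP P : pair_prod s P -> Q [set t : W + (Y + Y) -> U | P (t \o inr)].
  move=> sP; suff : Q [set t | [/\ tuple_in M t, ~ False & P (t \o inr)]].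
    by apply: filterS => t [].
  by apply: DQ; exists (fun=> ~ False), P; split=> //; exact/dfn_not/dfn_false.
exists Q; split=> //.
- suff : Q [set t | [/\ tuple_in M t, ~ False & setT (t \o inr)]].
    by apply: filterS => t [].
  by apply: DQ; exists (fun=> ~ False), setT; split=> //; [exact/dfn_not/dfn_false|exact: filterT].
- move=> Z R c dR c0 QRc; apply: contrapT => nR.
  have cM : tuple_in M c by move=> z; case: (c0 z).
  have := QR _ (dfn_not (dfn_par dR cM)) nR.
  by move=> /(filterI QRc)/filter_ex[t [? ?]].
move=> A t Qt.
have Qt' (Z : finType) (a : Z -> U) (P : set ((Y + Y) + Z -> U)) : dfn P ->
    tuple_in (sub_set M `|` A) a -> pair_prod s [set e | P (tcat e a)] ->
    P (tcat (t \o inr) a).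
  move=> dP aA /QP sP.
  have dP' : dfn (fun e : (W + (Y + Y)) + Z -> U => P (tcat (e \o inl \o inr) (e \o inr))).
    apply: (dfn_sub (f := fun s => match s with inl x => inl (inr x) | inr z => inr z end)) dP.
    by move=> e [].
  exact: (proj1 (reals_iff QU Qt dP' aA)).
have tu : reals s A (t \o inr \o inl).
  move=> Z R c dR cA sRc.
  have dR' : dfn (fun e : (Y + Y) + Z -> U => R (tcat (e \o inl \o inl) (e \o inr))).
    apply: (dfn_sub (f := fun s => match s with inl x => inl (inl x) | inr z => inr z end)) dR.
    by move=> e [].
  apply: (Qt' Z c _ dR') => [z|]; first by right.
  by rewrite /pair_prod /=; apply: filterE => v'; exact: sRc.
split=> //; apply: reals_cat => Z a R dR aA sR; apply: contrapT => nR.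
pose N (e : (Y + Y) + Z -> U) :=
  R (tcat (e \o inl \o inr) (tcat (e \o inr) (e \o inl \o inl))).
have dN : dfn N.
  apply: (dfn_sub (f := fun s => match s with inl x => inl (inr x)
    | inr (inl z) => inr z | inr (inr x) => inl (inl x) end)) dR.
  by move=> e [|[]].
have s2N : ~ pair_prod s [set e | N (tcat e a)] by move=> /(Qt' _ _ _ dN aA).
have /(ultra_not s2U) := s2N => {}s2N.
have {}s2N : s [set v | s [set u | ~ N (tcat (tcat u v) a)]] := s2N.
(* [R] holds at [v'] and the [u]-component of [t]; but it fails at [v'] for [s]-almost all [u],
   hence for that component too, because [v'] lies in [M]. *)
have [v' [[/= sN Rv'] v'M]] := filter_ex (filterI (filterI s2N sR) sM).
pose N' (e : Y + (Y + Z) -> U) :=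
  R (tcat (e \o inr \o inl) (tcat (e \o inr \o inr) (e \o inl))).
have dN' : dfn N'.
  apply: (dfn_sub (f := fun s => match s with inl x => inr (inl x)
    | inr (inl z) => inr (inr z) | inr (inr x) => inl x end)) dR.
  by move=> e [|[]].
have : ~ N' (tcat (t \o inr \o inl) (tcat v' a)).
  apply: (proj1 (reals_iff sU tu (dfn_not dN') _)) => //.
  by move=> [y|z]; [left; exact: v'M|exact: aA].
exact.
Qed.

(** * Non-forking formulas belong to invariant types *)

Section Broom.
Variables (X : finType).
Variable Phi : set_system (X -> U).
Hypotheses (PhiP : ProperFilter Phi) (Phii : inv Phi).

(** [B(x; w)] is negligible for the filter [Phi], but only against disjuncts whose parameters are
    finitely satisfiable in [M] over [w]; in this form negligibility survives [eliminable_pair].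
    With [Psi] empty and no parameters it says that [Phi] does not contain [B(x; w)]. *)
Definition eliminable (W : finType) (w : W -> U) (B : set (X + W -> U)) : Prop :=
  forall (Z : finType) (C : Z -> U) (Psi : set (X + Z -> U)), dfn Psi ->
    fsat (range w) C -> Phi [set x | B (tcat x w) \/ Psi (tcat x C)] ->
    Phi [set x | Psi (tcat x C)].

Lemma eliminable_eqM (W : finType) (w w' : W -> U) B : dfn B -> eqM w w' ->
  eliminable w B -> eliminable w' B.
Proof.
move=> dB ww' ew Z C' Psi dPsi fC' PhiB.
have [C E] := eqM_extend C' (eqM_sym ww').
pose R (e : X + (W + Z) -> U) :=
  B (tcat (e \o inl) (e \o inr \o inl)) \/ Psi (tcat (e \o inl) (e \o inr \o inr)).
have dR : dfn R.
  apply: dfn_or.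
    apply: (dfn_sub (f := fun s => match s with inl x => inl x | inr w => inr (inl w) end)) dB.
    by move=> e [].
  apply: (dfn_sub (f := fun s => match s with inl x => inl x | inr w => inr (inr w) end)) dPsi.
  by move=> e [].
have EC : eqM C' C by apply: (eqM_subE (f := inr)) E.
apply: (Phii dPsi (eqM_sym EC)).
apply: (ew _ _ _ dPsi); first exact: fsat_eqM E fC'.
exact: (Phii dR E PhiB).
Qed.

Lemma fsat_morley (T : finType) (Q : set_system (T -> U)) (t : nat -> T -> U) :
  UltraFilter Q -> Q [set t | tuple_in M t] ->
  morley (fun i j => (i < j)%N) (fun=> Q) M t -> forall m j,
  fsat (sub_set M `|` [set u | exists i x, (i < j)%N /\ u = t i x])
       (fun z : 'I_m * T => t (j + z.1)%N z.2).
Proof.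
move=> QU QM mt m j; elim: m => [|m IH].
  by move=> Y R c dR cA RY; exists (fun z : 'I_0 * T => t (j + z.1)%N z.2) => // -[[]].
pose f (z : 'I_m.+1 * T) : 'I_m * T + T :=
  if unlift ord_max z.1 is Some i then inl (i, z.2) else inr z.2.
have : fsat (sub_set M `|` [set u | exists i x, (i < j)%N /\ u = t i x])
    (tcat (fun z : 'I_m * T => t (j + z.1)%N z.2) (t (j + m)%N)).
  apply: fsat_trans IH _; apply: fsat_mono (coheir_fsat QU QM (mt (j + m)%N)).
  move=> u [[Mu|[i [x [ij ->]]]]|[z _ <-]]; first by left.
    by right; exists i, x; rewrite ltn_addr.
  by right; exists (j + z.1)%N, z.2; rewrite ltn_add2l.
move=> /(fsat_sub (f := f)); congr (fsat _ _); apply: funext => -[i x] /=.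
by rewrite /f /=; case: unliftP => [i' ->|->]; rewrite ?lift_max.
Qed.

(** The earliest block is eliminated first: the later blocks and [C] are finitely satisfiable in [M]
    over it. *)
Lemma eliminable_blocks (W S T Z : finType) (i : W -> T) (Q : set_system (T -> U))
    (t : nat -> T -> U) B (C : Z -> U) Psi :
  UltraFilter Q -> Q [set t | tuple_in M t] ->
  morley (fun i j => (i < j)%N) (fun=> Q) M t ->
  dfn B -> (forall l, eliminable (t l \o i) B) ->
  dfn Psi -> fsat (sub_set M `|` seq_set t) C -> forall m j,
  Phi [set x | (exists l : 'I_m, B (tcat x (t (j + l)%N \o i))) \/ Psi (tcat x C)] ->
  Phi [set x | Psi (tcat x C)].
Proof.
move=> QU QM mt dB et dPsi fC; elim=> [|m IH] j PhiB.
  by apply: filterS PhiB => x /= [[[]]|].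
apply: (IH j.+1).
pose C' := tcat (fun z : 'I_m * T => t (j.+1 + z.1)%N z.2) C.
pose Psi' (e : X + ('I_m * T + Z) -> U) :=
  (exists l : 'I_m, B (tcat (e \o inl) (fun w => e (inr (inl (l, i w)))))) \/
  Psi (tcat (e \o inl) (e \o inr \o inr)).
have dPsi' : dfn Psi'.
  apply: dfn_or.
    apply: dfn_ex_fin => l.
    apply: (dfn_sub (f := fun s => match s with inl x => inl x
      | inr w => inr (inl (l, i w)) end)) dB; by move=> e [].
  apply: (dfn_sub (f := fun s => match s with inl x => inl x | inr w => inr (inr w) end)) dPsi.
  by move=> e [].
have fC' : fsat (range (t j \o i)) C'.
  have fjC : fsat (sub_set M `|` [set u | exists i x, (i < j.+1)%N /\ u = t i x]) C'.
    apply: fsat_trans; first exact: fsat_morley.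
    apply: fsat_mono fC => u [[Mu|[l [x [_ ->]]]]|[z _ <-]]; first by left.
      by right; exists l, x.
    by right; exists (j.+1 + z.1)%N, z.2.
  apply: fsat_mono fjC => _ [w _ <-]; right; exists j, (i w); rewrite ltnSn.
  by [].
have := et j _ C' Psi' dPsi' fC'; apply.
apply: filterS PhiB => x [[l Bl]|Px]; last by right; right.
move: Bl; case: (unliftP ord0 l) => [l' ->|->] Bl.
  by right; left; exists l'; move: Bl; rewrite /= addSnnS.
by left; move: Bl; rewrite /= addn0.
Qed.

Lemma filter_all_lt (P : nat -> set (X -> U)) k : (forall l, Phi (P l)) ->
  Phi [set x | forall l, (l < k)%N -> P l x].
Proof.
move=> PhiP'; elim: k => [|k IH]; first by apply: filterE.
apply: filterS2 IH (PhiP' k) => x IHx Pk l.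
by rewrite ltnS leq_eqVlt => /orP[/eqP ->|/IHx].
Qed.

Definition add_pair (W Y : Type) (B : set (X + W -> U)) (R : set (X + Y -> U)) :
    set (X + (W + (Y + Y)) -> U) := fun e =>
  B (tcat (e \o inl) (e \o inr \o inl)) \/
  ~ (R (tcat (e \o inl) (e \o inr \o inr \o inl)) <->
     R (tcat (e \o inl) (e \o inr \o inr \o inr))).

Lemma dfn_add_pair (W Y : Type) (B : set (X + W -> U)) (R : set (X + Y -> U)) :
  dfn B -> dfn R -> dfn (add_pair B R).
Proof.
move=> dB dR; apply: dfn_or.
  apply: (dfn_sub (f := fun s => match s with inl x => inl x | inr w => inr (inl w) end)) dB.
  by move=> e [].
apply/dfn_not/dfn_iff.
  apply: (dfn_sub (f := fun s => match s with inl x => inl x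
    | inr y => inr (inr (inl y)) end)) dR; by move=> e [].
apply: (dfn_sub (f := fun s => match s with inl x => inl x
  | inr y => inr (inr (inr y)) end)) dR; by move=> e [].
Qed.

(** By invariance [Phi] contains the disjunction for each of [2 ^ #|X|] copies of [(w, u, v)] in a
    Morley sequence. By [nip] no [x] makes [R] differ between [u] and [v] in all the copies, so [B]
    holds at one of them or [Psi] does; the copies of [B] are then eliminated in turn. *)
Lemma eliminable_pair (W Y : finType) (w : W -> U) B (u v : Y -> U) (R : set (X + Y -> U)) :
  dfn B -> eliminable w B -> coheir_pair u v -> dfn R ->
  eliminable (tcat w (tcat u v)) (add_pair B R).
Proof.
move=> dB ew [s [sU sM su sv]] dR Z C Psi dPsi fC PhiB.
have dB' := dfn_add_pair dB dR.
have [Q [QU QM Qwuv Qs]] := coheir_pair_extension w sU sM su sv.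
have Qi := coheir_inv QU QM.
have [t mt] := morley_nat (F := fun=> Q) (fun=> QU) countM.
have tE l : eqM (tcat w (tcat u v)) (t l) := eqM_reals0 QU Qi Qwuv (mt l).
have [QC [QCU QCM QCC]] := fsat_coheir fC.
have QCi := coheir_inv QCU QCM.
have [C' QCC'] := reals_ex (X := Z) (F := QC) _ (countableU countM (countable_seq_set t)).
have tCE l : eqM (tcat C (tcat w (tcat u v))) (tcat C' (t l)).
  apply: (eqM_reals QCU QCi QCC QCC') => [a|a|]; last exact: tE.
    by exists a.
  by right; exists l, a.
have CC' : eqM C C' := eqM_subE (f := inl) (fun=> erefl) (fun=> erefl) (tCE 0).
apply: (Phii dPsi (eqM_sym CC')).
have PhiB' l : Phi [set x | add_pair B R (tcat x (t l)) \/ Psi (tcat x C')].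
  pose S (e : X + (Z + (W + (Y + Y))) -> U) :=
    add_pair B R (tcat (e \o inl) (e \o inr \o inr)) \/ Psi (tcat (e \o inl) (e \o inr \o inl)).
  have dS : dfn S.
    apply: dfn_or.
      apply: (dfn_sub (f := fun s => match s with inl x => inl x | inr w => inr (inr w) end)) dB'.
      by move=> e [].
    apply: (dfn_sub (f := fun s => match s with inl x => inl x | inr w => inr (inl w) end)) dPsi.
    by move=> e [].
  exact: (Phii dS (tCE l) PhiB).
(* The [u] and [v] components in turn; by the choice of [Q] this is a Morley sequence of [s]. *)
pose z (i : nat) : Y -> U :=
  if odd i then t i./2 \o inr \o inr else t i./2 \o inr \o inl.
have iz : indiscernible (fun i j => (i < j)%N) M z.
  apply: (morley_indiscernible (F := s)) => //; first exact: coheir_inv.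
  have zt a x : exists y, z a x = t a./2 y.
    by rewrite /z; case: ifP => _; [exists (inr (inr x))|exists (inr (inl x))].
  move=> i; rewrite {2}/z; have [tu tv] := Qs _ _ (mt i./2).
  have half_lt a : (a < i)%N -> (a./2 < i./2)%N \/ [/\ odd i, ~~ odd a & a./2 = i./2].
    move=> ai; case: (ltnP a./2 i./2) => h; [by left|right].
    have := odd_double_half a; have := odd_double_half i; rewrite -!mul2n.
    by case: (odd i); case: (odd a) => /= Ei Ea; split=> //; lia.
  case: ifP => oi.
    apply: reals_mono tv => b [Mb|[a [x [ai ->]]]]; first by left; left.
    have [lt|[_ oa E]] := half_lt a ai.
      by have [y ->] := zt a x; left; right; exists a./2, y.
    by right; exists x => //=; rewrite /z (negbTE oa) E.
  apply: reals_mono tu => b [Mb|[a [x [ai ->]]]]; first by left.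
  have [lt|[]] := half_lt a ai; last by rewrite oi.
  by have [y ->] := zt a x; right; exists a./2, y.
apply: (@eliminable_blocks W void _ Z inl Q t B C' Psi QU QM mt dB _ dPsi _ (2 ^ #|X|) 0).
- move=> l; apply: eliminable_eqM dB _ ew.
  exact: (eqM_subE (f := inl) (fun=> erefl) (fun=> erefl) (tE l)).
- exact: coheir_fsat QCU QCM QCC'.
apply: filterS (filter_all_lt (2 ^ #|X|) PhiB') => x H.
apply: contrapT => /not_orP[nB nP].
apply: (nip iz dR); exists x => l lk E.
have [[Bl|nR]|//] := H l lk; first by apply: nB; exists (Ordinal lk).
by apply: nR; move: E; rewrite /z /= odd_double /= doubleK uphalf_double.
Qed.

End Broom.

(* This plays the role of the broom lemma of Chernikov and Kaplan. *)
Lemma invariant_extension (X : finType) (Phi : set_system (X -> U)) :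
  ProperFilter Phi -> inv Phi ->
  exists F : set_system (X -> U), [/\ UltraFilter F, inv F & Phi `<=` F].
Proof.
move=> PhiP Phii.
(* Besides [Phi], agreement on all coheir pairs is imposed. Finite parts are consistent because the
   failure of finitely many agreements is eliminable. *)
pose D : set (set (X -> U)) := Phi `|` [set P | exists (Y : finType) (u v : Y -> U)
  (R : set (X + Y -> U)), [/\ coheir_pair u v, dfn R &
    P = [set x | R (tcat x u) <-> R (tcat x v)]]].
have [|F [FU DF]] := @meets_ultra _ D.
  suff H P : meets D P -> exists (W : finType) (w : W -> U) (B : set (X + W -> U)),
      [/\ dfn B, eliminable Phi w B & Phi [set x | B (tcat x w) \/ P x]].
    move=> P /H[W [w [B [dB eB PhiB]]]]; apply: contrapT => nP.
    have P0 x : ~ P x by move=> Px; apply: nP; exists x.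
    have := eB void (of_void U) _ (@dfn_false _) _ _.
    move=> /(_ _ _)/filter_ex[] //.
      move=> Y R c dR cA Rc; exists (of_void U) => //; by case.
    by apply: filterS PhiB => x [|/P0]; [left|].
  elim=> [|P1 P2 [PhiP1|[Y [u [v [R [cuv dR ->]]]]]] _ [W [w [B [dB eB PhiB]]]]].
  - exists void, (of_void U), (fun=> False); split; first exact: dfn_false.
      by move=> Z C Psi _ _; apply: filterS => x [].
    by apply: filterE => x; right.
  - exists W, w, B; split=> //; apply: filterS2 PhiP1 PhiB => x P1x [|P2x]; [left|right] => //.
  - exists (W + (Y + Y))%type, (tcat w (tcat u v)), (add_pair B R); split.
    + exact: dfn_add_pair.
    + exact: eliminable_pair.
    + apply: filterS PhiB => x [Bx|P2x]; first by left; left.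
      have [E|nE] := pselect (R (tcat x u) <-> R (tcat x v)); first by right.
      by left; right.
exists F; split=> //; last by move=> P PhiP'; apply: DF; left.
move=> Y R b c dR bc Fb.
(* [b] and [c] agree because both agree with their common partner [e]. *)
have [e He] := coheir_partner b (countableU (countable_range b) (countable_range c)).
have FD (u : Y -> U) : eqM b u -> range u `<=` range b `|` range c ->
    F [set x | R (tcat x u) <-> R (tcat x e)].
  by move=> bu ubc; apply: DF; right; exists Y, u, e, R; split=> //; exact: He.
have Fbe := FD b (@eqM_refl _ _) (@subsetUl _ _ _).
have Fce := FD c bc (@subsetUr _ _ _).
by apply: filterS3 Fb Fbe Fce => x /= Rb [be _] [_ ec]; exact: ec (be Rb).
Qed.

(** * Dividing and forking from bounded alternation *)

Definition ord_cat k (T : Type) (u v : 'I_k -> T) (i : 'I_(k + k)) : T :=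
  match fintype.split i with inl a => u a | inr a => v a end.

Definition xor_formula X k (phi : formula L (X + 'I_k)) : formula L (X + 'I_(k + k)) :=
  let p := frename phi (fun s => match s with inl x => inl x | inr i => inr (lshift k i) end) in
  let q := frename phi (fun s => match s with inl x => inl x | inr i => inr (rshift k i) end) in
  Imp (Imp p q) (Not (Imp q p)).

Lemma sat_xor (S : structure L) X k (phi : formula L (X + 'I_k)) (x : X -> S) u v :
  sat (tcat x (ord_cat u v)) (xor_formula phi) <->
  ~ (sat (tcat x u) phi <-> sat (tcat x v) phi).
Proof.
rewrite /= !sat_rename.
have -> : tcat x (ord_cat u v) \o (fun s : X + 'I_k => match s with inl x => inl x
    | inr i => inr (lshift k i) end) = tcat x u.
  by apply: funext => -[//|i] /=; rewrite /ord_cat (unsplitK (inl _)).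
have -> : tcat x (ord_cat u v) \o (fun s : X + 'I_k => match s with inl x => inl x
    | inr i => inr (rshift k i) end) = tcat x v.
  by apply: funext => -[//|i] /=; rewrite /ord_cat (unsplitK (inr _)).
by tauto.
Qed.

Lemma eqM_ord_cat k (u v u' v' : 'I_k -> U) : eqM (tcat v u) (tcat v' u') ->
  eqM (ord_cat u v) (ord_cat u' v').
Proof.
apply: (eqM_subE (f := fun i => match fintype.split i with inl a => inr a | inr a => inl a end)).
  by move=> i; rewrite /ord_cat /=; case: (fintype.split i).
by move=> i; rewrite /ord_cat /=; case: (fintype.split i).
Qed.

(** Dividing speaks of arbitrary injections into the indices, [nip] of increasing sequences: the
    values of [f] are sorted and continued beyond their maximum. *)
Lemma increasing_extension k (f : 'I_k -> nat) : injective f ->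
  exists g : nat -> nat, (forall i j, (i < j)%N -> (g i < g j)%N) /\
    forall i, (i < k)%N -> exists t, f t = g i.
Proof.
move=> fI; pose l := sort leq (map f (enum 'I_k)).
have sl : size l = k by rewrite size_sort size_map size_enum_ord.
have lE x : x \in l -> exists t, f t = x.
  by rewrite mem_sort => /mapP[t _ ->]; exists t.
have ul : sorted ltn l.
  rewrite ltn_sorted_uniq_leq sort_uniq map_inj_uniq // enum_uniq /=.
  exact: (sort_sorted leq_total).
pose N := \max_(t < k) f t.
have lN i : (i < k)%N -> (nth 0 l i <= N)%N.
  move=> ik; have /lE[t <-] : nth 0 l i \in l by rewrite mem_nth ?sl.
  exact: leq_bigmax.
exists (fun i => if (i < k)%N then nth 0 l i else (N + i.+1)%N); split=> [i j ij|i ik].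
  case: (ltnP j k) => jk; last first.
    by case: (ltnP i k) => ik; [have := lN i ik; lia|lia].
  have ik : (i < k)%N := ltn_trans ij jk.
  by rewrite ik; apply: (sorted_ltn_nth ltn_trans) => //; rewrite inE sl.
by rewrite ik; apply: lE; rewrite mem_nth ?sl.
Qed.

(** The witness is a Morley sequence of [s] cut into consecutive pairs: one tuple cannot tell apart
    the members of each of [2 ^ #|X|] pairs. *)
Lemma coheir_pair_divides (X : finType) k (phi : formula L (X + 'I_k)) u v :
  coheir_pair u v -> divides M (Pform (xor_formula phi) (ord_cat u v)).
Proof.
move=> [s [sU sM su sv]]; have si := coheir_inv sU sM.
have [z mz] := morley_nat (F := fun=> s) (fun=> sU) countM.
have iz := morley_indiscernible sU si mz.
exists (2 ^ #|X|)%N, (fun i => ord_cat (z i.*2) (z i.*2.+1)); split.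
  move=> i; apply/eqM_tp.
  apply: (eqM_ord_cat (u := z i.*2) (v := z i.*2.+1) (u' := u) (v' := v)).
  apply: (eqM_reals sU si (mz i.*2.+1) sv) => [a|a|]; last exact: eqM_reals0 (mz _) su.
    by right; exists i.*2, a; rewrite ltnSn.
  by exists a.
move=> f fI [a Ha]; have [g [gI gE]] := increasing_extension fI.
pose h i := (g i./2).*2 + odd i.
have hI i j : (i < j)%N -> (h i < h j)%N.
  move=> ij; rewrite /h; case: (ltnP i./2 j./2) => [/gI|ji].
    by case: (odd i); case: (odd j) => /=; lia.
  have E : i./2 = j./2 by apply/eqP; rewrite eqn_leq ji half_leq // ltnW.
  have := odd_double_half i; have := odd_double_half j; rewrite E.
  by case: (odd i); case: (odd j) => /=; lia.
have izh := indiscernible_reindex hI iz.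
apply: (nip izh (dfn_sat phi)); exists a => l /gE[t ft].
have /sat_xor := Ha t; rewrite ft; congr (~ (sat (tcat a (z _)) _ <-> sat (tcat a (z _)) _)).
  by rewrite /h /= odd_double doubleK addn0.
by rewrite /h /= odd_double /= uphalf_double addn1.
Qed.

(** Let [e] be a common partner of [b] and all [c l]. A solution of [phi(x; b)] that agrees on every
    pair would satisfy all [phi(x; c l)], so [phi(x; b)] implies a finite disjunction of dividing
    disagreement formulas. *)
Lemma conjugates_forks (X : finType) k (phi : formula L (X + 'I_k)) (b : 'I_k -> U)
    (n : nat) (c : 'I_n -> 'I_k -> U) : (forall l, eqM b (c l)) ->
  ~ (exists x, forall l, sat (tcat x (c l)) phi) -> forks M (Pform phi b).
Proof.
move=> bc nx.
have [e He] := coheir_partner b (countableU (countable_range b) (countable_seq_set c)).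
pose par (o : option 'I_n) := ord_cat (if o is Some l then c l else b) e.
exists [set Pform (xor_formula phi) (par o) | o in [set: option 'I_n]]; split.
- by apply: finite_image; exact: finite_finset.
- move=> _ [o _ <-]; apply: coheir_pair_divides; apply: He; first by case: o.
  by case: o => [l|] _ [a _ <-]; [right; exists l, a|left; exists a].
move=> x bx; apply: contrapT => nex; apply: nx.
have E o : sat (tcat x (if o is Some l then c l else b)) phi <-> sat (tcat x e) phi.
  apply: contrapT => /sat_xor H; apply: nex.
  by exists (Pform (xor_formula phi) (par o)) => //; exists o.
by exists x => l; apply/(E (Some l))/(E None).
Qed.

Definition stable X (D : set (set (X -> U))) : Prop :=
  forall f : U -> U, automorphism f -> (forall u, sub_set M u -> f u = u) ->
  forall P, D P -> exists2 P', D P' & forall x, P' (f \o x) -> P x.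

Lemma stable_invariant (X : finType) (D : set (set (X -> U))) : stable D ->
  (forall P, meets D P -> P !=set0) ->
  exists F : set_system (X -> U), [/\ UltraFilter F, inv F & D `<=` F].
Proof.
move=> sD Dn0; have [||F [FU iF DF]] := @invariant_extension X (filter_from (meets D) id).
- exact: meets_proper.
- move=> Y R b c dR /eqM_aut[f [fA fM <-]] [P mP PR].
  have [P' mP' P'P] : exists2 P', meets D P' & forall x, P' (f \o x) -> P x.
    elim: mP => [|P1 P2 DP1 _ [P2' mP2' H2]]; first by exists setT => //; exact: MeetT.
    have [P1' DP1' H1] := sD f fA fM P1 DP1.
    by exists (P1' `&` P2'); [exact: MeetI|move=> x [/H1 ? /H2 ?]].
  exists P' => // x P'x /=; have [[g fK gK] _ _] := fA.
  have xE : x = f \o (g \o x) by apply: funext => i /=; rewrite gK.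
  rewrite xE -tcat_comp; apply: (aut_eqM fA fM dR); apply: PR; apply: P'P.
  by rewrite -xE.
- by exists F; split=> // P DP; apply: DF; exists P => //; exact: meets_in.
Qed.

Lemma meets_conjugates (X Y : Type) (R : set (X + Y -> U)) (b : Y -> U) (P : set (X -> U)) :
  meets [set P | exists2 c, eqM b c & P = [set x | R (tcat x c)]] P ->
  exists n (c : 'I_n -> Y -> U), (forall l, eqM b (c l)) /\
    forall x, (forall l, R (tcat x (c l))) -> P x.
Proof.
elim=> [|_ P2 [c0 bc0 ->] _ [n [c [bc H]]]].
  by exists 0, (fun=> b); split=> // l; exact: eqM_refl.
exists n.+1, (fun l => if unlift ord0 l is Some k then c k else c0); split.
  by move=> l; case: unliftP.
move=> x Hx; split; first by have := Hx ord0; rewrite unlift_none.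
by apply: H => l; have := Hx (lift ord0 l); rewrite liftK.
Qed.

Lemma nonforking_invariant (X : finType) k (phi : formula L (X + 'I_k)) (b : 'I_k -> U) :
  ~ forks M (Pform phi b) -> exists F : set_system (X -> U),
  [/\ UltraFilter F, inv F & F [set x | sat (tcat x b) phi]].
Proof.
move=> nf.
pose D : set (set (X -> U)) := [set P | exists2 c, eqM b c & P = [set x | sat (tcat x c) phi]].
have [||F [FU iF DF]] := @stable_invariant X D.
- move=> f fA fM _ [c bc ->]; exists [set x | sat (tcat x (f \o c)) phi].
    by exists (f \o c) => //; exact: eqM_trans bc (aut_eqM fA fM).
  move=> x /=; rewrite -tcat_comp => H; exact/(sat_automorphism fA).
- move=> P mP; have [n [c [bc H]]] := meets_conjugates (R := fun e => sat e phi) mP.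
  apply: contrapT => nP; apply: nf.
  by apply: (conjugates_forks bc) => -[x Hx]; apply: nP; exists x; exact: H.
- by exists F; split=> //; apply: DF; exists b.
Qed.

(** * Forking along elementary maps and automorphisms *)

Section Transfer.
Variables (V : structure L) (j : U -> V).
Hypothesis ej : elementary j.

Lemma eq_tp_elementary X (a b : X -> U) : eq_tp M a b -> eq_tp (j @` M) (j \o a) (j \o b).
Proof.
move=> ab; suff H (c c' : X -> U) : eq_tp M c c' -> tp (j \o c) (j @` M) `<=` tp (j \o c') (j @` M).
  by apply/seteqP; split; apply: H.
move=> cc' [k phi par] [oM sphi]; split=> //; move: sphi; rewrite /psat /= => sphi.
have /choice[m Hm] : forall i, exists u, sub_set M u /\ j u = par i.
  by move=> i; have [u Mu E] := oM i; exists u.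
have parE : par = j \o m by apply: funext => i /=; case: (Hm i).
have : tp c M (Pform phi m).
  split; first by move=> i; case: (Hm i).
  by apply/ej; rewrite tcat_comp -parE.
by rewrite cc' => -[_ /ej]; rewrite /= tcat_comp -parE.
Qed.

Lemma divides_elementary (X : finType) (phi : pform U X) :
  divides M phi -> divides (j @` M) (pf_map j phi).
Proof.
case: phi => k phi par [n [b [bE binc]]]; exists n, (fun i => j \o b i); split.
  by move=> i; exact: eq_tp_elementary.
move=> f fI [a Ha]; apply: (binc f fI).
pose r i (s : X + 'I_k) : X + U := match s with inl x => inl x | inr t => inr (b (f i) t) end.
have [|x Hx] := elementary_ex (phi := fun i => frename phi (r i)) ej.
  by exists a => i; apply/sat_rename; apply: sat_ext (Ha i) => -[].
by exists x => i; have /sat_rename := Hx i; apply: sat_ext => -[].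
Qed.

Lemma forks_elementary (X : finType) (phi : pform U X) :
  forks M phi -> forks (j @` M) (pf_map j phi).
Proof.
move=> [s [fs sd cov]]; exists [set pf_map j psi | psi in s]; split.
- exact: finite_image.
- by move=> _ [psi spsi <-]; apply: divides_elementary; exact: sd.
have /finite_seqP[l lE] : finite_set (s : set {classic pform U X}) by [].
pose r k (par : 'I_k -> U) (s : X + 'I_k) : X + U :=
  match s with inl x => inl x | inr t => inr (par t) end.
pose up (psi : pform U X) : formula L (X + U) := frename (pf_fml psi) (r _ (pf_par psi)).
have upU psi (x : X -> U) : sat (tcat x id) (up psi) <-> psat x psi.
  by rewrite /up sat_rename; split; apply: sat_ext => -[].
have upV psi (x : X -> V) : sat (tcat x j) (up psi) <-> psat x (pf_map j psi).
  by rewrite /up sat_rename; split; apply: sat_ext => -[].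
move=> a Ha; apply: contrapT => na.
pose t := in_tuple (l : seq {classic pform U X}).
pose phis (i : 'I_(size l).+1) :=
  if unlift ord0 i is Some i' then Not (up (tnth t i')) else up phi.
have [|x Hx] := elementary_ex (phi := phis) ej.
  exists a => i; rewrite /phis; case: unliftP => [i' _|_]; last by apply/upV.
  move=> /upV Hi; apply: na; exists (pf_map j (tnth t i')) => //.
  by exists (tnth t i') => //; rewrite lE; exact: mem_tnth.
have [|psi spsi Hpsi] := cov x.
  by have := Hx ord0; rewrite /phis unlift_none => /upU.
rewrite lE in spsi; have /tnthP[i psiE] : (psi : {classic pform U X}) \in t := spsi.
have := Hx (lift ord0 i); rewrite /phis liftK; apply; apply/upU.
by rewrite -psiE.
Qed.

End Transfer.

Lemma forks_eq_tp (V : structure L) (A : set V) X k (phi : formula L (X + 'I_k)) b f :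
  automorphism f -> (forall u, A u -> f u = u) ->
  forks A (Pform phi b) -> forks A (Pform phi (f \o b)).
Proof.
move=> fA fid; have [[g fK gK] _ _] := fA.
have tpf Y (c : Y -> V) : eq_tp A c (f \o c).
  have H k' (psi : formula L (Y + 'I_k')) par : (forall i, A (par i)) ->
      sat (tcat c par) psi <-> sat (tcat (f \o c) par) psi.
    move=> oA; rewrite (sat_automorphism fA) tcat_comp.
    by have -> : f \o par = par by apply: funext => i /=; rewrite fid.
  by apply/seteqP; split=> -[k' psi par] [oA sp]; split=> //; apply/(H _ psi par oA).
move=> [s [fs sd cov]]; exists [set pf_map f psi | psi in s]; split.
- exact: finite_image.
- move=> _ [[k' psi par] spsi <-]; have [n [c [cE cinc]]] := sd _ spsi.
  exists n, c; split=> // i; apply: (eq_trans (cE i)); exact: tpf.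
move=> a; rewrite /psat /= => Ha.
have aE : a = f \o (g \o a) by apply: funext => i /=; rewrite gK.
have [|[k' psi par] spsi] := cov (g \o a).
  by apply/(sat_automorphism fA); rewrite tcat_comp -aE.
rewrite /psat /= => /(sat_automorphism fA); rewrite tcat_comp -aE => Hp.
by exists (pf_map f (Pform psi par)) => //; exists (Pform psi par).
Qed.

(** Used with [c : Y -> U]: the type of [U] over [M] and [bs] has its variables indexed by [U]
    itself, while the forking formula concerns a finite tuple [c]. *)
Lemma forks_rename (V : structure L) (A : set V) X X' k (phi : formula L (X + 'I_k)) b
    (c : X -> X') :
  forks A (Pform phi b) ->
  forks A (Pform (frename phi (fun s => match s with inl x => inl (c x) | inr i => inr i end)) b).
Proof.
pose r k' (s : X + 'I_k') : X' + 'I_k' := match s with inl x => inl (c x) | inr i => inr i end.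
have E k' (psi : formula L (X + 'I_k')) par a :
    psat a (Pform (frename psi (@r k')) par) <-> psat (a \o c) (Pform psi par).
  by rewrite /psat /= sat_rename; split; apply: sat_ext => -[].
move=> [s [fs sd cov]].
exists [set Pform (frename (pf_fml psi) (@r _)) (pf_par psi) | psi in s]; split.
- exact: finite_image.
- move=> _ [[k' psi par] spsi <-]; have [n [d [dE dinc]]] := sd _ spsi.
  exists n, d; split=> // f fI [a Ha]; apply: (dinc f fI); exists (a \o c) => i.
  by have := Ha i; rewrite /= E.
move=> a /E /cov[[k' psi par] spsi Hp].
by exists (Pform (frename psi (@r _)) par); [exists (Pform psi par)|apply/E].
Qed.

Section Strict.
Variables (K' : Type) (V : structure L) (j : U -> V) (X : finType) (bs : X -> V).
Hypotheses (ej : elementary j).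

Let s0 : induced M -> U := @sval _ _.

(** The type of [bs] over [j(U)], read back in [U]. *)
Definition pulled_back : set (set (X -> U)) := [set P | exists (Y : finType) (c : Y -> U)
  (phi : formula L ((X + Y) + induced M)),
  sat (tcat (tcat bs (j \o c)) (j \o s0)) phi /\
  P = [set x | sat (tcat (tcat x c) s0) phi]].

Lemma pulled_back_ultra :
  exists r : set_system (X -> U), UltraFilter r /\ pulled_back `<=` r.
Proof.
apply: directed_ultra.
- exists setT, void, (of_void U), (Imp Bot Bot); split=> //.
  by apply/seteqP; split=> // x _ [].
- move=> _ [Y [c [phi [Hphi ->]]]].
  pose r (s : (X + Y) + induced M) : X + U := match s with
    | inl (inl x) => inl x | inl (inr y) => inr (c y) | inr m => inr (s0 m) end.
  have [|x Hx] := elementary_ex (n := 1) (phi := fun=> frename phi r) ej.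
    by exists bs => _; apply/sat_rename; apply: sat_ext Hphi => -[[]|].
  by exists x; have /sat_rename := Hx ord0; apply: sat_ext => -[[]|].
- move=> _ _ [Y [c [phi [Hphi ->]]]] [Y' [c' [phi' [Hphi' ->]]]].
  pose r (s : (X + Y) + induced M) : (X + (Y + Y')) + induced M := match s with
    | inl (inl x) => inl (inl x) | inl (inr y) => inl (inr (inl y)) | inr m => inr m end.
  pose r' (s : (X + Y') + induced M) : (X + (Y + Y')) + induced M := match s with
    | inl (inl x) => inl (inl x) | inl (inr y) => inl (inr (inr y)) | inr m => inr m end.
  pose psi := Not (Imp (frename phi r) (Not (frename phi' r'))).
  have E (S : structure L) (x : X -> S) d d' e : sat (tcat (tcat x (tcat d d')) e) psi <->
      sat (tcat (tcat x d) e) phi /\ sat (tcat (tcat x d') e) phi'.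
    rewrite /= !sat_rename.
    have -> : tcat (tcat x (tcat d d')) e \o r = tcat (tcat x d) e by apply: funext => -[[]|].
    have -> : tcat (tcat x (tcat d d')) e \o r' = tcat (tcat x d') e by apply: funext => -[[]|].
    split=> [H|[? ?]]; last by apply.
    by split; apply: contrapT => ?; apply: H.
  exists [set x | sat (tcat (tcat x (tcat c c')) s0) psi]; last by move=> x /E.
  by exists (Y + Y')%type, (tcat c c'), psi; split=> //; rewrite tcat_comp; apply/E.
Qed.

Lemma pulled_backP (r : set_system (X -> U)) (Y : finType) (c : Y -> U) phi :
  UltraFilter r -> pulled_back `<=` r ->
  r [set x | sat (tcat (tcat x c) s0) phi] <-> sat (tcat (tcat bs (j \o c)) (j \o s0)) phi.
Proof.
move=> rU pr; split=> [rphi|Hphi]; last by apply: pr; exists Y, c, phi.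
apply: contrapT => nphi.
have /(filterI rphi)/filter_ex[x [? []//]] : r [set x | sat (tcat (tcat x c) s0) (Not phi)].
by apply: pr; exists Y, c, (Not phi).
Qed.

(** Under NIP, global non-forking types are invariant: if [R] separated the conjugates [u] and [v],
    it would separate one of them from their common partner [e], and that disagreement divides over
    [M]. *)
Lemma pulled_back_invariant (r : set_system (X -> U)) :
  UltraFilter r -> pulled_back `<=` r ->
  nonforking (j @` M) (tp bs (range j)) -> inv r.
Proof.
move=> rU pr nf Y R u v [phi HR] uv Ru; apply: contrapT => nRv.
have [m0 Mm0] := sub_nonempty M.
have RE c : r [set x | R (tcat x c)] <-> sat (tcat (tcat bs (j \o c)) (j \o s0)) phi.
  rewrite -(pulled_backP _ _ rU pr); split; by apply: filterS => x /HR.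
have [k [psi [g gE]]] := parametric_formula (exist _ m0 Mm0 : induced M) phi.
pose hat (c : Y -> U) : 'I_k -> U := tcat c s0 \o g.
have {}RE c : r [set x | R (tcat x c)] <-> sat (tcat bs (j \o hat c)) psi.
  by rewrite RE gE /hat -tcat_comp.
have uvh : eqM (hat u) (hat v).
  apply: eqM_sub; apply: (eqM_subE (f := fun s => match s with inl y => inr y | inr m => inl m end)
    (a := tcat s0 u) (b := tcat s0 v)); [by case|by case|].
  by apply: eqM_catM => // m; exact: (svalP m).
have [e He] := coheir_partner (hat u)
  (countableU (countable_range (hat u)) (countable_range (hat v))).
have nochange c : eqM (hat u) (hat c) -> range (hat c) `<=` range (hat u) `|` range (hat v) ->
    sat (tcat bs (j \o hat c)) psi <-> sat (tcat bs (j \o e)) psi.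
  move=> uc cA; apply: contrapT => H.
  pose chi := Pform (xor_formula psi) (ord_cat (hat c) e).
  apply: (nf (pf_map j chi)).
    split; first by move=> i; exists (pf_par chi i).
    rewrite /psat /=; move/sat_xor: H; apply: sat_ext => -[x|i] //=.
    by rewrite /ord_cat; case: (fintype.split i).
  have /(divides_elementary ej) dchi := coheir_pair_divides psi (He _ uc cA).
  exists [set pf_map j chi]; split; [exact: finite_set1|by move=> _ ->|].
  by move=> a Ha; exists (pf_map j chi).
apply/nRv/RE/(nochange v uvh (@subsetUr _ _ _)).
exact/(nochange u (@eqM_refl _ _) (@subsetUl _ _ _))/RE.
Qed.

End Strict.

Lemma small_sub (K' T : Type) (A B : set T) : B `<=` A -> small K' A -> small K' B.
Proof.
move=> /subset_card_le BA [AK nKA]; split; first exact: card_le_trans BA AK.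
by move=> KB; apply: nKA; exact: card_le_trans KB BA.
Qed.

(** If no invariant type contained the type of [c] over [m], one of its formulas would fork over [M]
    by [conjugates_forks]. Carried to [V] by [j] and then to [bs] by an automorphism, it would
    belong to the type of [U] over [M] and [bs], which does not fork. *)
Lemma strictly_nonforking_types (X : finType) (C : set U) (b : X -> U) :
  sub_set M `<=` C -> strictly_nonforking M C b ->
  exists r : set_system (X -> U), [/\ UltraFilter r, inv r, reals r C b &
    forall (Y : finType) (c : Y -> U) (m : X -> U), reals r (range c) m ->
    exists S : set_system (Y -> U), [/\ UltraFilter S, inv S & reals S (range m) c]].
Proof.
move=> MC [K' [V [j [bs [[mV ej sj] [bC nf1 nf2]]]]]].
have [r [rU pr]] := pulled_back_ultra bs ej.
pose s0 : induced M -> U := @sval _ _.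
have rP (Y : finType) (c : Y -> U) phi := pulled_backP (Y := Y) c phi rU pr.
exists r; split=> //; first exact: (pulled_back_invariant ej rU pr nf1).
  move=> Y R c [phi HR] cC rR; apply: contrapT => nR.
  have [m0 Mm0] := sub_nonempty M.
  have [k [psi [g gE]]] := parametric_formula (exist _ m0 Mm0 : induced M) phi.
  have : tp b C (Pform (Not psi) (tcat c s0 \o g)).
    split; last by rewrite /psat /= -gE -HR.
    by move=> i; rewrite /=; case: (g i) => [y|n]; [exact: cC|apply: MC; exact: (svalP n)].
  move=> /bC; rewrite /psat /=; apply.
  suff : sat (tcat bs (tcat (j \o c) (j \o s0) \o g)) psi.
    by apply: sat_ext => -[x|i] //=; case: (g i).
  by apply/gE/rP; apply: filterS rR => x; exact: (proj1 (HR _)).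
move=> Y c m rm.
pose D : set (set (Y -> U)) := [set P | exists R m', [/\ dfn R, R (tcat c m), eqM m m' &
  P = [set y | R (tcat y m')]]].
have [||S [SU iS DS]] := @stable_invariant Y D.
- move=> f fA fM _ [R [m' [dR Rcm mm' ->]]]; exists [set y | R (tcat y (f \o m'))].
    by exists R, (f \o m'); split=> //; exact: eqM_trans mm' (aut_eqM fA fM).
  by move=> y /=; rewrite -tcat_comp; apply: (eqM_sym (aut_eqM fA fM) dR).
- move=> P mP; apply: contrapT => P0.
  have [R [n [m' [dR Rcm mm' RP]]]] : exists (R : set (Y + X -> U)) n (m' : 'I_n -> X -> U),
      [/\ dfn R, R (tcat c m), forall l, eqM m (m' l) &
        forall y, (forall l, R (tcat y (m' l))) -> P y].
    elim: mP {P0} => [|_ P2 [R0 [m0 [dR0 R0cm mm0 ->]]] _ [R [n [m' [dR Rcm mm' RP]]]]].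
      exists (fun=> ~ False), 0, (fun=> m); split=> // [|l]; last exact: eqM_refl.
      exact/dfn_not/dfn_false.
    exists (fun e => R0 e /\ R e), n.+1, (fun l => if unlift ord0 l is Some k then m' k else m0).
    split=> //; first exact: dfn_and.
      by move=> l; case: unliftP.
    move=> y Hy; split; first by have [] := Hy ord0; rewrite unlift_none.
    by apply: RP => l; have [] := Hy (lift ord0 l); rewrite liftK.
  have [phi HR] := dR; have [m0 Mm0] := sub_nonempty M.
  have [k [psi [g gE]]] := parametric_formula (exist _ m0 Mm0 : induced M) phi.
  have mh l : eqM (tcat m s0 \o g) (tcat (m' l) s0 \o g).
    apply: eqM_sub; apply: (eqM_subE (f := fun s => match s with inl y => inr y | inr m => inl m end)
      (a := tcat s0 m) (b := tcat s0 (m' l))); [by case|by case|].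
    by apply: eqM_catM => // u; exact: (svalP u).
  have fk : forks M (Pform psi (tcat m s0 \o g)).
    apply: (conjugates_forks mh) => -[y Hy]; apply: P0; exists y; apply: RP => l.
    by apply/HR/gE; exact: Hy.
  have [_ _ _ hom] := mV.
  have sr : small K' (range (tcat (j \o s0) (j \o m))).
    by apply: small_sub sj => _ [[a|a] _ <-]; eexists.
  (* As [m] realizes [r], the tuples [j \o m] and [bs] have the same type over [j(M)]; homogeneity
     of [V] moves one to the other. *)
  have [|f fA fE] := hom _ _ (tcat (j \o s0) bs) sr.
    have E k' (chi : formula L ((induced M + X) + 'I_k')) (p : 'I_k' -> V) :
        (forall i, set0 (p i)) -> sat (tcat (tcat (j \o s0) (j \o m)) p) chi <->
        sat (tcat (tcat (j \o s0) bs) p) chi.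
      move=> p0.
      pose h (s : (induced M + X) + 'I_k') : (X + void) + induced M := match s with
        | inl (inl u) => inr u | inl (inr x) => inl (inl x)
        | inr i => False_rect _ (p0 i) end.
      have hE x : tcat (tcat (j \o s0) x) p = tcat (tcat x (j \o of_void U)) (j \o s0) \o h.
        by apply: funext => -[[u|x']|i] //=; case: (p0 i).
      have dchi : dfn (fun e => sat (tcat e s0) (frename chi h)) by exists (frename chi h).
      rewrite !hE -!sat_rename -(rP void (of_void U)).
      have -> := realsP rU rm dchi (c := of_void U) _; last by case.
      by rewrite (ej _ (frename chi h)) !tcat_comp.
    by apply/seteqP; split=> -[k' chi p] [o0 H]; split=> //; apply/(E k' chi p).
  have fM u : (j @` M) u -> f u = u.
    by move=> [u' Mu' <-]; have := congr1 (@^~ (inl (exist _ u' Mu'))) fE.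
  have fh : f \o (j \o (tcat m s0 \o g)) = tcat bs (j \o s0) \o g.
    apply: funext => i /=; case: (g i) => [x|u] /=.
      by have := congr1 (@^~ (inr x)) fE.
    by have := congr1 (@^~ (inl u)) fE.
  have := forks_rename c (forks_eq_tp fA fM (forks_elementary ej fk)); rewrite fh.
  apply: nf2; split.
    move=> i /=; case: (g i) => [x|u] /=; first by right; exists x.
    by left; exists (s0 u) => //; exact: (svalP u).
  rewrite /psat /= sat_rename.
  pose h (s : (Y + X) + induced M) : (X + Y) + induced M := match s with
    | inl (inl y) => inl (inr y) | inl (inr x) => inl (inl x) | inr u => inr u end.
  have dswap : dfn (fun e => sat (tcat e s0) (frename phi h)) by exists (frename phi h).
  have : r [set x | sat (tcat (tcat x c) s0) (frename phi h)].
    apply/(realsP rU rm dswap); first by move=> y; exists y.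
    by apply/sat_rename; move/HR: Rcm; apply: sat_ext => -[[]|].
  move=> /rP/sat_rename H.
  suff : sat (tcat (j \o c) (tcat bs (j \o s0) \o g)) psi by apply: sat_ext => -[].
  by apply/gE; apply: sat_ext H => -[[]|].
exists S; split=> // Z R e dR em SR; apply: contrapT => nR.
have /choice[h hE] : forall z, exists x, e z = m x.
  by move=> z; have [x _ <-] := em z; exists x.
have {}hE : e = m \o h by apply: funext.
have dR' : dfn (fun a : Y + X -> U => ~ R (tcat (a \o inl) (a \o inr \o h))).
  apply: dfn_not.
  apply: (dfn_sub (f := fun s => match s with inl y => inl y | inr z => inr (h z) end)) dR.
  by move=> a [].
have nSR : S [set y | ~ R (tcat y e)].
  apply: DS; exists (fun a : Y + X -> U => ~ R (tcat (a \o inl) (a \o inr \o h))), m.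
  by split=> //; rewrite hE in nR *.
by have [y []] := filter_ex (filterI SR nSR).
Qed.

(** * Strict Morley sequences *)

(** [None] in [option X'] is the variable to be solved for, the one added by the inductive step. *)
Definition solvable (X' Y : Type) (R : set (option X' + Y -> U)) n
    (e : X' + 'I_n * Y -> U) : Prop :=
  exists x, forall k : 'I_n, R (tcat (extend (e \o inl) x) (fun y => e (inr (k, y)))).

Lemma dfn_solvable (X' Y : Type) (R : set (option X' + Y -> U)) n :
  dfn R -> dfn (solvable R (n := n)).
Proof.
move=> dR; pose q (k : 'I_n) (t : option X' + Y) : unit + (X' + 'I_n * Y) := match t with
  | inl (Some x) => inr (inl x) | inl None => inl tt | inr y => inr (inr (k, y)) end.
have dq : dfn (fun e : unit + (X' + 'I_n * Y) -> U => forall k, R (e \o q k)).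
  by apply: dfn_all_fin => k; apply: (dfn_sub (f := q k)) dR.
have E (x : unit -> U) k (e : X' + 'I_n * Y -> U) : tcat x e \o q k =
    tcat (extend (e \o inl) (x tt)) (fun y => e (inr (k, y))).
  by apply: funext => -[[]|].
apply: (dfn_ext _ (dfn_ex dq)) => e; split=> -[x Hx].
  by exists (x tt) => k; rewrite -E.
by exists (fun=> x) => k; rewrite E.
Qed.

Section StrictMorley.
Variables (l : nat) (m : 'I_l -> U) (s : nat -> 'I_l -> U).
Hypothesis ms : strict_morley M m s.

Lemma strict_morley_eqM i : eqM m (s i).
Proof.
have [_ ms1 _] := ms; apply/eqM_tp; apply/seteqP; split=> phi [oM sphi].
  by split=> //; apply: ms1.
split=> //; apply: contrapT => nphi.
have nm : tp m M (pf_not phi) by split.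
exact: (ms1 i _ nm sphi).
Qed.

(* Strictness makes [r] conjugates of [m] appear in every row, in such a way that
   all the sequences picking one entry in each row look like [s]. *)
Lemma strict_rows (r N : nat) (m' : 'I_r -> 'I_l -> U) : (forall k, eqM m (m' k)) ->
  exists E : nat -> 'I_r -> 'I_l -> U,
    (forall i, (i < N)%N -> eqM (fun z : 'I_r * 'I_l => m' z.1 z.2) (fun z => E i z.1 z.2)) /\
    forall f : nat -> 'I_r, eqM (fun z : 'I_N * 'I_l => s z.1 z.2)
      (fun z : 'I_N * 'I_l => E z.1 (f z.1) z.2).
Proof.
have [_ _ ms2] := ms => mm'.
elim: N => [|N [E [rowE pathE]]].
  exists (fun _ => m'); split=> // f; apply: (eqM_subE (f := fun z : 'I_0 * 'I_l => match z.1 with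
    Ordinal _ h => False_rect void (notF h) end) (a := of_void U) (b := of_void U)) => //.
    by move=> [[]].
  by move=> [[]].
have [|q [qU qi qs qc]] := strictly_nonforking_types _ (ms2 N); first by move=> u; left.
(* The new row is [m'] itself. The earlier rows [c] are moved to [c'], which realizes over all of
   [m'] the invariant type [S] of [c] over [m1]; each entry of the new row is then to [c'] what [m1]
   is to [c]. *)
pose c (z : 'I_N * ('I_r * 'I_l)) := E z.1 z.2.1 z.2.2.
have [m1 qm1] := reals_ex (X := 'I_l) (F := q) _ (countable_range c).
have [S [SU Si Sc]] := qc _ c m1 qm1.
have [c' Sc'] := reals_ex (X := ('I_N * ('I_r * 'I_l))%type) (F := S) _
  (countable_range (fun z : 'I_r * 'I_l => m' z.1 z.2)).
have cc' : eqM c c' := eqM_reals0 SU Si Sc Sc'.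
pose E' (i : nat) (k : 'I_r) (x : 'I_l) : U :=
  if insub i is Some i' then c' (i', (k, x)) else m' k x.
exists E'; split.
  move=> i; rewrite ltnS leq_eqVlt => /orP[/eqP ->|iN].
    by rewrite /E' insubF ?ltnn.
  apply: eqM_trans (rowE i iN) _.
  apply: (eqM_subE (f := fun z => (Ordinal iN, z)) _ _ cc') => z //.
  rewrite /E' insubT /=; case: z => a b /=.
  by congr c'; congr (_, _); exact: val_inj.
move=> f; pose h (z : 'I_N.+1 * 'I_l) : 'I_l + 'I_N * 'I_l :=
  if unlift ord_max z.1 is Some i then inr (i, z.2) else inl z.2.
pose path (i : 'I_N * 'I_l) := c (i.1, (f i.1, i.2)).
pose path' (i : 'I_N * 'I_l) := c' (i.1, (f i.1, i.2)).
have H1 : eqM (tcat (s N) (fun z : 'I_N * 'I_l => s z.1 z.2)) (tcat m1 path).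
  apply: (eqM_reals qU qi qs qm1) => [[i x]|[i x]|]; last exact: pathE.
    by right; exists i, x; rewrite ltn_ord.
  by exists (i, (f i, x)).
have H2 : eqM (tcat c m1) (tcat c' (m' (f N))).
  apply: (eqM_reals SU Si Sc Sc') => [x|x|]; first by exists x.
    by exists (f N, x).
  apply: eqM_trans _ (mm' _); apply: eqM_trans _ (eqM_sym (strict_morley_eqM N)).
  exact: eqM_reals0 qU qi qm1 qs.
have H3 : eqM (tcat m1 path) (tcat (m' (f N)) path').
  pose g (t : 'I_l + 'I_N * 'I_l) : 'I_N * ('I_r * 'I_l) + 'I_l := match t with
    | inl x => inr x | inr i => inl (i.1, (f i.1, i.2)) end.
  by apply: (eqM_subE (f := g) _ _ H2) => -[].
apply: (eqM_subE (f := h) _ _ (eqM_trans H1 H3)) => -[i x] /=.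
  by rewrite /h /=; case: unliftP => [i' ->|->]; rewrite ?lift_max.
rewrite /h /=; case: unliftP => [i' ->|->]; last by rewrite /= /E' insubF ?ltnn.
rewrite lift_max /E' insubT //= => iN; rewrite /path' /=.
by congr c'; congr (_, _); exact: val_inj.
Qed.

Variables (X' : finType) (p : set_system (X' -> U)) (R : set (option X' + 'I_l -> U)).
Hypotheses (pU : UltraFilter p) (pi : inv p) (dR : dfn R).

Hypothesis p01 : p [set x' | exists x, forall k : 'I_2, R (tcat (extend x' x) (s k))].

(** Otherwise a solution [x] along a cyclic path through rows of conjugates of [m] fails somewhere
    in every row. Two rows failing at the same entry give a constant path on which [R] alternates
    twice, too often for one variable. *)
Lemma strict_consistent n (m' : 'I_n -> 'I_l -> U) : (forall k, eqM m (m' k)) ->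
  p [set x' | exists x, forall k, R (tcat (extend x' x) (m' k))].
Proof.
case: n m' => [|r] m' mm'.
  have [u0 _] := sub_nonempty M.
  by apply: filterE => x'; exists u0 => -[].
have [is_ _ _] := ms.
pose r1 (t : option X' + 'I_l) : unit + (X' + 'I_l) := match t with
  | inl (Some x) => inr (inl x) | inl None => inl tt | inr i => inr (inr i) end.
pose R1 (e : unit + (X' + 'I_l) -> U) := R (e \o r1).
have dR1 : dfn R1 by apply: (dfn_sub (f := r1)) dR.
have R1E x' (x : unit -> U) y : R1 (tcat x (tcat x' y)) <-> R (tcat (extend x' (x tt)) y).
  rewrite /R1 (_ : _ \o r1 = tcat (extend x' (x tt)) y) //.
  by apply: funext => -[[]|].
have [a0 pa0] := reals_ex (X := X') (F := p) _ (countable_seq_set s).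
pose z i := tcat a0 (s i).
have zE N (g : 'I_N -> nat) (y : nat -> 'I_l -> U) a : reals p (seq_set y) a ->
    eqM (fun w : 'I_N * 'I_l => s (g w.1) w.2) (fun w : 'I_N * 'I_l => y w.1 w.2) ->
    eqM (fun w : 'I_N * (X' + 'I_l) => z (g w.1) w.2)
        (fun w : 'I_N * (X' + 'I_l) => tcat a (y w.1) w.2).
  move=> pa E.
  have H : eqM (tcat a0 (fun w : 'I_N * 'I_l => s (g w.1) w.2))
      (tcat a (fun w : 'I_N * 'I_l => y w.1 w.2)).
    apply: (eqM_reals pU pi pa0 pa) => // -[i x].
      by exists (g i), x.
    by exists (i : nat), x.
  pose h (w : 'I_N * (X' + 'I_l)) : X' + 'I_N * 'I_l :=
    match w.2 with inl x => inl x | inr x => inr (w.1, x) end.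
  by apply: (eqM_subE (f := h) _ _ H) => -[i [x|x]].
have iz : indiscernible (fun i j => (i < j)%N) M z.
  move=> N i j ii ij; apply/eqM_tp.
  have sE (g : 'I_N -> nat) : increasing (fun i j => (i < j)%N) g ->
      eqM (fun w : 'I_N * 'I_l => s (g w.1) w.2) (fun w : 'I_N * 'I_l => s w.1 w.2).
    by move=> ig; apply/eqM_tp; exact: (is_ N g val ig (fun a b => id)).
  exact: eqM_trans (zE N i s a0 pa0 (sE _ ii)) (eqM_sym (zE N j s a0 pa0 (sE _ ij))).
have cons N : exists x : unit -> U, forall i, (i < N)%N -> R1 (tcat x (z i)).
  (* For the single variable [x] the bound is [2 ^ 1], so a common solution at [s 0] and [s 1]
     suffices. *)
  apply: (indiscernible_consistent iz dR1).
  have [|x Hx] := proj1 (realsP pU pa0 (@dfn_solvable _ _ _ 2 dR)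
      (c := fun w : 'I_2 * 'I_l => s w.1 w.2) _) p01.
    by move=> w; exists (w.1 : nat), w.2.
  exists (fun=> x) => i; rewrite card_unit => i2; apply/R1E.
  exact: (Hx (Ordinal i2)).
(* There are [r.+2] blocks of [r.+1] rows: in the first rows of two blocks, [x] fails at the same
   entry, and the cyclic path visits every entry within a block. *)
pose N := (r.+1 * r.+2)%N.
have [E [rowE pathE]] := strict_rows N mm'.
apply: contrapT => /(ultra_not pU) pn.
have [a pa] := reals_ex (X := X') (F := p) _
  (countable_seq_set (fun (w : nat * 'I_r.+1) x => E w.1 w.2 x)).
have pa' f : reals p (seq_set (fun i => E i (f i))) a.
  by apply: reals_mono pa => u [i [x ->]]; exists (i, f i), x.
have transfer (f : nat -> 'I_r.+1) (x x0 : unit -> U) i : (i < N)%N ->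
    eqM (tcat (fun w : 'I_N * (X' + 'I_l) => z w.1 w.2) x0)
        (tcat (fun w : 'I_N * (X' + 'I_l) => tcat a (E w.1 (f w.1)) w.2) x) ->
    R1 (tcat x0 (z i)) <-> R (tcat (extend a (x tt)) (E i (f i))).
  move=> iN Hx; rewrite -R1E.
  pose q (t : unit + (X' + 'I_l)) : 'I_N * (X' + 'I_l) + unit :=
    match t with inl u => inr u | inr y => inl (Ordinal iN, y) end.
  have dq : dfn (fun e => R1 (e \o q)) by apply: (dfn_sub (f := q)) dR1.
  have E1 (y : nat -> X' + 'I_l -> U) (x1 : unit -> U) :
      tcat (fun w : 'I_N * (X' + 'I_l) => y w.1 w.2) x1 \o q = tcat x1 (y i).
    by apply: funext => -[].
  rewrite -(E1 z) -(E1 (fun i => tcat a (E i (f i)))).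
  by split; [exact: Hx _ dq|exact: (eqM_sym Hx dq)].
pose zN f := zE N val _ a (pa' f) (pathE f).
have [x Hx] : exists x, forall i, (i < N)%N ->
    R (tcat (extend a x) (E i (inord (i %% r.+1)))).
  pose f i : 'I_r.+1 := inord (i %% r.+1).
  have [x0 Hx0] := cons N; have [x Hx] := eqM_extend x0 (zN f).
  by exists (x tt) => i iN; apply: (proj1 (transfer f x x0 i iN Hx)); exact: Hx0.
have {}pn i : (i < N)%N -> exists k, ~ R (tcat (extend a x) (E i k)).
  move=> iN; apply: contrapT => nk.
  have sol : solvable R (tcat a (fun w : 'I_r.+1 * 'I_l => E i w.1 w.2)).
    by exists x => k; apply: contrapT => nR; apply: nk; exists k.
  have : ~ solvable R (tcat a (fun w : 'I_r.+1 * 'I_l => E i w.1 w.2)).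
    apply/(inv_realsM pU pi pa (dfn_not (@dfn_solvable _ _ _ r.+1 dR)) _ (rowE i iN)) => //.
    by move=> w; exists (i, w.1), w.2.
  exact.
have /choice[j jP] : forall t : 'I_r.+2, exists k, ~ R (tcat (extend a x) (E (t * r.+1)%N k)).
  by move=> t; apply: pn; rewrite /N mulnC ltn_pmul2l.
have [t1 [t2 [t12 jt]]] : exists t1 t2 : 'I_r.+2, (t1 < t2)%N /\ j t1 = j t2.
  apply: contrapT => nt; have : injective j.
    move=> t1 t2 jt; apply: val_inj; apply: contrapT => ne; apply: nt.
    case: (ltngtP t1 t2) => h; [by exists t1, t2|by exists t2, t1|by case: ne].
  by move=> /leq_card; rewrite !card_ord ltnn.
have xk (t : 'I_r.+2) : (t * r.+1 + j t < N)%N /\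
    R (tcat (extend a x) (E (t * r.+1 + j t)%N (j t))).
  have tN : (t * r.+1 + j t < N)%N.
    rewrite /N; have := ltn_ord t; have := ltn_ord (j t); rewrite ltnS => H1 H2.
    apply: (@leq_trans (t.+1 * r.+1)); last by rewrite mulnC leq_mul2l.
    by rewrite mulSn addnC ltn_add2r.
  split=> //; have := Hx _ tN.
  by rewrite modnMDl modn_small // inord_val.
(* In the first row of a block the cyclic path takes entry 0, where [R] holds. *)
have k0 t : (0 < j t)%N.
  rewrite lt0n; apply/eqP => j0; have [_] := xk t; rewrite {1}j0 addn0; exact: jP.
have [x0 Hx0] := eqM_extend (fun _ : unit => x) (eqM_sym (zN (fun=> j t1))).
(* Four rows on the constant path: [R] fails at the first and third and holds at the second and
   fourth. Later values just keep [g] increasing. *)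
pose g i := match i with 0 => (t1 * r.+1)%N | 1 => (t1 * r.+1 + j t1)%N
  | 2 => (t2 * r.+1)%N | i.+3 => (t2 * r.+1 + j t2 + i)%N end.
have g12 : (t1 * r.+1 + j t1 < t2 * r.+1)%N.
  apply: (@leq_trans (t1.+1 * r.+1)); last by rewrite leq_mul2r t12 orbT.
  by rewrite mulSn addnC ltn_add2r.
have gI i i' : (i < i')%N -> (g i < g i')%N.
  have := k0 t1; have := k0 t2.
  case: i => [|[|[|i]]]; case: i' => [|[|[|i']]] //=; lia.
apply: (nip (indiscernible_reindex gI iz) dR1); exists x0.
have flip t : j t = j t1 ->
    ~ (R1 (tcat x0 (z (t * r.+1)%N)) <-> R1 (tcat x0 (z (t * r.+1 + j t)%N))).
  move=> jE; have [tN Rt] := xk t.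
  rewrite (transfer (fun=> j t1) (fun=> x) x0 _ tN); last exact: eqM_sym.
  rewrite (transfer (fun=> j t1) (fun=> x) x0 (t * r.+1)%N); last exact: eqM_sym.
    by rewrite -jE => -[_ /(_ Rt)]; exact: jP.
  by apply: leq_ltn_trans tN; rewrite leq_addr.
rewrite card_unit => -[|[|[]]] // _; first exact: flip.
by rewrite /= addn0; exact: flip.
Qed.

Definition extends_type (p : set_system (X' -> U)) (F : set_system (option X' -> U)) : Prop :=
  forall (Y : finType) (S : set (X' + Y -> U)) (c : Y -> U), dfn S ->
  p [set x : X' -> U | S (tcat x c)] -> F [set x : option X' -> U | S (tcat (x \o Some) c)].

(** [p] together with all conjugates of [R(x; m)] is a stable family, finitely consistent by
    [strict_consistent]. *)
Lemma strict_extension : exists F : set_system (option X' -> U),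
  [/\ UltraFilter F, inv F, extends_type p F & F [set x | R (tcat x m)]].
Proof.
pose D : set (set (option X' -> U)) :=
  [set P | exists (Y : finType) (S : set (X' + Y -> U)) (c : Y -> U),
    [/\ dfn S, p [set x : X' -> U | S (tcat x c)] &
        P = [set x : option X' -> U | S (tcat (x \o Some) c)]]] `|`
  [set P | exists2 m', eqM m m' & P = [set x | R (tcat x m')]].
have [||F [FU iF DF]] := @stable_invariant (option X') D.
- move=> f fA fM _ [[Y [S [c [dS pS ->]]]]|[m' mm' ->]].
    exists [set x : option X' -> U | S (tcat (x \o Some) (f \o c))].
      by left; exists Y, S, (f \o c); split=> //; exact: pi dS (aut_eqM fA fM) pS.
    move=> x /= H; apply: (eqM_sym (aut_eqM fA fM) dS).
    by rewrite tcat_comp.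
  exists [set x | R (tcat x (f \o m'))].
    by right; exists (f \o m') => //; exact: eqM_trans mm' (aut_eqM fA fM).
  by move=> x /=; rewrite -tcat_comp; apply: (eqM_sym (aut_eqM fA fM) dR).
- move=> P mP.
  suff [Q [n [m' [pQ mm' QP]]]] : exists (Q : set (X' -> U)) n (m' : 'I_n -> 'I_l -> U),
      [/\ p Q, forall k, eqM m (m' k) & forall x, Q (x \o Some) ->
        (forall k, R (tcat x (m' k))) -> P x].
    have [x' [Qx' [x Hx]]] := filter_ex (filterI pQ (strict_consistent mm')).
    by exists (extend x' x); apply: QP.
  elim: mP => [|P1 P2 [[Y [S [c [dS pS ->]]]]|[m0 mm0 ->]] _ [Q [n [m' [pQ mm' QP]]]]].
  + exists setT, 0, (fun=> m); split=> //; first exact: filterT.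
    by move=> k; exact: eqM_refl.
  + exists ([set x | S (tcat x c)] `&` Q), n, m'; split=> //; first exact: filterI.
    by move=> x [? ?] ?; split=> //; exact: QP.
  + exists Q, n.+1, (fun k => if unlift ord0 k is Some k' then m' k' else m0); split=> //.
      by move=> k; case: unliftP.
    move=> x Qx Hx; split; first by have := Hx ord0; rewrite unlift_none.
    by apply: QP => // k; have := Hx (lift ord0 k); rewrite liftK.
exists F; split=> //.
  by move=> Y S c dS pS; apply: DF; left; exists Y, S, c.
by apply: DF; right; exists m => //; exact: eqM_refl.
Qed.

End StrictMorley.

(** * Commuting with the coheirs *)

Section Commuting.
Variables (M1 : set U) (k : nat) (d : 'I_k -> U).
Hypotheses (MM1 : sub_set M `<=` M1) (countM1 : countable M1).
Hypothesis copies : forall (l : nat) (m : 'I_l -> U), tuple_in M1 m ->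
  exists2 d' : 'I_k -> U, tuple_in M1 d' & eqM (tcat m d') (tcat m d).

Lemma copies_fin (Y : finType) (m : Y -> U) : tuple_in M1 m ->
  exists2 d' : 'I_k -> U, tuple_in M1 d' & eqM (tcat m d') (tcat m d).
Proof.
move=> mM; have [|d' d'M E] := @copies _ (m \o @enum_val _ Y).
  by move=> i; exact: mM.
exists d' => //.
pose f (t : Y + 'I_k) : 'I_#|Y| + 'I_k :=
  match t with inl y => inl (enum_rank y) | inr i => inr i end.
by apply: (eqM_subE (f := f) _ _ E) => -[y|i] //=; rewrite enum_rankK.
Qed.

Definition coheir1 (F : set_system ('I_k -> U)) : Prop :=
  [/\ UltraFilter F, F [set y | tuple_in M y] & reals F M1 d].

(** [y'] depends on [m] and [n] alone: each term is a copy in [M1], over [m] and the earlier terms,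
    of [d], which realizes all the coheirs in question over [M1]. Hence all such Morley sequences
    look alike, whichever coheir is used at each index. *)
Lemma coheir1_copies (Y : finType) (m : Y -> U) n : tuple_in M1 m ->
  exists y' : nat -> 'I_k -> U, (forall i, tuple_in M1 (y' i)) /\
    forall F B y (i : 'I_n -> nat), (forall i, coheir1 (F i)) ->
      morley (fun i j => (i < j)%N) F B y ->
      increasing (fun i j => (i < j)%N) i -> tuple_in B m ->
      eqM (tcat m (fun z : 'I_n * 'I_k => y (i z.1) z.2))
          (tcat m (fun z : 'I_n * 'I_k => y' z.1 z.2)).
Proof.
move=> mM; elim: n => [|n [y' [y'M IH]]].
  have [u Mu] := sub_nonempty M.
  exists (fun _ _ => u); split=> [i x|F B y i _ _ _ _]; first exact: MM1.
  apply: (eqM_subE (f := fun s : Y + 'I_0 * 'I_k => match s with inl c => c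
     | inr z => False_rect _ (notF (valP z.1)) end) (a := m) (b := m)) => //.
    by move=> [//|[[]]].
  by move=> [//|[[]]].
have [|d' d'M E] := @copies_fin _ (tcat m (fun z : 'I_n * 'I_k => y' z.1 z.2)).
  by move=> [c|z]; [exact: mM|exact: y'M].
pose y1 i := if (i < n)%N then y' i else d'.
exists y1; split=> [i x|F B y i Fc My ii mB].
  by rewrite /y1; case: ifP => _; [exact: y'M|exact: d'M].
apply: (eqM_snoc (y := y) (y' := y1) (i := i) (i' := val)).
have lt_max (t : 'I_n) : (lift ord_max t < @ord_max n)%N by rewrite lift_max ltn_ord.
have [FU Fm Fd] := Fc (i ord_max).
apply: (@eqM_trans _ _ (tcat d (tcat m (fun z : 'I_n * 'I_k => y' z.1 z.2)))).
  apply: (eqM_reals FU (coheir_inv FU Fm) (My _) Fd).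
  - move=> [c|[t x]]; first by left; exact: mB.
    by right; exists (i (lift ord_max t)), x; split=> //; exact: (ii _ _ (lt_max t)).
  - by move=> [c|z]; [exact: mM|exact: y'M].
  - apply: (IH F B y (fun t => i (lift ord_max t))) => // t u tu; apply: ii.
    by rewrite !lift_max.
pose f (t : 'I_k + (Y + 'I_n * 'I_k)) : (Y + 'I_n * 'I_k) + 'I_k :=
  match t with inl x => inr x | inr z => inl z end.
apply: (eqM_subE (f := f) _ _ (eqM_sym E)); first by move=> [].
move=> [x|[c|[t x]]] //=; rewrite /y1 ?ltnn //.
have -> : bump n t = t by rewrite /bump leqNgt ltn_ord.
by rewrite ltn_ord.
Qed.

Lemma coheir1_unique (Q Q' : set_system ('I_k -> U)) (Y : finType)
    (R : set ('I_k + Y -> U)) (u : Y -> U) : coheir1 Q -> coheir1 Q' -> dfn R ->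
  Q [set y | R (tcat y u)] -> Q' [set y | R (tcat y u)].
Proof.
move=> Qc Qc' dR QR; have [QU _ _] := Qc; have [QU' _ _] := Qc'.
apply: contrapT => /(ultra_not QU') Q'R.
pose F i := if odd i then Q' else Q.
have Fc i : coheir1 (F i) by rewrite /F; case: odd.
have [z Mz] := @morley_nat _ F (range u) (fun i => let: And3 a _ _ := Fc i in a)
  (countable_range u).
have iz : indiscernible (fun i j => (i < j)%N) M z.
  move=> n i j ii ij; apply/eqM_tp.
  have [|y' [_ y'E]] := @coheir1_copies void (of_void U) n; first by case.
  have E (h : 'I_n -> nat) : increasing (fun i j => (i < j)%N) h ->
      eqM (fun w : 'I_n * 'I_k => z (h w.1) w.2) (fun w => y' w.1 w.2).
    move=> ih; have := y'E F (range u) z h Fc Mz ih.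
    have v : tuple_in (range u) (of_void U) by case.
    by move=> /(_ v); apply: (eqM_subE (f := inr)).
  exact: eqM_trans (E i ii) (eqM_sym (E j ij)).
have dS : dfn (fun e : Y + 'I_k -> U => R (tcat (e \o inr) (e \o inl))).
  pose f (t : 'I_k + Y) : Y + 'I_k := match t with inl x => inr x | inr y => inl y end.
  by apply: (dfn_sub (f := f)) dR => e [].
apply: (nip iz dS); exists u => l _.
have uB i : tuple_in (range u `|` [set u | exists j x, (j < i)%N /\ u = z j x]) u.
  by move=> x; left; exists x.
have := Mz l.*2; rewrite /F odd_double => /(_ Y R u dR (uB _) QR) R0.
have := Mz l.*2.+1; rewrite /F /= odd_double /=.
move=> /(_ Y (fun e => ~ R e) u (dfn_not dR) (uB _) Q'R) R1 [H _].
exact: R1 (H R0).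
Qed.

Variable Q : set_system ('I_k -> U).
Hypothesis Q1 : coheir1 Q.

(* [F_x (x) Q_y] and [Q_y (x) F_x] agree on [R(x; y, m)]. *)
Definition commutes X (F : set_system (X -> U)) Z (R : set (X + ('I_k + Z) -> U))
    (m : Z -> U) : Prop := forall a, reals F M1 a ->
  F [set x | R (tcat x (tcat d m))] <-> Q [set y | R (tcat a (tcat y m))].

Definition comm X (F : set_system (X -> U)) : Prop :=
  forall (Z : finType) (R : set (X + ('I_k + Z) -> U)) (m : Z -> U),
    dfn R -> tuple_in M1 m -> commutes F R m.

(** Commuting speaks of parameters in [M1]. To add [y n], the earlier terms are replaced by copies
    in [M1] and [y n] by [d]; what [Q] then says about [a] is carried back by the induction
    hypothesis. *)
Lemma comm_morley (X : finType) (F : set_system (X -> U)) a B (y : nat -> 'I_k -> U) n :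
  UltraFilter F -> inv F -> comm F -> reals F M1 a ->
  morley (fun i j => (i < j)%N) (fun=> Q) B y -> M1 `<=` B -> range a `<=` B ->
  reals F (M1 `|` [set u | exists i x, (i < n)%N /\ u = y i x]) a.
Proof.
move=> FU iF cF Fa My M1B aB; have [QU Qm Qd] := Q1; have Qi := coheir_inv QU Qm.
pose t n (z : 'I_n * 'I_k) := y z.1 z.2.
suff H : reals F (M1 `|` range (t n)) a.
  apply: reals_mono H => u [|[i [x [iN ->]]]]; [by left|right].
  by exists (Ordinal iN, x).
elim: n => [|n IH].
  by apply: reals_mono Fa => u [//|[[[]]]].
apply: reals_cat => Z m R dR mM; have {}mM : tuple_in M1 m.
  by move=> z; case: (mM z) => // /MM1.
have [y' [y'M y'E]] := coheir1_copies n mM.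
have {}y'E : eqM (tcat m (t n)) (tcat m (fun z : 'I_n * 'I_k => y' z.1 z.2)).
  by apply: (y'E _ B y val (fun=> Q1) My) => // z; apply/M1B/mM.
pose g (z : Z + 'I_n.+1 * 'I_k) : 'I_k + (Z + 'I_n * 'I_k) := match z with
  | inl z => inr (inl z)
  | inr z => if unlift ord_max z.1 is Some i then inr (inr (i, z.2)) else inl z.2 end.
have gE : tcat m (t n.+1) = tcat (y n) (tcat m (t n)) \o g.
  apply: funext => -[//|[i x]] /=; rewrite /t /=.
  by case: unliftP => [i' ->|->] //=; rewrite /bump leqNgt ltn_ord.
pose R' (e : X + ('I_k + (Z + 'I_n * 'I_k)) -> U) :=
  R (tcat (e \o inl) (e \o inr \o g)).
have dR' : dfn R'.
  pose f (s : X + (Z + 'I_n.+1 * 'I_k)) := match s with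
    inl x => inl x | inr z => inr (g z) end.
  by apply: (dfn_sub (f := f)) dR => e [].
rewrite gE => FR.
have [d0M d0E] : tuple_in M1 (tcat m (fun z : 'I_n * 'I_k => y' z.1 z.2)) /\
    eqM (tcat (y n) (tcat m (t n))) (tcat d (tcat m (fun z : 'I_n * 'I_k => y' z.1 z.2))).
  have yM : tuple_in M1 (tcat m (fun z : 'I_n * 'I_k => y' z.1 z.2)).
    by move=> [z|z]; [exact: mM|exact: y'M].
  split=> //; apply: (eqM_reals QU Qi (My n) Qd) => //.
  move=> [z|[i x]]; first by left; apply/M1B/mM.
  by right; exists i, x.
have {}FR : F [set x | R' (tcat x (tcat d (tcat m (fun z : 'I_n * 'I_k => y' z.1 z.2))))].
  exact: (iF _ R' _ _ dR' d0E FR).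
move/(cF _ R' _ dR' d0M a Fa): FR => QR.
have aE : eqM (tcat a (tcat m (fun z : 'I_n * 'I_k => y' z.1 z.2))) (tcat a (tcat m (t n))).
  apply: (eqM_reals FU iF Fa IH) => //; last exact: eqM_sym.
  by move=> [z|z]; [left; exact: mM|right; exists z].
pose R2 (e : 'I_k + (X + (Z + 'I_n * 'I_k)) -> U) :=
  R' (tcat (e \o inr \o inl) (tcat (e \o inl) (e \o inr \o inr))).
have dR2 : dfn R2.
  pose f (s : X + ('I_k + (Z + 'I_n * 'I_k))) := match s with
    inl x => inr (inl x) | inr (inl i) => inl i | inr (inr z) => inr (inr z) end.
  by apply: (dfn_sub (f := f)) dR' => e [|[]].
have {}QR := Qi _ R2 _ _ dR2 aE QR.
apply: (My n _ R2 _ dR2 _ QR).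
move=> [x|[z|[i x]]]; first by left; apply: aB; exists x.
  by left; apply/M1B/mM.
by right; exists i, x.
Qed.

Lemma indiscernible_dfn I (lt : I -> I -> Prop) A X (Y : finType) (y : I -> X -> U) i j
    (R : set (Y + X -> U)) c : sub_set M `<=` A -> indiscernible lt A y -> dfn R ->
  tuple_in A c -> R (tcat c (y i)) -> R (tcat c (y j)).
Proof.
move=> MA iy dR cA; have I1 (t : 'I_1 -> I) : increasing lt t.
  by move=> u v; rewrite !ord1.
have E := eqM_eq_tp MA (iy 1 (fun=> i) (fun=> j) (I1 _) (I1 _)) cA.
pose f (t : Y + X) : Y + 'I_1 * X := match t with inl u => inl u | inr u => inr (ord0, u) end.
apply: (eqM_subE (f := f) _ _ E) dR; by move=> [].
Qed.

(** The term after [d0] realizes [Q] over [C] as well. With [C] the element [b] of [key_dp], it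
    tells what [Q] says about [b]. *)
Lemma morley_cat B C (E : nat -> 'I_k -> U) d0 :
  countable B -> countable C -> morley (fun i j => (i < j)%N) (fun=> Q) B E ->
  reals Q (B `|` seq_set E) d0 -> exists y : nat + nat -> 'I_k -> U,
  [/\ y \o inl = E, y (inr 0) = d0, reals Q (B `|` C) (y (inr 1)) &
    morley (sum_lt (fun i j => (i < j)%N) (fun i j => (i < j)%N)) (fun=> Q) B y].
Proof.
move=> cB cC ME Qd0; have [QU _ _] := Q1.
have cB' : countable (((B `|` seq_set E) `|` range d0) `|` C).
  apply: countableU cC; apply: countableU (countable_range d0).
  exact: countableU cB (countable_seq_set E).
have [D MD] := morley_nat (F := fun=> Q) (fun=> QU) cB'.
exists (fun i => match i with inl i => E i | inr 0 => d0 | inr i.+1 => D i end); split=> //.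
  apply: reals_mono (MD 0) => u [Bu|Cu]; left; [by left; left; left|by right].
move=> [i|[|i]].
- apply: reals_mono (ME i) => u [Bu|[[j|j] [x [//= ji ->]]]]; first by left.
  by right; exists j, x.
- apply: reals_mono Qd0 => u [Bu|[[j|j] [x [//= ji ->]]]]; first by left.
  by right; exists j, x.
- apply: reals_mono (MD i) => u [Bu|[[j|[|j]] [x [ji ->]]]]; first by left; left; left; left.
  + by left; left; left; right; exists j, x.
  + by left; left; right; exists x.
  + by right; exists j, x.
Qed.

Lemma dfn_all_extend (X Y : Type) (R : set (option X + Y -> U)) : dfn R ->
  dfn (fun e : X + Y -> U => forall x, R (tcat (extend (e \o inl) x) (e \o inr))).
Proof.
move=> dR; pose f (t : option X + Y) : unit + (X + Y) := match t with
  | inl (Some x) => inr (inl x) | inl None => inl tt | inr y => inr (inr y) end.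
have dR' : dfn (fun e : unit + (X + Y) -> U => R (e \o f)).
  by apply: (dfn_sub (f := f)) dR.
have E (x : unit -> U) e : tcat x e \o f = tcat (extend (e \o inl) (x tt)) (e \o inr).
  by apply: funext => -[[]|].
apply: (dfn_ext _ (dfn_all dR')) => e; split=> H x; last by rewrite E.
by rewrite -(E (fun=> x)).
Qed.

Definition relative X Y Z (chi : set (option X + Z -> U)) (R : set (option X + (Y + Z) -> U))
    (e : X + (Y + Z) -> U) : Prop := forall x,
  chi (tcat (extend (e \o inl) x) (e \o inr \o inr)) -> R (tcat (extend (e \o inl) x) (e \o inr)).

Lemma dfn_relative X Y Z (chi : set (option X + Z -> U)) (R : set (option X + (Y + Z) -> U)) :
  dfn chi -> dfn R -> dfn (relative chi R).
Proof.
move=> dchi dR; pose f (t : option X + Z) : option X + (Y + Z) :=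
  match t with inl x => inl x | inr i => inr (inr i) end.
have d12 : dfn (fun e => chi (e \o f) -> R e).
  by apply: dfn_imp => //; apply: (dfn_sub (f := f)) dchi.
apply: (dfn_ext _ (dfn_all_extend d12)) => e.
have E1 x : tcat (extend (e \o inl) x) (e \o inr) \o f =
    tcat (extend (e \o inl) x) (e \o inr \o inr) by apply: funext => -[].
by split=> H x; have := H x; rewrite E1.
Qed.

(** * The formula that forces commutation *)

Section Key.
Variables (X' : finType) (l : nat) (p' : set_system (X' -> U)) (p : set_system (option X' -> U)).
Hypotheses (pU' : UltraFilter p') (pi' : inv p') (cp' : comm p').
Hypotheses (pU : UltraFilter p) (pi : inv p) (pp' : extends_type p' p).
Variables (m : 'I_l -> U) (R : set (option X' + ('I_k + 'I_l) -> U)) (a : option X' -> U).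
Hypotheses (mM : tuple_in M1 m) (dR : dfn R).
Hypotheses (pR : p [set x | R (tcat x (tcat d m))]) (pa : reals p (range m) a).
Hypothesis QR : ~ Q [set y | R (tcat a (tcat y m))].
Variables (a' : X' -> U) (E : nat -> 'I_k -> U) (d0 : 'I_k -> U).
Hypothesis pa' : reals p' M1 a'.
Let B := M1 `|` range a'.
Hypothesis ME : morley (fun i j => (i < j)%N) (fun=> Q) B E.
Hypothesis Qd0 : reals Q (B `|` seq_set E) d0.

Let cB : countable B.
Proof. by apply: countableU => //; exact: countable_range. Qed.

(* dp-minimality: [E] or the continuation of [d0] is indiscernible over [b], and
   in the second case [R] would hold between [b] and [Q]. *)
Lemma key_dp b : reals p (range (tcat m (tcat (E 1) d0))) (extend a' b) ->
  R (tcat (extend a' b) (tcat (E 0) m)).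
Proof.
move=> pb; have [QU Qm Qd] := Q1; have Qi := coheir_inv QU Qm.
have mB : tuple_in B m by move=> i; left.
(* [e] has over [m] the type of [d], so [p] contains [R(x; e, m)]; and [(a', b)] realizes [p] over
   [e]. *)
have Rab e : reals Q (B `|` set0) e -> (forall i, range (tcat m (tcat (E 1) d0)) (e i)) ->
    R (tcat (extend a' b) (tcat e m)).
  move=> Qe re; apply: pb dR _ _; first by move=> [i|i]; [exact: re|exists (inl i)].
  apply: (pi dR) pR; apply: (eqM_reals QU Qi Qd Qe) => // i; left; exact: mB.
have QB i : reals Q (B `|` set0) (E i) by apply: reals_mono (@ME i) => u [|//]; left.
have [y [yE y0 y1 My]] := morley_cat cB (countable_range (fun _ : unit => b)) ME Qd0.
have MB : sub_set M `<=` B by move=> u /MM1; left.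
have nI : infinite_set [set: nat] by exact: infinite_nat.
have abB : tuple_in (B `|` [set b]) (tcat (extend a' b) m).
  by move=> [[x|]|i]; [left; right; exists x|right|left; left; exact: mM].
have MBb : sub_set M `<=` B `|` [set b] by move=> u /MB; left.
pose R' (e : (option X' + 'I_l) + 'I_k -> U) :=
  R (tcat (e \o inl \o inl) (tcat (e \o inr) (e \o inl \o inr))).
have dR' : dfn R'.
  pose f (t : option X' + ('I_k + 'I_l)) : (option X' + 'I_l) + 'I_k :=
    match t with inl x => inl (inl x) | inr (inl i) => inr i | inr (inr i) => inl (inr i) end.
  by apply: (dfn_sub (f := f)) dR => e [|[]].
have [iE|iD] := dp_minimal_sum b MB cB linear_order_nat linear_order_nat nI nI
  (morley_indiscernible QU Qi My).
  (* [R] is known at [E 1] and passes to [E 0], over which [(a', b)] need not realize [p]. *)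
  have : R' (tcat (tcat (extend a' b) m) (y (inl 0))).
    apply: (indiscernible_dfn (i := 1) 0 MBb iE dR' abB).
    apply: Rab => [|i]; first by rewrite yE; exact: QB.
    by exists (inr (inl i)) => //; rewrite -yE.
  by rewrite -[y _]/((y \o inl) 0) yE.
(* [R] passes from [d0] to a term realizing [Q] over [b]; then [Q] contains [R(a; y, m)], against
   [QR]. *)
have R1 : R' (tcat (tcat (extend a' b) m) (y (inr 1))).
  apply: (indiscernible_dfn (i := 0) 1 MBb iD dR' abB).
  apply: Rab => [|i]; first by rewrite /= y0; apply: (reals_mono _ Qd0) => u [|//]; left.
  by exists (inr (inr i)) => //; rewrite /= y0.
pose R2 (e : 'I_k + (option X' + 'I_l) -> U) := R' (tcat (e \o inr) (e \o inl)).
have dR2 : dfn R2.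
  pose f (t : (option X' + 'I_l) + 'I_k) : 'I_k + (option X' + 'I_l) :=
    match t with inl x => inr x | inr i => inl i end.
  by apply: (dfn_sub (f := f)) dR' => e [].
case: QR; apply: (Qi _ R2 (tcat (extend a' b) m) (tcat a m) dR2).
  apply: (eqM_reals pU pi pb pa) => [i|i|]; [by exists (inl i)|by exists i|exact: eqM_refl].
apply: (proj2 (realsP QU y1 dR2 _)) R1.
by move=> [[x|]|i]; [left; right; exists x|right; exists tt|left; left; exact: mM].
Qed.

(** If no [zeta] sufficed, saturation would give a [b] such that [(a', b)] realizes [p] over [m],
    [E 1], [d0] while [R] fails at [E 0], against [key_dp]. *)
Lemma key_implication : exists zeta : set (option X' + ('I_l + ('I_k + 'I_k)) -> U),
  [/\ dfn zeta, p [set x | zeta (tcat x (tcat m (tcat (E 1) d0)))] &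
    forall b, zeta (tcat (extend a' b) (tcat m (tcat (E 1) d0))) ->
      R (tcat (extend a' b) (tcat (E 0) m))].
Proof.
pose t := tcat m (tcat (E 1) d0); pose c := tcat a' (tcat t (E 0)).
pose P (zeta : set (option X' + ('I_l + ('I_k + 'I_k)) -> U)) := [set x : unit -> U |
  zeta (tcat (extend a' (x tt)) t) /\ ~ R (tcat (extend a' (x tt)) (tcat (E 0) m))].
pose D : set (set (unit -> U)) :=
  [set S | exists zeta, [/\ dfn zeta, p [set x | zeta (tcat x t)] & S = P zeta]].
have dT Y : dfn (setT : set (Y -> U)).
  by apply: (dfn_ext _ (dfn_not (@dfn_false Y))) => e; split=> // _.
apply: contrapT => nz; have [|||||x Dx] := @saturated_dfn _ (range c) D.
- exact: countable_range.
- exists (P setT), setT; split=> //; exact: filterT.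
- move=> S [z [dz pz ->]]; apply: contrapT => nS; apply: nz; exists z; split=> // b zb.
  by apply: contrapT => nR; apply: nS; exists (fun=> b).
- move=> S1 S2 [z1 [dz1 pz1 ->]] [z2 [dz2 pz2 ->]].
  exists (P (z1 `&` z2)); last by move=> x [[]].
  by exists (z1 `&` z2); split=> //; [exact: dfn_and|exact: filterI].
- move=> S [z [dz _ ->]].
  exists (X' + ('I_l + ('I_k + 'I_k) + 'I_k))%type, c.
  exists (fun e : unit + (X' + ('I_l + ('I_k + 'I_k) + 'I_k)) -> U =>
    z (tcat (extend (e \o inr \o inl) (e (inl tt))) (e \o inr \o inr \o inl)) /\
    ~ R (tcat (extend (e \o inr \o inl) (e (inl tt)))
          (tcat (e \o inr \o inr \o inr) (e \o inr \o inr \o inl \o inl)))).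
  split; [|by move=> i; exists i|by []].
  pose ho (o : option X') : unit + (X' + ('I_l + ('I_k + 'I_k) + 'I_k)) :=
    if o is Some x then inr (inl x) else inl tt.
  apply: dfn_and.
    pose f s := match s with inl o => ho o | inr s => inr (inr (inl s)) end.
    by apply: (dfn_sub (f := f)) dz => e [[]|].
  pose f s := match s with inl o => ho o | inr (inl i) => inr (inr (inr i))
     | inr (inr i) => inr (inr (inl (inl i))) end.
  by apply: dfn_not; apply: (dfn_sub (f := f)) dR => e [[]|[]].
have [_ nR] : P setT x.
  apply: Dx; exists setT; split=> //; exact: filterT.
apply/nR/key_dp => Y S e dS er pS.
have /choice[f fE] : forall y, exists i, t i = e y by move=> y; have [i _ <-] := er y; exists i.
have eE : e = t \o f by apply: funext => y; rewrite /= fE.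
pose S' (w : option X' + ('I_l + ('I_k + 'I_k)) -> U) := S (tcat (w \o inl) (w \o inr \o f)).
have DS : D (P S').
  exists S'; split=> //.
    pose h (s : option X' + Y) : option X' + ('I_l + ('I_k + 'I_k)) :=
      match s with inl x => inl x | inr y => inr (f y) end.
    by apply: (dfn_sub (f := h)) dS => w [].
  by move: pS; rewrite eE.
by rewrite eE; case: (Dx _ DS).
Qed.

Variable s : nat -> 'I_l -> U.
Hypotheses (ms : strict_morley M m s) (sM : forall i, tuple_in M1 (s i)) (s0 : s 0 = m).

(** [w], made of [E 1] and [d0], is finitely satisfiable in [M] over [M1], [a'] and [E 0]. So two
    facts about it pass to some [w'] in [M]: [zeta] has a common solution at [s 0] and [s 1], and
    [zeta] implies [R] at [E 0]. The first yields the invariant extension. The second becomes a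
    statement about [d] because [E 0] realizes [Q] over [a'] and [p'] commutes with [Q]. *)
Lemma key_formula : exists chi : set (option X' + 'I_l -> U), [/\ dfn chi,
  exists F, [/\ UltraFilter F, inv F, extends_type p' F & F [set x | chi (tcat x m)]] &
  p' [set x' | relative chi R (tcat x' (tcat d m))]].
Proof.
have [zeta [dz pz zR]] := key_implication; have [QU Qm Qd] := Q1.
pose W := ('I_k + 'I_k)%type; pose w : W -> U := tcat (E 1) d0.
have fw : fsat (B `|` range (E 0)) w.
  apply: fsat_trans.
    apply: fsat_mono (coheir_fsat QU Qm (@ME 1)) => u [Bu|[i _ <-]]; first by left.
    by right; exists 0, i.
  apply: fsat_mono (coheir_fsat QU Qm Qd0) => u [[Bu|[i _ <-]]|[i _ <-]].
  - by left.
  - by right; exists 0, i.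
  - by right; exists 1, i.
have swm j : eqM (tcat m w) (tcat (s j) w).
  have [F [FU Fm Fw]] := fsat_coheir fw.
  pose f (t : 'I_l + W) : W + 'I_l := match t with inl i => inr i | inr i => inl i end.
  apply: (eqM_subE (f := f) (a := tcat w m) (b := tcat w (s j))); try by case.
  apply: (eqM_reals FU (coheir_inv FU Fm) Fw Fw); last exact: strict_morley_eqM.
    by move=> i; left; left; exact: mM.
  by move=> i; left; left; exact: sM.
pose sw (z : 'I_2 * ('I_l + W)) := tcat (s z.1) w z.2.
(* [p] contains [zeta] at [s 0] and at [s 1]; its [None] coordinate is the common solution. *)
have psol : p' [set x' | solvable zeta (tcat x' sw)].
  apply: contrapT => /(ultra_not pU') np.
  have := pp' (dfn_not (dfn_solvable 2 dz)) np.
  have pk j : p [set x | zeta (tcat x (tcat (s j) w))] := pi dz (swm j) pz.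
  move=> /(filterI (filterI (pk 0) (pk 1))) /filter_ex[x [[z0 z1]]]; apply.
  exists (x None) => -[[|[|]] //= h].
    by rewrite (_ : extend _ _ = x) //; apply: funext => -[].
  by rewrite (_ : extend _ _ = x) //; apply: funext => -[].
have [y [yE y0 _ My]] := morley_cat cB (@countable_range 'I_l _ m) ME Qd0.
pose g i : nat + nat := match i with 0 => inl 0 | 1 => inl 1 | i.+2 => inr i end.
have Mz : morley (fun i j => (i < j)%N) (fun=> Q) B (y \o g).
  move=> i; apply: reals_mono (My (g i)) => u [Bu|[j [x [ji ->]]]]; first by left.
  by right; exists (g j), x; split=> //; case: i j ji => [|[|i]] [|[|j]].
(* As [p'] commutes with [Q], [a'] realizes [p'] even over [E 0], [E 1] and [d0]. *)
have {psol} sol : solvable zeta (tcat a' sw).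
  have H : reals p' (M1 `|` [set u | exists i x, (i < 3)%N /\ u = (y \o g) i x]) a'.
    by apply: comm_morley Mz _ _ => // u; [left|right].
  apply: (proj1 (realsP pU' H (dfn_solvable 2 dz) _)) psol => -[i [x|[x|x]]].
  - by left; exact: sM.
  - right; exists 1, x; split=> //; exact: (congr1 (fun h => h 1 x) (esym yE)).
  - right; exists 2, x; split=> //; exact: (congr1 (@^~ x) (esym y0)).
pose c : X' + ('I_k + 'I_2 * 'I_l) -> U := tcat a' (tcat (E 0) (fun z : 'I_2 * 'I_l => s z.1 z.2)).
have cB' : tuple_in (B `|` range (E 0)) c.
  move=> [x|[i|z]]; [by left; right; exists x|by right; exists i|left; left; exact: sM].
pose C := (W + (X' + ('I_k + 'I_2 * 'I_l)))%type.
pose S (e : C -> U) :=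
  solvable zeta (tcat (e \o inr \o inl) (fun z : 'I_2 * ('I_l + W) => match z.2 with
     | inl i => e (inr (inr (inr (z.1, i)))) | inr i => e (inl i) end)) /\
  forall x, zeta (tcat (extend (e \o inr \o inl) x)
                   (tcat (fun i => e (inr (inr (inr (ord0, i))))) (e \o inl))) ->
    R (tcat (extend (e \o inr \o inl) x)
         (tcat (e \o inr \o inr \o inl) (fun i => e (inr (inr (inr (ord0, i))))))).
have dS : dfn S.
  apply: dfn_and.
    pose f (t : X' + 'I_2 * ('I_l + W)) : C := match t with
      | inl x => inr (inl x) | inr (j, inl i) => inr (inr (inr (j, i)))
      | inr (j, inr i) => inl i end.
    by apply: (dfn_sub (f := f)) (dfn_solvable 2 dz) => e [x|[j [i|i]]].
  pose f1 (t : option X' + ('I_l + W)) : option X' + (W + ('I_k + 'I_2 * 'I_l)) :=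
    match t with
    | inl x => inl x | inr (inl i) => inr (inr (inr (ord0, i))) | inr (inr i) => inr (inl i)
    end.
  pose f2 (t : option X' + ('I_k + 'I_l)) : option X' + (W + ('I_k + 'I_2 * 'I_l)) :=
    match t with
    | inl x => inl x | inr (inl i) => inr (inr (inl i))
    | inr (inr i) => inr (inr (inr (ord0, i))) end.
  have d12 : dfn (fun e => zeta (e \o f1) -> R (e \o f2)).
    by apply: dfn_imp; [apply: (dfn_sub (f := f1)) dz|apply: (dfn_sub (f := f2)) dR].
  pose f3 (t : X' + (W + ('I_k + 'I_2 * 'I_l))) : C := match t with
    | inl x => inr (inl x) | inr (inl i) => inl i | inr (inr i) => inr (inr i) end.
  have := dfn_sub (f := f3) (g := fun e => e \o f3) (fun _ _ => erefl) (dfn_all_extend d12).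
  have E1 (e : C -> U) x : tcat (extend ((e \o f3) \o inl) x) ((e \o f3) \o inr) \o f1 =
      tcat (extend (e \o inr \o inl) x)
        (tcat (fun i => e (inr (inr (inr (ord0, i))))) (e \o inl)).
    by apply: funext => -[[]|[]].
  have E2 (e : C -> U) x : tcat (extend ((e \o f3) \o inl) x) ((e \o f3) \o inr) \o f2 =
      tcat (extend (e \o inr \o inl) x)
        (tcat (e \o inr \o inr \o inl) (fun i => e (inr (inr (inr (ord0, i)))))).
    by apply: funext => -[[]|[]].
  by apply: dfn_ext => e; split=> H x; have := H x; rewrite E1 E2.
have [|w' w'M [sol' imp']] := fw _ S c dS cB'.
  split.
    have swE : sw = fun z => match z.2 with inl i => s z.1 i | inr i => w i end.
      by apply: funext => -[j [i|i]].
    by move: sol; rewrite swE.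
  move=> x; rewrite /= s0; exact: zR.
pose chi (e : option X' + 'I_l -> U) := zeta (tcat (e \o inl) (tcat (e \o inr) w')).
have dchi : dfn chi.
  pose f (t : option X' + ('I_l + W)) : (option X' + 'I_l) + induced M := match t with
    | inl x => inl (inl x) | inr (inl i) => inl (inr i)
    | inr (inr i) => inr (exist _ (w' i) (w'M i)) end.
  by apply: (dfn_subM (f := f)) dz => e [|[]].
exists chi; split=> //.
  apply: (strict_extension ms pU' pi' dchi).
  pose sj (z : 'I_2 * 'I_l) := s z.1 z.2.
  apply: (proj2 (realsP pU' pa' (dfn_solvable 2 dchi) (c := sj) _)) => [i|]; first exact: sM.
  have [x Hx] := sol'; exists x => j; have := Hx j.
  rewrite /chi /=; congr (zeta _); apply: funext => -[|[]] //.
have dR2 := dfn_relative dchi dR.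
apply: (proj2 (cp' dR2 mM pa')).
pose R3 (e : 'I_k + (X' + 'I_l) -> U) :=
  relative chi R (tcat (e \o inr \o inl) (tcat (e \o inl) (e \o inr \o inr))).
have dR3 : dfn R3.
  pose f (t : X' + ('I_k + 'I_l)) : 'I_k + (X' + 'I_l) := match t with
    | inl x => inr (inl x) | inr (inl i) => inl i | inr (inr i) => inr (inr i) end.
  by apply: (dfn_sub (f := f)) dR2 => e [|[]].
apply: (proj2 (realsP QU (@ME 0) dR3 (c := tcat a' m) _)).
  by move=> [x|i]; left; [right; exists x|left; exact: mM].
by move=> x; rewrite /= -s0; exact: imp'.
Qed.

End Key.

Hypothesis countL : countable_language L.
Hypothesis morley1 : forall (l : nat) (m : 'I_l -> U), tuple_in M1 m ->
  exists s : nat -> 'I_l -> U,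
    [/\ strict_morley M m s, forall i, tuple_in M1 (s i) & s 0 = m].

Lemma limit_ultra (I T : Type) (W : set_system I) (G : I -> set_system T) :
  UltraFilter W -> (forall i, UltraFilter (G i)) -> UltraFilter [set S | W [set i | G i S]].
Proof.
move=> WU GU; pose H := [set S | W [set i | G i S]].
have PF : ProperFilter H.
  split; last split.
  - move=> W0; have /filter_ex[i Gi] : W [set i | G i set0] := W0.
    exact: filter_not_empty Gi.
  - by rewrite /H /=; apply: filterE => i; exact: filterT.
  - move=> P P'; rewrite /H /= => HP HP'.
    by apply: filterS2 HP HP' => i /=; exact: filterI.
  - move=> P P' PP'; rewrite /H /=; apply: filterS => i /=.
    by apply: filterS => u /=; exact: PP'.
split=> // F FF HF; apply/seteqP; split=> // P FP; apply: contrapT.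
move=> /(ultra_not WU) nP.
have /HF FnP : H (~` P).
  by rewrite /H /=; apply: filterS nP => i /= /(ultra_not (GU i)).
by have [x []] := filter_ex (filterI FP FnP).
Qed.

(** * Generic invariant extensions *)

Section Generic.
Variables (X' : finType) (p' : set_system (X' -> U)).
Hypotheses (pU' : UltraFilter p') (pi' : inv p') (cp' : comm p').

Definition inv_extension (F : set_system (option X' -> U)) : Prop :=
  [/\ UltraFilter F, inv F & extends_type p' F].

(* Nonempty basic open sets of invariant extensions of [p'], with parameters in [M1]
   and [d]. *)
Definition condition (P : set (option X' -> U)) : Prop :=
  (exists (Z : finType) (R : set (option X' + ('I_k + Z) -> U)) (m : Z -> U),
    [/\ dfn R, tuple_in M1 m & P = [set x | R (tcat x (tcat d m))]]) /\
  exists2 F, inv_extension F & F P.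

Lemma extends_reals (F : set_system (option X' -> U)) A a :
  extends_type p' F -> reals F A a -> reals p' A (a \o Some).
Proof.
move=> eF Fa Y S c dS cA /(eF _ _ _ dS) FS.
pose f (t : X' + Y) : option X' + Y := match t with inl x => inl (Some x) | inr y => inr y end.
pose S' (e : option X' + Y -> U) := S (tcat (e \o inl \o Some) (e \o inr)).
have dS' : dfn S' by apply: (dfn_sub (f := f)) dS => e [].
exact: Fa dS' cA FS.
Qed.

(** An extension in [P] that does not commute contains [R1], one of [R] and its negation, while [Q]
    does not contain it at [a]. The [chi] found for [T] and [R1] together forces [R1] into every
    extension that contains it and into [Q] at every realization, hence commutation. *)
Lemma refine_commutes (P : set (option X' -> U)) (Z : finType)
    (R : set (option X' + ('I_k + Z) -> U)) (m : Z -> U) :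
  condition P -> dfn R -> tuple_in M1 m -> exists P', [/\ condition P', P' `<=` P &
    forall F, inv_extension F -> F P' -> commutes F R m].
Proof.
move=> cP dR mM; have [[Z1 [T [m1 [dT m1M PE]]]] _] := cP.
have [QU Qm Qd] := Q1.
have [H|] := pselect (forall F, inv_extension F -> F P -> commutes F R m).
  by exists P; split.
move=> /existsNP[F /not_implyP[eF /not_implyP[FP /existsNP[a /not_implyP[Fa nR]]]]].
have [FU Fi Fe] := eF.
have [R1 [dR1 FR1 QR1 R1E]] : exists R1 : set (option X' + ('I_k + Z) -> U), [/\ dfn R1,
    F [set x | R1 (tcat x (tcat d m))], ~ Q [set y | R1 (tcat a (tcat y m))] &
    forall G b, UltraFilter G -> G [set x | R1 (tcat x (tcat d m))] ->
      Q [set y | R1 (tcat b (tcat y m))] ->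
      G [set x | R (tcat x (tcat d m))] <-> Q [set y | R (tcat b (tcat y m))]].
  have [FR|FR] := pselect (F [set x | R (tcat x (tcat d m))]).
    exists R; split=> //; first by move=> QR; apply: nR.
  exists (fun e => ~ R e); split.
  - exact: dfn_not.
  - exact/(ultra_not FU).
  - by move=> /(ultra_not QU) QR; apply: nR.
  - by move=> G b GU /(ultra_not GU) GR /(ultra_not QU) QR.
pose n := #|{: Z1 + Z}|; pose m2 : 'I_n -> U := tcat m1 m \o enum_val.
have m2M : tuple_in M1 m2.
  by move=> i; rewrite /m2 /=; case: (enum_val i) => z; [exact: m1M|exact: mM].
have m2E h : m2 (enum_rank h) = tcat m1 m h by rewrite /m2 /= enum_rankK.
pose i1 (t : option X' + ('I_k + Z1)) : option X' + ('I_k + 'I_n) := match t with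
  | inl x => inl x | inr (inl i) => inr (inl i)
  | inr (inr z) => inr (inr (enum_rank (inl z : Z1 + Z))) end.
pose i2 (t : option X' + ('I_k + Z)) : option X' + ('I_k + 'I_n) := match t with
  | inl x => inl x | inr (inl i) => inr (inl i)
  | inr (inr z) => inr (inr (enum_rank (inr z : Z1 + Z))) end.
have E1 x y : tcat x (tcat y m2) \o i1 = tcat x (tcat y m1).
  by apply: funext => -[|[|z]] //=; rewrite -[LHS]/(m2 _) m2E.
have E2 x y : tcat x (tcat y m2) \o i2 = tcat x (tcat y m).
  by apply: funext => -[|[|z]] //=; rewrite -[LHS]/(m2 _) m2E.
pose R2 (e : option X' + ('I_k + 'I_n) -> U) := T (e \o i1) /\ R1 (e \o i2).
have dR2 : dfn R2.
  by apply: dfn_and; [apply: (dfn_sub (f := i1)) dT|apply: (dfn_sub (f := i2)) dR1].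
have R2E x y : R2 (tcat x (tcat y m2)) <-> T (tcat x (tcat y m1)) /\ R1 (tcat x (tcat y m)).
  by rewrite /R2 E1 E2.
have FR2 : F [set x | R2 (tcat x (tcat d m2))].
  rewrite PE in FP; apply: filterS (filterI FP FR1) => x [? ?]; exact/R2E.
have QR2 : ~ Q [set y | R2 (tcat a (tcat y m2))].
  by move=> QR2; apply: QR1; apply: (filterS _ QR2) => y /R2E[].
have Fa2 : reals F (range m2) a by apply: reals_mono Fa => _ [i _ <-].
have [a' pa'] := reals_ex (F := p') _ countM1.
have cB : countable (M1 `|` range a') by apply: countableU => //; exact: countable_range.
have [E ME] := morley_nat (F := fun=> Q) (fun=> QU) cB.
have [d0 Qd0] := reals_ex (F := Q) _ (countableU cB (countable_seq_set E)).
have [s [ms sM s0]] := morley1 m2M.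
have [chi [dchi [F' [FU' Fi' Fe' Fchi]] pchi]] :=
  key_formula pU' pi' cp' FU Fi Fe m2M dR2 FR2 Fa2 QR2 pa' ME Qd0 ms sM s0.
have extE (x : option X' -> U) : extend (x \o Some) (x None) = x by apply: funext => -[].
have GR2 G : inv_extension G -> G [set x | chi (tcat x m2)] ->
    G [set x | R2 (tcat x (tcat d m2))].
  move=> [GU Gi Ge] Gchi; have GS := Ge _ _ _ (dfn_relative dchi dR2) pchi.
  apply: filterS (filterI GS Gchi) => x [/(_ (x None))] /=.
  by rewrite -[_ \o inl]/(x \o Some) extE; apply.
have eF' : inv_extension F' by [].
exists (P `&` [set x | chi (tcat x m2)]); split.
- split; last first.
    exists F' => //; apply: filterI => //.
    by rewrite PE; apply: filterS (GR2 _ eF' Fchi) => x /R2E[].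
  pose T' (e : option X' + ('I_k + 'I_n) -> U) :=
    T (e \o i1) /\ chi (tcat (e \o inl) (e \o inr \o inr)).
  exists 'I_n, T', m2; split=> //.
    apply: dfn_and; first by apply: (dfn_sub (f := i1)) dT.
    pose f (t : option X' + 'I_n) : option X' + ('I_k + 'I_n) :=
      match t with inl x => inl x | inr i => inr (inr i) end.
    by apply: (dfn_sub (f := f)) dchi => e [].
  by rewrite PE; apply/seteqP; split=> x; rewrite /T' /= E1.
- by move=> x [].
- move=> G eG GP b Gb; have [GU Gi Ge] := eG.
  have Gchi : G [set x | chi (tcat x m2)] by apply: filterS GP => x [].
  apply: R1E => //; first by apply: filterS (GR2 _ eG Gchi) => x /R2E[].
  have := proj1 (cp' (dfn_relative dchi dR2) m2M (extends_reals Ge Gb)) pchi.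
  apply: filterS => y /(_ (b None)) /=.
  rewrite -[_ \o inl]/(b \o Some) extE => H.
  have /H/R2E[] // : chi (tcat b m2) by apply: Gb dchi m2M Gchi.
Qed.

(** The sets [R] hide parameters from [M]; made explicit, they leave countably many pairs of a
    formula and a tuple of [M1] to be treated. *)
Lemma commutes_formula (Z : finType)
    (R : set (option X' + ('I_k + Z) -> U)) (m : Z -> U) : dfn R -> tuple_in M1 m ->
  exists l (phi : formula L (option X' + ('I_k + 'I_l))) (m' : 'I_l -> U), tuple_in M1 m' /\
    forall x y, R (tcat x (tcat y m)) <-> sat (tcat x (tcat y m')) phi.
Proof.
move=> [phi phiE] mM; have [u0 Mu0] := sub_nonempty M.
pose f (t : option X' + ('I_k + Z) + induced M) : (option X' + 'I_k) + Z + induced M :=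
  match t with inl (inl x) => inl (inl (inl x)) | inl (inr (inl i)) => inl (inl (inr i))
  | inl (inr (inr z)) => inl (inr z) | inr u => inr u end.
have [l [psi [g H]]] := parametric_formula (exist _ u0 Mu0 : induced M) (frename phi f).
pose h (t : option X' + 'I_k + 'I_l) : option X' + ('I_k + 'I_l) :=
  match t with inl (inl x) => inl x | inl (inr i) => inr (inl i) | inr i => inr (inr i) end.
exists l, (frename psi h), (tcat m (@sval _ _) \o g); split.
  by move=> i /=; case: (g i) => [z|[u Mu]] /=; [exact: mM|exact: MM1].
move=> x y; rewrite phiE sat_rename.
rewrite (_ : _ \o h = tcat (tcat x y) (tcat m (@sval _ _) \o g)); last first.
  by apply: funext => -[[]|].
rewrite -(H U (tcat x y) m (@sval _ _)) sat_rename.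
by rewrite (_ : tcat _ _ \o f = tcat (tcat x (tcat y m)) (@sval _ _)) //; apply: funext => -[[|[]]|].
Qed.

(* A generic invariant extension commutes: meet all the countably many open dense
   sets of [refine_commutes]. *)
Lemma generic_extension (P : set (option X' -> U)) : condition P ->
  exists F, [/\ inv_extension F, comm F & F P].
Proof.
move=> cP; have [c1 c1I] : exists c1 : U -> nat, forall u v, M1 u -> M1 v -> c1 u = c1 v -> u = v.
  by have /countable_injP[c cI] := countM1; exists c => u v /mem_set uM /mem_set vM; apply: cI.
pose c l := sval (cid (@formula_code L countL (option X' + ('I_k + 'I_l))%type)).
have cI l : injective (@c l) := svalP (cid (@formula_code L countL (option X' + ('I_k + 'I_l))%type)).
pose code l (phi : formula L (option X' + ('I_k + 'I_l))) (m : 'I_l -> U) : nat :=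
  pickle (l, (c l phi, [seq c1 (m i) | i <- ord_enum l])).
have /choice[next nextP] : forall nP : nat * set (option X' -> U), exists P', condition nP.2 ->
    [/\ condition P', P' `<=` nP.2 & forall l phi m, tuple_in M1 m -> @code l phi m = nP.1 ->
      forall F, inv_extension F -> F P' -> commutes F (fun e => sat e phi) m].
  move=> [n P0] /=; have [cP0|] := pselect (condition P0); last by exists P0.
  have [[l [phi [m [mM E]]]]|none] := pselect (exists l phi m, tuple_in M1 m /\ @code l phi m = n).
    have [P' [cP' sub H]] := refine_commutes cP0 (dfn_sat phi) mM.
    exists P' => _; split=> // l' phi' m' m'M.
    rewrite -E => /(pcan_inj pickleK)[ll' cE Em]; subst l'; rewrite (cI _ _ _ cE).
    have -> // : m' = m.
    apply: funext => i; apply: c1I => //; have i_in := mem_ord_enum i.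
    have := congr1 (fun w => nth 0 w (index i (ord_enum l))) Em.
    by rewrite !(nth_map i) ?index_mem // nth_index.
  exists P0 => _; split=> // l phi m mM E; case: none; by exists l, phi, m.
pose Pn := fix Pn n := if n is j.+1 then next (j, Pn j) else P.
have cPn n : condition (Pn n) by elim: n => //= n /(nextP (n, Pn n))[].
have Pn_le j n : (j <= n)%N -> Pn n `<=` Pn j.
  elim: n => [|n IH]; first by rewrite leqn0 => /eqP ->.
  rewrite leq_eqVlt => /orP[/eqP -> //|/IH H].
  by apply: subset_trans H; have [] := nextP (n, Pn n) (cPn n).
(* The limit of the [G n] along a free ultrafilter lies in all the decreasing conditions, and being
   an invariant extension passes to the limit. *)
have /choice[G GP] n : exists F, inv_extension F /\ F (Pn n).
  by have [_ [F eF FP]] := cPn n; exists F.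
have [W [WU Wn]] := free_ultra.
have eG : inv_extension [set S | W [set n | G n S]].
  split.
  - by apply: limit_ultra => // n; have [[]] := GP n.
  - move=> Y R b b' dR bb'; apply: (@filterS _ W) => n; have [[_ Gi _] _] := GP n; exact: Gi.
  - move=> Y S b dS pS; apply: (@filterE _ W) => n; have [[_ _ Ge] _] := GP n; exact: Ge.
have GPn j : W [set n | G n (Pn j)].
  apply: filterS (Wn j) => n jn; have [[[GF _] _ _] GPn] := GP n.
  by apply: filterS GPn; apply: Pn_le; exact: ltnW.
exists [set S | W [set n | G n S]]; split=> //; last exact: (GPn 0).
move=> Z R m dR mM a Ga; have [l [phi [m' [m'M E]]]] := commutes_formula dR mM.
pose n := @code l phi m'; have [_ _ H] := nextP (n, Pn n) (cPn n).
have := H l phi m' m'M erefl _ eG (GPn n.+1) a Ga.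
rewrite (_ : [set x | _] = [set x | R (tcat x (tcat d m))]); last first.
  by apply/seteqP; split=> x /E.
by rewrite (_ : [set y | sat _ _] = [set y | R (tcat a (tcat y m))]) //; apply/seteqP; split=> y /E.
Qed.

End Generic.

(** * Induction on the number of variables *)

Fixpoint opt n : finType := if n is j.+1 then option (opt j) else void.

Lemma inv_image X Y (h : Y -> X) (F : set_system (X -> U)) : inv F ->
  inv [set P : set (Y -> U) | F [set x : X -> U | P (x \o h)]].
Proof.
move=> Fi Z S b c dS bc; pose f (t : Y + Z) : X + Z :=
  match t with inl x => inl (h x) | inr y => inr y end.
pose S' (e : X + Z -> U) := S (tcat (e \o inl \o h) (e \o inr)).
have dS' : dfn S' by apply: (dfn_sub (f := f)) dS => e [].
exact: Fi dS' bc.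
Qed.

Definition has_commuting (X : finType) : Prop :=
  forall (Z : finType) (R : set (X + ('I_k + Z) -> U)) (m : Z -> U),
  dfn R -> tuple_in M1 m ->
  (exists F : set_system (X -> U),
     [/\ UltraFilter F, inv F & F [set x | R (tcat x (tcat d m))]]) ->
  exists F : set_system (X -> U),
    [/\ UltraFilter F, inv F, comm F & F [set x | R (tcat x (tcat d m))]].

Lemma has_commuting_void : has_commuting void.
Proof.
move=> Z R m dR mM [F [FU Fi FR]]; exists F; split=> //.
move=> Z' S m' dS m'M a _; have [QU _ Qd] := Q1.
have eqa (x : void -> U) : x = a by apply: funext => -[].
have E : F [set x | S (tcat x (tcat d m'))] <-> S (tcat a (tcat d m')).
  split=> [/filter_ex[x]|Sa]; first by rewrite (eqa x).
  by apply: filterE => x; rewrite /= (eqa x).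
apply: (iff_trans E); apply: iff_sym.
pose S' (e : 'I_k + Z' -> U) := S (tcat a e).
have dS' : dfn S'.
  pose f (t : void + ('I_k + Z')) := match t with inl x => of_void _ x | inr y => y end.
  by apply: (dfn_sub (f := f)) dS => e [[]|].
exact: (realsP QU Qd dS' m'M).
Qed.

Lemma has_commuting_option (X' : finType) : has_commuting X' -> has_commuting (option X').
Proof.
move=> IH Z R m dR mM [F [FU Fi FR]].
(* With [d] replaced by its copy, all parameters [m2] lie in [M1], where [morley1] applies. *)
have [d' d'M dd'] := copies_fin mM.
pose n := #|{: Z + 'I_k}|; pose m2 : 'I_n -> U := tcat m d' \o enum_val.
have m2M : tuple_in M1 m2.
  by move=> i; rewrite /m2 /=; case: (enum_val i) => z; [exact: mM|exact: d'M].
have m2E h : m2 (enum_rank h) = tcat m d' h by rewrite /m2 /= enum_rankK.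
pose i1 (t : option X' + ('I_k + Z)) : option X' + 'I_n := match t with
  | inl x => inl x | inr (inl i) => inr (enum_rank (inr i : Z + 'I_k))
  | inr (inr z) => inr (enum_rank (inl z : Z + 'I_k)) end.
pose R2 (e : option X' + 'I_n -> U) := R (e \o i1).
have dR2 : dfn R2 by apply: (dfn_sub (f := i1)) dR.
have R2E x : R2 (tcat x m2) <-> R (tcat x (tcat d' m)).
  rewrite /R2 (_ : _ \o i1 = tcat x (tcat d' m)) //.
  by apply: funext => -[|[i|z]] //=; rewrite -[LHS]/(m2 _) m2E.
have dmE : eqM (tcat d m) (tcat d' m).
  pose f (t : 'I_k + Z) := match t with inl i => inr i | inr z => inl z end.
  by apply: (eqM_subE (f := f) _ _ (eqM_sym dd')) => -[].
have [s [ms sM s0]] := morley1 m2M.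
have Fs i : F [set x | R2 (tcat x (s i))].
  apply: (Fi _ _ _ _ dR2 (strict_morley_eqM ms i)).
  by apply: filterS (Fi _ _ _ _ dR dmE FR) => x /R2E.
pose sj (z : 'I_2 * 'I_n) := s z.1 z.2.
pose F' := [set P : set (X' -> U) | F [set x : option X' -> U | P (x \o Some)]].
have FU' : UltraFilter F' := ultra_image FU (fun x => x \o Some).
have Fi' : inv F' := inv_image Fi.
have F's : F' [set x | solvable R2 (tcat x sj)].
  rewrite /F' /=; apply: filterS (filterI (Fs 0) (Fs 1)) => x [x0 x1].
  have extE : extend (x \o Some) (x None) = x by apply: funext => -[].
  by exists (x None) => -[[|[|]] //= h]; rewrite -[_ \o inl]/(x \o Some) extE.
pose R3 (e : X' + ('I_k + 'I_2 * 'I_n) -> U) := solvable R2 (tcat (e \o inl) (e \o inr \o inr)).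
have dR3 : dfn R3.
  pose f (t : X' + 'I_2 * 'I_n) : X' + ('I_k + 'I_2 * 'I_n) :=
    match t with inl x => inl x | inr z => inr (inr z) end.
  by apply: (dfn_sub (f := f)) (dfn_solvable 2 dR2) => e [].
have [z|p' [pU' pi' cp' p's]] := IH _ R3 sj dR3 _ (ex_intro _ F' (And3 FU' Fi' F's)).
  exact: sM.
have [G [GU Gi Ge GR]] := strict_extension ms pU' pi' dR2 p's.
have eG : inv_extension p' G by [].
have GR' : G [set x | R (tcat x (tcat d m))].
  by apply: (Gi _ _ _ _ dR (eqM_sym dmE)); apply: filterS GR => x /R2E.
have [|H [[HU Hi _] cH HR]] := @generic_extension _ _ pU' pi' cp' [set x | R (tcat x (tcat d m))].
  by split; [exists Z, R, m|exists G].
by exists H.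
Qed.

Lemma has_commuting_opt n : has_commuting (opt n).
Proof. by elim: n => [|n IH]; [exact: has_commuting_void|exact: has_commuting_option]. Qed.

Lemma has_commuting_bij (X Y : finType) (h : X -> Y) (h' : Y -> X) :
  cancel h h' -> cancel h' h -> has_commuting X -> has_commuting Y.
Proof.
move=> hK h'K cX Z R m dR mM [F [FU Fi FR]].
pose f (t : Y + ('I_k + Z)) : X + ('I_k + Z) :=
  match t with inl x => inl (h' x) | inr y => inr y end.
pose R' (e : X + ('I_k + Z) -> U) := R (tcat (e \o inl \o h') (e \o inr)).
have dR' : dfn R' by apply: (dfn_sub (f := f)) dR => e [].
have xE (x : Y -> U) : (x \o h) \o h' = x by apply: funext => y /=; rewrite h'K.
have [|G [GU Gi Gc GR]] := cX Z R' m dR' mM.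
  exists [set P : set (X -> U) | F [set y : Y -> U | P (y \o h)]]; split.
  - exact: ultra_image.
  - exact: inv_image.
  - by apply: (@filterS _ F _ _ _ _ FR) => y; rewrite /R' /= -[_ \o h']/((y \o h) \o h') xE.
exists [set P : set (Y -> U) | G [set x : X -> U | P (x \o h')]]; split=> //.
- exact: ultra_image.
- exact: inv_image.
move=> Z' S m' dS m'M a Ga.
pose f' (t : Y + ('I_k + Z')) : X + ('I_k + Z') :=
  match t with inl x => inl (h' x) | inr y => inr y end.
pose S' (e : X + ('I_k + Z') -> U) := S (tcat (e \o inl \o h') (e \o inr)).
have dS' : dfn S' by apply: (dfn_sub (f := f')) dS => e [].
have Ga' : reals G M1 (a \o h).
  move=> V T b dT bM GT.
  pose T' (e : Y + V -> U) := T (tcat (e \o inl \o h) (e \o inr)).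
  pose g (t : X + V) : Y + V := match t with inl x => inl (h x) | inr y => inr y end.
  have dT' : dfn T' by apply: (dfn_sub (f := g)) dT => e [].
  apply: (Ga _ T' b dT' bM) => /=; apply: filterS GT => x.
  by rewrite /T' /= (_ : _ \o h = x) //; apply: funext => i /=; rewrite hK.
have := Gc _ S' m' dS' m'M _ Ga'.
rewrite (_ : [set y | S' _] = [set y | S (tcat a (tcat y m'))]) //.
by apply/seteqP; split=> y; rewrite /S' /= -[_ \o h']/((a \o h) \o h') xE.
Qed.

Lemma has_commuting_ord n : has_commuting 'I_n.
Proof.
suff E : exists h : opt n -> 'I_n, bijective h.
  have [h [h' hK h'K]] := E.
  exact: has_commuting_bij hK h'K (@has_commuting_opt n).
have cE : #|opt n| = n by elim: n => [|n IH] /=; rewrite ?card_void // card_option IH.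
by exists (cast_ord cE \o enum_rank); apply: bij_comp (@enum_rank_bij _);
   exists (cast_ord (esym cE)); [exact: cast_ordK|exact: cast_ordKV].
Qed.

(** * Back from ultrafilters to types of formulas *)

Definition fpform (V : structure L) X (W : finType) (f : formula L (X + W)) (c : W -> V) :
    pform V X :=
  Pform (frename f (fun t => match t with inl x => inl x | inr w => inr (enum_rank w) end))
    (c \o @enum_val W predT).

Lemma psat_fpform (V : structure L) X (W : finType) (f : formula L (X + W)) (c : W -> V) a :
  psat a (fpform f c) <-> sat (tcat a c) f.
Proof.
rewrite /psat /= sat_rename.
by split; apply: sat_ext => -[x|w] //=; rewrite enum_rankK.
Qed.

Lemma pf_over_fpform (V : structure L) X (W : finType) (f : formula L (X + W)) (c : W -> V)
    A : tuple_in A c -> pf_over A (fpform f c).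
Proof. by move=> cA i; exact: cA. Qed.

Lemma filter_realizes X (F : set_system (X -> U)) (s : set (pform U X)) : Filter F ->
  finite_set s -> (forall phi, s phi -> F [set a | psat a phi]) -> F [set a | realizes a s].
Proof.
move=> FF /(@finite_seqP {classic (pform U X)})[t ->].
elim: t => [|phi t IH] H; first by apply: filterE => a phi; rewrite /= in_nil.
have Ft : F [set a | realizes a [set` t]].
  by apply: IH => psi t_psi; apply: H; rewrite /= in_cons t_psi orbT.
have Fphi : F [set a | psat a phi] by apply: H; rewrite /= in_cons eqxx.
apply: filterS (filterI Fphi Ft) => a [aphi at_] psi /=; rewrite in_cons.
by move=> /orP[/eqP ->|/at_].
Qed.

Definition filter_type X (F : set_system (X -> U)) : set (pform U X) :=
  [set phi | F [set a | psat a phi]].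

Lemma filter_type_complete X (F : set_system (X -> U)) :
  UltraFilter F -> complete_type setT (filter_type F).
Proof.
move=> FU; split; first split => //.
  move=> s fs sF; have /filter_ex[a sa] : F [set a | realizes a s] by exact: filter_realizes.
  by exists a.
by move=> phi _; have [?|/(ultra_not FU) ?] := pselect (F [set a | psat a phi]); [left|right].
Qed.

Lemma filter_type_inv X (F : set_system (X -> U)) N :
  inv F -> invariant_type M N (filter_type F).
Proof.
move=> iF l phi b c _ _ bc.
by apply: (inv_iff (R := fun e => sat e phi)) => //; [exact: dfn_sat|exact/eqM_tp].
Qed.

Lemma filter_type_reals (X : finType) (F : set_system (X -> U)) A a : UltraFilter F ->
  reals F A a -> tp a A `<=` filter_type F.
Proof.
move=> FU Fa [l phi m] [mA aphi].
exact: (proj2 (realsP FU Fa (dfn_sat phi) mA) aphi).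
Qed.

Lemma finsat_fsat (X : finType) A (a : X -> U) : sub_set M `<=` A ->
  finsat_in M (tp a A) -> fsat A a.
Proof.
move=> MA fs Y R c [phi phiE] cA Ra; have [u0 Mu0] := sub_nonempty M.
have [l [psi [g H]]] := parametric_formula (exist _ u0 Mu0 : induced M) phi.
have HE x : R (tcat x c) <-> psat x (Pform psi (tcat c (@sval _ _) \o g)).
  by rewrite phiE; exact: H.
have [|_ [-> ]|a' a'M Ha'] := fs [set Pform psi (tcat c (@sval _ _) \o g)].
- exact: finite_set1.
- split; last exact/HE.
  by move=> i /=; case: (g i) => [y|[u Mu]] /=; [exact: cA|exact: MA].
- by exists a' => //; apply/HE; exact: Ha'.
Qed.

Lemma coheir_ultra (q : set (pform U 'I_k)) : coheir M d q -> tp d M1 `<=` q ->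
  exists F, coheir1 F /\ filter_type F = q.
Proof.
move=> [[[_ _] qc] _ fq] dq.
pose D := [set P : set ('I_k -> U) | exists2 phi, q phi &
  P = [set y | tuple_in M y /\ psat y phi]].
have mD P : meets D P -> exists s, [/\ finite_set s, s `<=` q &
    forall y, tuple_in M y -> realizes y s -> P y].
  elim=> [|P1 P2 [phi qphi ->] _ [s [fs sq sP]]].
    by exists set0; split=> //; exact: finite_set0.
  exists ([set phi] `|` s); split; first by rewrite finite_setU; split=> //; exact: finite_set1.
    by move=> psi [->|/sq].
  move=> y yM ys; split; first by split=> //; apply: ys; left.
  by apply: sP => // psi spsi; apply: ys; right.
have [|F [FU DF]] := @meets_ultra _ D.
  by move=> P /mD[s [fs sq sP]]; have [y yM ys] := fq s fs sq; exists y; exact: sP.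
have qF phi : q phi -> F [set y | tuple_in M y /\ psat y phi].
  by move=> qphi; apply: DF; exists phi.
have FE : filter_type F = q.
  apply/seteqP; split=> phi; last by move=> /qF; apply: filterS => y [].
  move=> Fphi; have [//|/qF nq] := qc phi (fun _ => I).
  by have [y [ys [_ ny]]] := filter_ex (filterI Fphi nq); case: (ny ys).
exists F; split=> //; split=> //.
  (* A tautology or its negation lies in [q], and either puts the tuples of [M] into [F]; [d] fills
     an empty tuple of parameters. *)
  have [/qF|/qF] := qc (Pform (Imp Bot Bot : formula L ('I_k + 'I_0)) (fun i => d (widen_ord (leq0n k) i))) (fun _ => I);
  by apply: filterS => y [].
move=> Y R c [phi phiE] cA FR; apply: contrapT => nR.
have [u0 Mu0] := sub_nonempty M.
have [l [psi [g H]]] := parametric_formula (exist _ u0 Mu0 : induced M) phi.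
have HE x : R (tcat x c) <-> psat x (Pform psi (tcat c (@sval _ _) \o g)).
  by rewrite phiE; exact: H.
have /dq/qF nF : tp d M1 (pf_not (Pform psi (tcat c (@sval _ _) \o g))).
  split; last by move=> /HE.
  by move=> i /=; case: (g i) => [y|[u Mu]] /=; [exact: cA|exact: MM1].
by have [y [/HE Ry [_ ny]]] := filter_ex (filterI FR nF); case: (ny Ry).
Qed.

Section Extension.
Variables (V : structure L) (j : U -> V).
Hypothesis ej : elementary j.

(** Provides the parameter in [U] that [inv_ext] asks for when one factor of a product is evaluated
    over the realization [b] of the other. *)
Lemma type_eq_tp (X W : finType) A (p : set (pform U X)) (x0 : X -> U) (b : X -> V)
    (m : W -> U) : sub_set M `<=` A -> tp x0 A `<=` p ->
  (forall phi, p phi -> psat b (pf_map j phi)) -> tuple_in A m ->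
  eq_tp (j @` M) (j \o tcat x0 m) (tcat b (j \o m)).
Proof.
move=> MA xp pb mA.
have half phi : pf_over (j @` M) phi ->
    psat (j \o tcat x0 m) phi -> psat (tcat b (j \o m)) phi.
  case: phi => r g e /= eM.
  have /choice[e0 e0E] : forall i, exists u, sub_set M u /\ j u = e i.
    by move=> i; have [u Mu uE] := eM i; exists u.
  have -> : e = j \o e0 by apply: funext => i /=; rewrite (e0E i).2.
  pose f (t : (X + W) + 'I_r) : X + (W + 'I_r) := match t with
    inl (inl x) => inl x | inl (inr w) => inr (inl w) | inr i => inr (inr i) end.
  have fE (S : structure L) (x : X -> S) y z : tcat (tcat x y) z = tcat x (tcat y z) \o f.
    by apply: funext => -[[]|].
  rewrite /psat /= -tcat_comp => /ej; rewrite fE => xg.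
  have : tp x0 A (fpform (frename g f) (tcat m e0)).
    split; last exact/psat_fpform/sat_rename.
    by apply: pf_over_fpform => -[w|i]; [exact: mA|apply: MA; exact: (e0E i).1].
  move=> /xp/pb; rewrite -[pf_map _ _]/(fpform (frename g f) (j \o tcat m e0)).
  by move=> /psat_fpform/sat_rename; rewrite tcat_comp -fE.
apply/seteqP; split=> phi [oM sphi]; split=> //; first exact: half.
apply: contrapT => nphi; exact: (half (pf_not phi) oM nphi).
Qed.

Lemma inv_ext_sat (X W : finType) (p : set (pform U X)) (B : set V)
    (a : X -> V) (f : formula L (X + W)) (c : W -> U) (v : W -> V) :
  complete_type setT p -> realizes a (inv_ext j M p B) ->
  eq_tp (j @` M) (j \o c) v -> tuple_in B v ->
  p (fpform f c) <-> sat (tcat a v) f.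
Proof.
move=> [_ cp] pa cv vB.
have H g : p (fpform g c) -> sat (tcat a v) g.
  move=> pg; apply/psat_fpform; apply: pa; split; first exact: pf_over_fpform.
  by exists (c \o @enum_val W predT) => //; exact: (eq_tp_sub (@enum_val W predT) cv).
split; first exact: H.
move=> af; have [//|/(H (Not f)) naf] := cp (fpform f c) (fun _ => I); case: (naf af).
Qed.

End Extension.

(** Both products are computed inside [U]: one as [F] on formulas about [d], the other as [q] on
    formulas about a realization [a0] of [F] over [M1]. They agree by [comm] for the coheir [Q],
    which [coheir1_unique] identifies with [q]. *)
Lemma comm_commute_over (n : nat) (F : set_system ('I_n -> U)) (q : set (pform U 'I_k)) :
  UltraFilter F -> inv F -> comm F -> coheir M d q -> tp d M1 `<=` q ->
  commute_over M M1 (filter_type F) q.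
Proof.
move=> FU Fi Fc qd dq V V' j j' a b a' b' ej ej' [qb Fa] [Fa' qb'] [l f m] /= mM.
have [Q' [Q1' qE]] := coheir_ultra qd dq; have [QU _ _] := Q1.
have [qc _ _] := qd; have [a0 Fa0] := reals_ex (F := F) _ countM1.
pose f1 (t : ('I_n + 'I_k) + 'I_l) : 'I_n + ('I_k + 'I_l) := match t with
  inl (inl x) => inl x | inl (inr y) => inr (inl y) | inr i => inr (inr i) end.
pose f2 (t : ('I_n + 'I_k) + 'I_l) : 'I_k + ('I_n + 'I_l) := match t with
  inl (inl x) => inr (inl x) | inl (inr y) => inl y | inr i => inr (inr i) end.
have f1E (S : structure L) (x : 'I_n -> S) (y : 'I_k -> S) z :
    sat (tcat (tcat x y) z) f <-> sat (tcat x (tcat y z)) (frename f f1).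
  by rewrite sat_rename; split; apply: sat_ext => -[[]|].
have f2E (S : structure L) (x : 'I_n -> S) (y : 'I_k -> S) z :
    sat (tcat (tcat x y) z) f <-> sat (tcat y (tcat x z)) (frename f f2).
  by rewrite sat_rename; split; apply: sat_ext => -[[]|].
have H1 : psat (tcat a b) (Pform f (j \o m)) <->
    F [set x | sat (tcat x (tcat d m)) (frename f f1)].
  rewrite /psat /= f1E.
  rewrite -(inv_ext_sat (frename f f1) (filter_type_complete FU) Fa
    (type_eq_tp ej MM1 dq qb mM)); last first.
    by move=> [y|i]; [right; exists y|left; exists (m i)].
  by split; apply: filterS => x /psat_fpform.
have H2 : psat (tcat a' b') (Pform f (j' \o m)) <->
    q (fpform (frename f f2) (tcat a0 m)).
  rewrite /psat /= f2E.
  rewrite -(inv_ext_sat (frename f f2) qc qb'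
    (type_eq_tp ej' MM1 (filter_type_reals FU Fa0) Fa' mM)) //.
  by move=> [y|i]; [right; exists y|left; exists (m i)].
rewrite H1 H2 -qE.
apply: iff_trans (Fc _ _ _ (dfn_sat (frename f f1)) mM _ Fa0) _.
have dS := dfn_sat (frename f f2).
split=> [H|H].
  have {}H : Q [set y | sat (tcat y (tcat a0 m)) (frename f f2)].
    by apply: filterS H => y; rewrite /= -f1E f2E.
  have := coheir1_unique (u := tcat a0 m) Q1 Q1' dS H.
  by have [QU' _ _] := Q1'; apply: filterS => y /psat_fpform.
have [QU' _ _] := Q1'.
have {}H : Q' [set y | sat (tcat y (tcat a0 m)) (frename f f2)].
  by apply: filterS H => y /psat_fpform.
have := coheir1_unique (u := tcat a0 m) Q1' Q1 dS H.
by apply: filterS => y; rewrite /= -f2E f1E.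
Qed.

Lemma nonforking_commuting n (phi : formula L ('I_n + 'I_k)) : ~ forks M (Pform phi d) ->
  exists F : set_system ('I_n -> U),
    [/\ UltraFilter F, inv F, comm F & F [set x | psat x (Pform phi d)]].
Proof.
move=> /nonforking_invariant[F [FU Fi Fphi]].
pose f (t : 'I_n + 'I_k) : 'I_n + ('I_k + void) :=
  match t with inl x => inl x | inr y => inr (inl y) end.
pose R (e : 'I_n + ('I_k + void) -> U) := sat (e \o f) phi.
have dR : dfn R by apply: (dfn_sub (f := f)) (dfn_sat phi).
have RE x : R (tcat x (tcat d (of_void U))) <-> sat (tcat x d) phi.
  by rewrite /R (_ : _ \o f = tcat x d) //; apply: funext => -[].
have [||G [GU Gi Gc GR]] := has_commuting_ord (n := n) (m := of_void U) dR; first by case.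
  by exists F; split=> //; apply: filterS Fphi => x /RE.
by exists G; split=> //; apply: filterS GR => x /RE.
Qed.

End Commuting.
End Definable.

Theorem theorem6p5 (L : language) (T : set (sentence L))
  (K : Type) (U : structure L)
  (countL : countable_language L) (completeT : complete_theory T)
  (monsterU : monster K U) (modelU : models U T) (dpT : dp_minimal K U)
  (M M1 N : substructure U)
  (MN : elem_sub M N) (NU : elem_sub_in N)
  (smallM : small K M) (smallN : small K N)
  (countM : countable M)
  (satN : @saturated L (induced N) (fun A : set (induced N) => countable A))
  (n k : nat) (phi : formula L ('I_n + 'I_k)) (d : 'I_k -> U)
  (dN : tuple_in N d)
  (nfphi : ~ forks M (Pform phi d))
  (MM1 : elem_sub M M1) (M1N : elem_sub M1 N)
  (countM1 : countable M1)
  (finsat_d : finsat_in M (tp d M1))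
  (copies_d : forall (l : nat) (m : 'I_l -> U), tuple_in M1 m ->
     exists2 d' : 'I_k -> U, tuple_in M1 d' & eq_tp M (tcat m d') (tcat m d))
  (morley : forall (l : nat) (m : 'I_l -> U), tuple_in M1 m ->
     exists s : nat -> 'I_l -> U,
       [/\ strict_morley M m s, forall i, tuple_in M1 (s i) & s 0 = m]) :
  exists a : 'I_n -> U,
    [/\ psat a (Pform phi d),
        invariant_type M N (tp a N) &
        exists p : set (pform U 'I_n),
          [/\ complete_type setT p, invariant_type M setT p, restrict_type p N = tp a N &
              forall q : set (pform U 'I_k),
                coheir M d q -> tp d M1 `<=` q -> commute_over M M1 p q]].
Proof.
have [MNs eMN] := MN; have [MM1s _] := MM1.
have MU : elem_sub_in M by move=> V psi e; exact: iff_trans (eMN V psi e) (NU V psi _).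
have copies l (m : 'I_l -> U) : tuple_in M1 m ->
    exists2 d' : 'I_k -> U, tuple_in M1 d' & eqM M (tcat m d') (tcat m d).
  by move=> /copies_d[d' d'M /eqM_tp E]; exists d'.
have [Q Q1] := fsat_coheir (finsat_fsat MM1s finsat_d).
have [F [FU Fi Fc Fphi]] := nonforking_commuting monsterU countM MU dpT MM1s countM1 copies Q1 countL morley nfphi.
have [_ _ satU _] := monsterU; have [[_ fp] cp] := filter_type_complete FU.
have [|a pa] := satU N smallN n (restrict_type (filter_type F) N).
  by split=> [psi []|s fs sp] //; apply: fp => // psi /sp[].
have pE : restrict_type (filter_type F) N = tp a N.
  apply/seteqP; split=> psi; first by move=> p_psi; split; [case: p_psi|exact: pa].
  move=> [oN apsi]; split=> //; have [//|npsi] := cp psi (fun _ => I).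
  by case: (pa (pf_not psi) (conj npsi oN)).
exists a; split.
- by apply: pa; split.
- rewrite -pE => l psi b c bN cN bc.
  have := filter_type_inv (N := N) Fi psi bN cN bc.
  by rewrite /restrict_type /= => E; split=> -[/E].
- exists (filter_type F); split; [exact: filter_type_complete|exact: filter_type_inv|by []|].
  move=> q qd dq.
  exact (comm_commute_over monsterU countM dpT MM1s countM1 copies Q1 FU Fi Fc qd dq).
Qed.
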